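(* Let $f\in\mathrm{End}(\mathbb{P}^1)^{+}$ be an endomorphism of the projective line over $\mathbb{C}$ which is not conjugate to a power map. Then there exists an integer $N\ge 1$ such that $C(f^{\infty})=C(f^{N})$.
   Context: $\mathrm{End}(\mathbb{P}^1)^{+}$ is the semigroup (under composition, written multiplicatively, with $f^n$ the $n$-th iterate) of dominant (i.e. non-constant) endomorphisms of $\mathbb{P}^1$ over $\mathbb{C}$. For $f\in\mathrm{End}(\mathbb{P}^1)^{+}$, $C(f)=\{g\in\mathrm{End}(\mathbb{P}^1)^{+}\mid gf=fg\}$ and $C(f^{\infty})=\bigcup_{n\ge 1}C(f^n)$. A power map is an endomorphism of the form $z\mapsto z^{\pm d}$ with $d\ge1$; conjugate means conjugate by an automorphism of $\mathbb{P}^1$. *)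

(* Defs.v *)
From HB Require Import structures.
From mathcomp Require Import all_boot all_order all_algebra.
From mathcomp Require Import classical_sets reals.
From mathcomp Require Import complex.

Set Implicit Arguments.
Unset Strict Implicit.
Unset Printing Implicit Defensive.

Import Order.TTheory GRing.Theory Num.Theory.

Local Open Scope classical_set_scope.
Local Open Scope ring_scope.
Local Open Scope complex_scope.

(* P^1(F) = F u {oo}, with None standing for oo. *)
Definition P1 (F : fieldType) : Type := option F.

(* The point [x : y]; meaningful only when (x, y) != (0, 0). *)
Definition hpt (F : fieldType) (x y : F) : P1 F :=
  if y == 0 then None else Some (x / y).

Lemma hpt_surj (F : fieldType) (z : P1 F) :
  exists x y : F, (x, y) != (0, 0) /\ z = hpt x y.
Proof.
case: z => [z|].
- by exists z, 1; rewrite xpair_eqE oner_eq0 andbF /hpt oner_eq0 divr1.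
- by exists 1, 0; rewrite xpair_eqE oner_eq0 /hpt eqxx.
Qed.

Lemma hpt_eq (F : fieldType) (x y x' y' : F) :
  (x, y) != (0, 0) -> (x', y') != (0, 0) ->
  hpt x y = hpt x' y' <-> x * y' = x' * y.
Proof.
rewrite !xpair_eqE /hpt => h h'.
have [y0|y0] := eqVneq y 0; have [y'0|y'0] := eqVneq y' 0.
- by rewrite y0 y'0 !mulr0.
- move: h; rewrite y0 eqxx andbT mulr0 => x0; split=> // /eqP.
  by rewrite mulf_eq0 (negPf x0) (negPf y'0).
- move: h'; rewrite y'0 eqxx andbT mulr0 => x0; split=> // /esym/eqP.
  by rewrite mulf_eq0 (negPf x0) (negPf y0).
- split=> [[] /eqP|/eqP]; first by rewrite eqr_div // => /eqP.
  by rewrite -eqr_div // => /eqP ->.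
Qed.

(* The value at (x, y) of the binary form of degree d obtained by homogenizing
   a polynomial p of degree at most d. *)
Definition form (F : fieldType) (d : nat) (p : {poly F}) (x y : F) : F :=
  \sum_(i < d.+1) p`_i * x ^+ i * y ^+ (d - i).

(* A morphism from P^1 to itself is given in homogeneous coordinates by two
   binary forms of the same degree without common zero.  As C = R[i] is
   infinite, such a morphism is determined by the map it induces on points. *)
Definition endomorphism (R : realType) (f : P1 R[i] -> P1 R[i]) : Prop :=
  exists (d : nat) (p q : {poly R[i]}),
    [/\ (size p <= d.+1)%N, (size q <= d.+1)%N,
        forall x y : R[i], (x, y) != (0, 0) ->
          (form d p x y, form d q x y) != (0, 0)
      & forall x y : R[i], (x, y) != (0, 0) ->
          f (hpt x y) = hpt (form d p x y) (form d q x y)].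

Definition End_plus (R : realType) : set (P1 R[i] -> P1 R[i]) :=
  [set f | endomorphism f /\ ~ exists c, forall z, f z = c].

Definition centralizer (R : realType) (f : P1 R[i] -> P1 R[i]) :
    set (P1 R[i] -> P1 R[i]) :=
  [set g | End_plus g /\ g \o f = f \o g].

Definition centralizer_infty (R : realType) (f : P1 R[i] -> P1 R[i]) :
    set (P1 R[i] -> P1 R[i]) :=
  \bigcup_(n in [set n : nat | (1 <= n)%N]) centralizer (iter n f).

Definition power_map (R : realType) (f : P1 R[i] -> P1 R[i]) : Prop :=
  exists d : nat, (1 <= d)%N /\
    ((forall x y : R[i], (x, y) != (0, 0) ->
        f (hpt x y) = hpt (x ^+ d) (y ^+ d)) \/
     (forall x y : R[i], (x, y) != (0, 0) ->
        f (hpt x y) = hpt (y ^+ d) (x ^+ d))).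

(* u is an automorphism with inverse v. *)
Definition automorphism (R : realType) (u v : P1 R[i] -> P1 R[i]) : Prop :=
  [/\ endomorphism u, endomorphism v, u \o v = id & v \o u = id].

Definition conjugate (R : realType) (f g : P1 R[i] -> P1 R[i]) : Prop :=
  exists u v : P1 R[i] -> P1 R[i], automorphism u v /\ f = u \o g \o v.

(* Main.v *)
Require Import Defs.
From HB Require Import structures.
From mathcomp Require Import all_boot all_order all_algebra.
From mathcomp Require Import boolp classical_sets reals.
From mathcomp Require Import complex.
From mathcomp Require cyclic.
From mathcomp Require Import zify ring.

Set Implicit Arguments.
Unset Strict Implicit.
Unset Printing Implicit Defensive.

Import Order.TTheory GRing.Theory Num.Theory.

(** The exponent [N] has to depend on [f] only: the task is to find, for every
    [g] commuting with some iterate [iter n f], an exponent independent of [g]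
    and [n] with which [g] commutes already.  The argument is algebraic.  It
    uses the local degree [mult f z] and the leading coefficient [lead f z] of
    the Taylor expansion of [f] at [z], the count of fibres with multiplicity
    and the Riemann-Hurwitz formula ([fibre], [critical]), and the fact that two
    morphisms agreeing at many points, or to high order at one point, are equal
    ([coincidence], [first_diff]).  The cases are distinguished by the fate of
    the critical points of [f].

    Some critical point has an infinite orbit
    ([stabilizes_infinite_critical_orbit]).  The total ramification of [f] along
    infinite orbits is bounded; let [M] be its maximum and [Z] the set of points
    of infinite orbit where it is attained.  Preimages under [g], and under
    [f], of points of [Z] lie in [Z], and every point of [Z] is carried by [f]
    to a critical point of [Z].  Fix [c] in [Z]; for each [j] choose a [j]-th
    preimage of [c], then a [g]-preimage of that, and push it forward to a
    critical point.  Among [r + 1] values of [j], where [r] is the number of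
    critical points, two lead to the same critical point, and along the orbit
    of that point [g] intertwines two iterates of [f], which are equal for
    reasons of degree.  So [g] commutes with [iter t f] for some [0 < t <= r],
    and [N = r`!] will do.

    All critical points are preperiodic and one of them lands on a cycle that is
    not superattracting ([stabilizes_repelling_landing]).  The points of such
    cycles form a finite set preserved by every [g]; an iterate of [f] fixes it
    pointwise with multipliers equal to 1 or of infinite order.  There a germ
    that intertwines [n]-th iterates intertwines the maps themselves as soon as
    the multipliers correspond ([rigid_linear]), and this correspondence holds
    from an exponent that can be chosen uniformly ([stabilizes_finite_set]).
    Maps of degree one are treated in the same way with the set of all periodic
    points, unless an iterate is the identity.

    All critical points land on superattracting cycles
    ([stabilizes_superattracting_landing]).  After passing to an iterate, the
    finite set [A] of superattracting periodic points is fixed pointwise.  If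
    all points of [A] have finite backward orbits, then the union of these
    orbits is a finite set containing the critical points and equal to its own
    preimage; by Riemann-Hurwitz it consists of two totally ramified points and
    [f] is conjugate to a power map ([exceptional_power]).  This is the only
    place where the hypothesis on [f] enters.  Otherwise some [p'] in [A] has an
    infinite backward orbit.  A map commuting with an iterate of [f] is
    determined by the leading term of its germ at a point of [A]
    ([rigid_super]), and the leading coefficients, normalized so that those of
    [f] are 1, are roots of unity ([nlead_root_of_unity]).  The powers of [g]
    carry [p'] to a cycle; on it [g] commutes with [iter t f] exactly when its
    coefficient [c] satisfies [c ^+ (k ^ t) = c], where [k] is the local degree
    of [f].  So it suffices to bound the order [R] of [eta = c ^+ k.-1].  One
    builds, from [f] and [g], commuting maps [h] and [G] fixing a point [p] of
    the cycle, with the same local degree, whose leading coefficients differ by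
    the factor [eta] and with [iter R h = iter R G]: [h] is [G] followed by a
    rotation of order [R] of the local coordinate.  The rational functions [r]
    with [r \o h = r \o G] form a field, which contains the [R]-th power of a
    Lagrange resolvent ([resolvent]) and is therefore, by Lueroth's theorem
    ([lueroth]), generated by one function [b].  The field is stable under composition
    with [f], so [b \o f = Phi \o b], and all preimages under [b] of [b p] have
    multiplicity at least [R].  Riemann-Hurwitz for [b] then makes the backward
    orbit of [p] finite if [R >= 3 * deg f ^ 2] ([rotation_order]).  Hence
    [R < 3 * deg f ^ 2] and [N = (3 * deg f ^ 2)`!] will do. *)

(* Binary forms are meant, not sesquilinear ones. *)
Local Notation form := Defs.form.

(** * Binary forms and morphisms *)

Section Forms.
Local Open Scope ring_scope.
Variable F : fieldType.
Implicit Types (p q A B : {poly F}) (x y c : F) (d e : nat).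

Lemma form_neq0 d p x y : (size p <= d.+1)%N -> y != 0 ->
  form d p x y = y ^+ d * p.[x / y].
Proof.
move=> sp y0; rewrite (horner_coef_wide _ sp) /form big_distrr /=.
apply: eq_bigr => i _; rewrite expr_div_n.
have -> : y ^+ d = y ^+ (d - i) * y ^+ i by rewrite -exprD subnK // -ltnS.
have yi : y ^+ i != 0 by rewrite expf_neq0.
by field.
Qed.

Lemma form_y0 d p x : form d p x 0 = p`_d * x ^+ d.
Proof.
rewrite /form big_ord_recr /= subnn expr0 mulr1 big1 ?add0r // => i _.
by rewrite expr0n subn_eq0 leqNgt ltn_ord mulr0.
Qed.

Lemma form_y1 d p x : (size p <= d.+1)%N -> form d p x 1 = p.[x].
Proof. by move=> sp; rewrite form_neq0 ?oner_eq0 // expr1n mul1r divr1. Qed.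

Lemma form_lin d p q a b x y :
  form d (a *: p + b *: q) x y = a * form d p x y + b * form d q x y.
Proof.
rewrite /form !big_distrr /= -big_split /=; apply: eq_bigr => i _.
by rewrite coefD !coefZ; ring.
Qed.

Lemma size_formM d e p q : (size p <= d.+1)%N -> (size q <= e.+1)%N ->
  (size (p * q)%R <= (d + e).+1)%N.
Proof.
move=> sp sq; apply: leq_trans (size_polyMleq _ _) _.
by lia.
Qed.

Lemma coef_formM d e p q : (size p <= d.+1)%N -> (size q <= e.+1)%N ->
  (p * q)`_(d + e) = p`_d * q`_e.
Proof.
move=> sp sq; rewrite coefM.
have hd : (d < (d + e).+1)%N by lia.
rewrite (bigD1 (Ordinal hd)) //= addKn big1 ?addr0 // => i ine.
have ne : (i : nat) != d.
  by apply: contra_neq ine => id; apply: val_inj.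
have [lt|le] := ltnP i d.
  by rewrite [q`_ _]nth_default ?mulr0 //; apply: leq_trans sq _; lia.
by rewrite nth_default ?mul0r //; apply: leq_trans sp _; lia.
Qed.

Lemma formM d e p q x y : (size p <= d.+1)%N -> (size q <= e.+1)%N ->
  form (d + e) (p * q) x y = form d p x y * form e q x y.
Proof.
move=> sp sq; have [->|y0] := eqVneq y 0.
  by rewrite !form_y0 coef_formM // exprD; ring.
rewrite !form_neq0 ?size_formM // hornerM exprD; ring.
Qed.

Lemma size_formX d p n : (size p <= d.+1)%N -> (size (p ^+ n)%R <= (d * n).+1)%N.
Proof.
move=> sp; elim: n => [|n IH]; first by rewrite expr0 size_poly1 muln0.
by rewrite exprS mulnS size_formM.
Qed.

Lemma formX d p n x y : (size p <= d.+1)%N ->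
  form (d * n) (p ^+ n) x y = form d p x y ^+ n.
Proof.
move=> sp; elim: n => [|n IH].
  by rewrite muln0 !expr0 /form big_ord1 coef1 /= !expr0 !mulr1.
by rewrite !exprS mulnS formM ?IH ?size_formX.
Qed.

Lemma form_sum (I : Type) (r : seq I) d (a : I -> F) (P : I -> {poly F}) x y :
  form d (\sum_(i <- r) a i *: P i) x y = \sum_(i <- r) a i * form d (P i) x y.
Proof.
elim: r => [|i r IH].
  rewrite !big_nil /form big1 // => i _.
  by rewrite coef0 !mul0r.
by rewrite !big_cons -IH -[\sum_(j <- r) _ *: _]scale1r form_lin !scale1r mul1r.
Qed.

(** Substitution of the forms of [A] and [B] into the form of [p], on
    dehomogenized polynomials. *)
Definition hcomp d p (A B : {poly F}) : {poly F} :=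
  \sum_(i < d.+1) p`_i *: (A ^+ i * B ^+ (d - i)).

Lemma size_hcomp d e p A B : (size A <= e.+1)%N -> (size B <= e.+1)%N ->
  (size (hcomp d p A B) <= (d * e).+1)%N.
Proof.
move=> sA sB; rewrite /hcomp; apply: leq_trans (size_sum _ _ _) _.
apply/bigmax_leqP => i _; apply: leq_trans (size_scale_leq _ _) _.
have -> : (d * e = e * i + e * (d - i))%N.
  by rewrite -mulnDr subnKC 1?mulnC // -ltnS.
by rewrite size_formM ?size_formX.
Qed.

Lemma form_comp d e p A B x y : (size A <= e.+1)%N -> (size B <= e.+1)%N ->
  form (d * e) (hcomp d p A B) x y = form d p (form e A x y) (form e B x y).
Proof.
move=> sA sB; rewrite /hcomp form_sum [in RHS]/form; apply: eq_bigr => i _.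
have -> : (d * e = e * i + e * (d - i))%N.
  by rewrite -mulnDr subnKC 1?mulnC // -ltnS.
by rewrite formM ?size_formX // !formX // mulrA.
Qed.

Lemma horner_hcomp d p A B x :
  (hcomp d p A B).[x] = form d p A.[x] B.[x].
Proof.
rewrite /hcomp horner_sum; apply: eq_bigr => i _.
by rewrite hornerZ hornerM !horner_exp mulrA.
Qed.

End Forms.

Section Endo.
Local Open Scope ring_scope.
Variable F : numClosedFieldType.
Local Notation P1 := (P1 F).
Implicit Types (p q : {poly F}) (f g u v : P1 -> P1) (z w : P1) (d e : nat).

(** The degree and the two polynomials are arguments, as fibres, critical points
    and germs are computed from them. *)
Definition represents d p q f :=
  [/\ (size p <= d.+1)%N, (size q <= d.+1)%N,
      forall x y : F, (x, y) != (0, 0) -> (form d p x y, form d q x y) != (0, 0)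
    & forall x y : F, (x, y) != (0, 0) ->
        f (hpt x y) = hpt (form d p x y) (form d q x y)].

(** Over [R[i]], [endo] and [End] are convertible to [endomorphism] and
    [End_plus]; everything before the final theorem holds over any
    numClosedFieldType. *)
Definition endo f := exists d p q, represents d p q f.

Definition End f := endo f /\ ~ exists c, forall z, f z = c.

Lemma hpt_x1 (x : F) : hpt x 1 = Some x.
Proof. by rewrite /hpt oner_eq0 divr1. Qed.

Lemma hpt_10 : hpt (1 : F) 0 = None.
Proof. by rewrite /hpt eqxx. Qed.

Lemma pair_x1 (x : F) : (x, 1 : F) != (0, 0).
Proof. by rewrite xpair_eqE oner_eq0 andbF. Qed.

Lemma pair_10 : (1 : F, 0 : F) != (0, 0).
Proof. by rewrite xpair_eqE oner_eq0. Qed.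

Lemma represents_fin d p q f x : represents d p q f ->
  f (Some x) = hpt p.[x] q.[x].
Proof.
move=> [sp sq _ fE].
by rewrite -hpt_x1 fE ?pair_x1 // !form_y1.
Qed.

Lemma represents_inf d p q f : represents d p q f -> f None = hpt p`_d q`_d.
Proof.
move=> [sp sq _ fE]; rewrite -hpt_10 fE ?pair_10 //.
by rewrite !form_y0 !expr1n !mulr1.
Qed.

Lemma represents_finE d p q f x : represents d p q f -> q.[x] != 0 ->
  f (Some x) = Some (p.[x] / q.[x]).
Proof. by move=> /represents_fin-> q0; rewrite /hpt (negPf q0). Qed.

Lemma represents_no_root d p q f x : represents d p q f ->
  p.[x] = 0 -> q.[x] != 0.
Proof.
move=> [sp sq nz _] px; have := nz x 1 (pair_x1 _).
by rewrite !form_y1 // px xpair_eqE eqxx.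
Qed.

Lemma represents_coprime d p q f : represents d p q f -> coprimep p q.
Proof.
move=> rf; apply: contraT => /closed_rootP [x].
by rewrite root_gcd => /andP[/rootP px /rootP qx];
  have := represents_no_root rf px; rewrite qx eqxx.
Qed.

Lemma represents_top d p q f : represents d p q f -> (p`_d, q`_d) != (0, 0).
Proof.
move=> [sp sq nz _]; have := nz 1 0 pair_10.
by rewrite !form_y0 !expr1n !mulr1.
Qed.

Lemma represents_size d p q f : represents d p q f ->
  maxn (size p) (size q) = d.+1.
Proof.
move=> rf; have [sp sq _ _] := rf; have := represents_top rf.
apply: contraNeq; rewrite neq_ltn gtn_max leq_max !ltnS.
case/orP=> [/andP[pd qd]|]; last by lia.
by rewrite !nth_default.
Qed.

Lemma represents_comp d p q f e p' q' g :
  represents d p q f -> represents e p' q' g ->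
  represents (d * e) (hcomp d p p' q') (hcomp d q p' q') (f \o g).
Proof.
move=> [sp sq nz fE] [sp' sq' nz' gE]; split; rewrite ?size_hcomp //.
  by move=> x y xy; rewrite !form_comp // nz // nz'.
by move=> x y xy; rewrite /= !form_comp // gE // fE // nz'.
Qed.

Lemma endo_comp f g : endo f -> endo g -> endo (f \o g).
Proof.
move=> [d [p [q rf]]] [e [p' [q' rg]]].
by exists (d * e)%N, (hcomp d p p' q'), (hcomp d q p' q'); apply: represents_comp.
Qed.

Lemma poly_eq0_cofinite p (s : seq F) :
  (forall x, x \notin s -> p.[x] = 0) -> p = 0.
Proof.
move=> h; apply/eqP; apply: contraT => p0.
have [r pE] := closed_field_poly_normal p.
pose n := size (r ++ s).
have : (size (undup (r ++ s)) < size (map (fun i : nat => i%:R : F) (iota 0 n.+1)))%N.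
  by rewrite size_map size_iota ltnS size_undup.
rewrite ltnNge => /negP[]; apply: uniq_leq_size.
  by rewrite map_inj_uniq ?iota_uniq // => i j /eqP; rewrite eqr_nat => /eqP.
move=> x /mapP[i _ xE]; rewrite mem_undup mem_cat.
have [//|xs] := boolP (x \in s); first by rewrite orbT.
rewrite orbF; have /rootP := h x xs.
by rewrite pE rootZ ?lead_coef_eq0 // root_prod_XsubC.
Qed.

Lemma cofinite_exists (s : seq F) : exists x, x \notin s.
Proof.
apply/not_existsP => h.
have /eqP : (1 : {poly F}) = 0.
  by apply: (@poly_eq0_cofinite _ s) => x xs; case: (h x).
by rewrite oner_eq0.
Qed.

Lemma rootsP p : p != 0 -> exists s : seq F, forall x, (p.[x] == 0) = (x \in s).
Proof.
move=> p0; have [r pE] := closed_field_poly_normal p; exists r => x.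
by rewrite -[LHS]/(root p x) pE rootZ ?lead_coef_eq0 // root_prod_XsubC.
Qed.

(** An identity between polynomials homogenizes, so that the point at infinity
    needs no separate argument. *)
Lemma represents_cross d p q f e p' q' g :
  represents d p q f -> represents e p' q' g -> p * q' = p' * q -> f = g.
Proof.
move=> rf rg eq; apply/funext => z; have [x [y [xy ->]]] := hpt_surj z.
have [sp sq nz fE] := rf; have [sp' sq' nz' gE] := rg.
rewrite fE // gE //; apply/hpt_eq; rewrite ?nz ?nz' //.
by rewrite -formM // eq addnC formM.
Qed.

Lemma represents_cross_conv d p q f e p' q' (s : seq F) g :
  represents d p q f -> represents e p' q' g ->
  (forall x, x \notin s -> f (Some x) = g (Some x)) -> p * q' = p' * q.
Proof.
move=> rf rg eq; apply/eqP; rewrite -subr_eq0; apply/eqP.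
apply: (@poly_eq0_cofinite _ s) => x xs; have := eq x xs.
rewrite (represents_fin _ rf) (represents_fin _ rg).
have [sp sq nz fE] := rf; have [sp' sq' nz' gE] := rg.
have := nz x 1 (pair_x1 x); have := nz' x 1 (pair_x1 x).
rewrite !form_y1 // => h1 h2 /(hpt_eq h2 h1) e1.
by rewrite hornerD hornerN !hornerM e1 subrr.
Qed.

(** The cross products of numerators and denominators agree at infinitely many
    points. *)
Lemma endo_eq (s : seq F) f g : endo f -> endo g ->
  (forall x, x \notin s -> f (Some x) = g (Some x)) -> f = g.
Proof.
move=> [d [p [q rf]]] [e [p' [q' rg]]] eq.
exact: represents_cross rf rg (represents_cross_conv rf rg eq).
Qed.

(** Coprime fractions with the same values have associate numerators and
    associate denominators. *)
Lemma represents_degree d p q e p' q' f :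
  represents d p q f -> represents e p' q' f -> d = e.
Proof.
move=> rf rg; have eq := represents_cross_conv rf rg (s := [::]) (fun _ _ => erefl).
have cf := represents_coprime rf; have cg := represents_coprime rg.
have pp : p %= p'.
  apply/andP; split.
    by rewrite -(Gauss_dvdpl _ cf) -eq dvdp_mulr.
  by rewrite -(Gauss_dvdpl _ cg) eq dvdp_mulr.
have qq : q %= q'.
  apply/andP; split.
    by rewrite coprimep_sym in cf; rewrite -(Gauss_dvdpr _ cf) eq dvdp_mull.
  by rewrite coprimep_sym in cg; rewrite -(Gauss_dvdpr _ cg) -eq dvdp_mull.
have := represents_size rf.
by rewrite (eqp_size pp) (eqp_size qq) (represents_size rg) => -[].
Qed.

Definition deg f : nat := xget 0%N [set d | exists p q, represents d p q f].

Lemma degP f : endo f -> exists p q, represents (deg f) p q f.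
Proof.
move=> [d rf]; rewrite /deg.
by case: xgetP => [n -> /=|/(_ d)].
Qed.

Lemma deg_eq d p q f : represents d p q f -> deg f = d.
Proof.
move=> rf; have [|p' [q' rg]] := @degP f; first by exists d, p, q.
exact: represents_degree rg rf.
Qed.

Lemma deg_comp f g : endo f -> endo g -> deg (f \o g) = (deg f * deg g)%N.
Proof.
move=> /degP[p [q rf]] /degP[p' [q' rg]].
exact: deg_eq (represents_comp rf rg).
Qed.

Lemma represents_const d p q f : represents d p q f ->
  (exists c, forall z, f z = c) -> d = 0%N.
Proof.
move=> rf [c cE]; have [x [y [xy cxy]]] := hpt_surj c.
suff /(represents_degree rf) : represents 0 x%:P y%:P f by [].
have fc (a : F) (s t : F) : form 0 a%:P s t = a.
  by rewrite /form big_ord1 coefC /= !expr0 !mulr1.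
split; rewrite ?size_polyC_leq1 //.
- by move=> s t _; rewrite !fc.
- by move=> s t _; rewrite !fc cE.
Qed.

Lemma End_deg f : endo f -> End f <-> (0 < deg f)%N.
Proof.
move=> ef; have [p [q rf]] := degP ef; split=> [[_ nc]|dpos].
  rewrite lt0n; apply/negP => /eqP d0; apply: nc; exists (f None) => z.
  have [x [y [xy ->]]] := hpt_surj z.
  rewrite d0 in rf; have [sp sq nz fE] := rf; rewrite fE // (represents_inf rf).
  by rewrite /form !big_ord1 !expr0 !mulr1.
by split=> // /(represents_const rf) d0; rewrite d0 in dpos.
Qed.

End Endo.

(** * Taylor expansions and local degrees *)

Section Germs.
Local Open Scope ring_scope.
Variable F : numClosedFieldType.
Local Notation P1 := (P1 F).
Implicit Types (N D s t p q : {poly F}) (f g u v : P1 -> P1) (z w : P1).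

(** A local expression of a map fixing 0, by a fraction with denominator
    invertible at 0. *)
Definition germ u N D :=
  [/\ D.[0] != 0, N.[0] = 0
    & forall x, D.[x] != 0 -> u (Some x) = Some (N.[x] / D.[x])].

Lemma endo_germ u : endo u -> u (Some 0) = Some 0 ->
  exists N D, germ u N D.
Proof.
move=> [d [N [D ru]]] u0; exists N, D.
have := represents_fin 0 ru; rewrite u0 /hpt.
case: eqP => // /eqP D0 [] /esym/eqP.
rewrite mulf_eq0 invr_eq0 (negPf D0) orbF => /eqP N0.
by split=> // x Dx; apply: represents_finE ru Dx.
Qed.

Lemma germ_neq0 u N D : germ u N D -> D != 0.
Proof. by case=> D0 _ _; apply: contraNneq D0 => ->; rewrite horner0. Qed.

Lemma germ_cross u N D N' D' : germ u N D -> germ u N' D' -> N * D' = N' * D.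
Proof.
move=> gu gv; have [s sP] := rootsP (mulf_neq0 (germ_neq0 gu) (germ_neq0 gv)).
apply/eqP; rewrite -subr_eq0; apply/eqP; apply: (@poly_eq0_cofinite _ _ s) => x.
rewrite -sP hornerM mulf_eq0 negb_or => /andP[Dx Dx'].
have [_ _ /(_ _ Dx) e1] := gu; have [_ _ /(_ _ Dx')] := gv.
rewrite e1 => -[] /eqP; rewrite eqr_div // => /eqP e.
by rewrite hornerD hornerN !hornerM e subrr.
Qed.

Lemma Xn_coprime m D : D.[0] != 0 -> coprimep 'X^m D.
Proof.
move=> D0; apply: coprimep_expl; rewrite coprimep_sym -[X in coprimep _ X]subr0.
by rewrite coprimep_XsubC.
Qed.

(** [s] is a Taylor polynomial of [u] at 0: computations with power series are
    carried out on truncations modulo powers of ['X]. *)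
Definition jet m u s := exists N D, germ u N D /\ 'X^m %| N - s * D.

(** The denominator is invertible modulo ['X^m]. *)
Lemma jet_ex m u : endo u -> u (Some 0) = Some 0 -> exists s, jet m u s.
Proof.
move=> eu /(endo_germ eu)[N [D gu]]; have [D0 _ _] := gu.
have /Bezout_eq1_coprimepP[[U V] /= e] := Xn_coprime m D0.
exists (N * V), N, D; split=> //.
have -> : N - N * V * D = N * U * 'X^m.
  by rewrite -[X in X - _]mulr1 -e; ring.
exact: dvdp_mull.
Qed.

Lemma jet_le m m' u s : (m <= m')%N -> jet m' u s -> jet m u s.
Proof.
move=> le [N [D [gu dv]]]; exists N, D; split=> //.
by apply: dvdp_trans dv; apply: dvdp_exp2l.
Qed.

Lemma jet_uniq m u s s' : jet m u s -> jet m u s' -> 'X^m %| s - s'.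
Proof.
move=> [N [D [gu dv]]] [N' [D' [gu' dv']]].
have [D0 _ _] := gu; have [D0' _ _] := gu'.
rewrite -(Gauss_dvdpl _ (Xn_coprime m D0)) -(Gauss_dvdpl _ (Xn_coprime m D0')).
have -> : (s - s') * D * D' = (N' - s' * D') * D - (N - s * D) * D'.
  by rewrite !mulrBl (germ_cross gu gu'); ring.
by rewrite dvdp_sub // dvdp_mulr.
Qed.

Lemma jet_root m u s : (0 < m)%N -> jet m u s -> s.[0] = 0.
Proof.
case: m => // m _ [N [D [[D0 N0 _] dv]]].
have : 'X %| N - s * D by apply: dvdp_trans dv; rewrite exprS dvdp_mulr.
rewrite -[X in X %| _]subr0 dvdp_XsubCl => /rootP.
rewrite hornerD hornerN hornerM N0 sub0r => /eqP.
by rewrite oppr_eq0 mulf_eq0 (negPf D0) orbF => /eqP.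
Qed.

Lemma comp_poly_wide d p s : (size p <= d.+1)%N ->
  p \Po s = \sum_(i < d.+1) p`_i *: s ^+ i.
Proof.
move=> sp; rewrite /comp_poly (horner_coef_wide _ (n := d.+1)).
  by apply: eq_bigr => i _; rewrite coef_map mul_polyC.
by rewrite size_map_polyC.
Qed.

(** [N = s D] modulo ['X^m] can be substituted in the homogenization of [p]. *)
Lemma hcomp_mod m d p N s D : (size p <= d.+1)%N -> 'X^m %| N - s * D ->
  'X^m %| hcomp d p N D - D ^+ d * (p \Po s).
Proof.
move=> sp dv; rewrite (comp_poly_wide _ sp) big_distrr /= -sumrB.
apply: (big_ind (fun r : {poly F} => 'X^m %| r)).
- exact: dvdp0.
- by move=> a b; apply: dvdp_add.
move=> i _; have -> : D ^+ d = D ^+ i * D ^+ (d - i).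
  by rewrite -exprD subnKC // -ltnS.
have -> : p`_i *: (N ^+ i * D ^+ (d - i)) -
   D ^+ i * D ^+ (d - i) * (p`_i *: s ^+ i) =
   (p`_i)%:P * D ^+ (d - i) * (N ^+ i - (s * D) ^+ i).
  by rewrite -!mul_polyC exprMn; ring.
rewrite subrXX; apply: dvdp_mull; exact: dvdp_mulr.
Qed.

Lemma Xdvd_comp m p s : s.[0] = 0 -> 'X^m %| p -> 'X^m %| p \Po s.
Proof.
move=> s0 /dvdpP[r ->]; rewrite comp_polyM rmorphXn /= comp_polyX.
apply/dvdp_mull/dvdp_exp2r.
by rewrite -[X in X %| _]subr0 dvdp_XsubCl; apply/rootP.
Qed.

Lemma jet_comp m u v s t : (0 < m)%N -> jet m u s -> jet m v t ->
  jet m (v \o u) (t \Po s).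
Proof.
move=> m0 ju jv; have s0 := jet_root m0 ju.
have [N [D [gu dv]]] := ju; have [N' [D' [gv dv']]] := jv.
pose d := maxn (size N') (size D').
have sN : (size N' <= d.+1)%N by rewrite /d; lia.
have sD : (size D' <= d.+1)%N by rewrite /d; lia.
have [D0 N0 uE] := gu; have [D0' N0' vE] := gv.
have hE p x : (size p <= d.+1)%N -> D.[x] != 0 ->
  (hcomp d p N D).[x] = D.[x] ^+ d * p.[N.[x] / D.[x]].
  by move=> sp Dx; rewrite horner_hcomp form_neq0.
exists (hcomp d N' N D * D), (hcomp d D' N D * D); split; first split.
- by rewrite hornerM hE // N0 mul0r !mulf_neq0 // expf_neq0.
- by rewrite hornerM hE // N0 mul0r N0' mulr0 mul0r.
- move=> x; rewrite !hornerM mulf_eq0 negb_or => /andP[h Dx] /=.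
  rewrite uE //; rewrite !hE // in h *.
  move: h; rewrite mulf_eq0 negb_or => /andP[_ h]; rewrite vE //; congr Some.
  have Dxd : D.[x] ^+ d != 0 by rewrite expf_neq0.
  by field; rewrite h Dx Dxd.
have := hcomp_mod sN dv; have := hcomp_mod sD dv => h1 h2.
have h3 := Xdvd_comp s0 dv'.
have -> : hcomp d N' N D * D - (t \Po s) * (hcomp d D' N D * D) =
  D * ((hcomp d N' N D - D ^+ d * (N' \Po s))
     - (t \Po s) * (hcomp d D' N D - D ^+ d * (D' \Po s))
     + D ^+ d * ((N' - t * D') \Po s)).
  by rewrite comp_polyB comp_polyM; ring.
rewrite dvdp_mull // dvdp_add ?dvdp_mull // dvdp_sub // dvdp_mull //.
Qed.

(** [s = a X^e + O(X^(e+1))].  The value [a = 0] is allowed, so that leading terms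
    can be added without discussing cancellation. *)
Definition poly_lead s e (a : F) := exists t, s = 'X^e * t /\ t.[0] = a.

Lemma poly_lead_mod m s s' e a : (e < m)%N -> 'X^m %| s - s' ->
  poly_lead s e a -> poly_lead s' e a.
Proof.
move=> em dv [t [sE ta]]; rewrite {}sE in dv.
have /dvdpP[r rE] : ('X^(e.+1) : {poly F}) %| 'X^e * t - s'.
  by apply: dvdp_trans dv; apply: dvdp_exp2l.
exists (t - 'X * r); split; last by rewrite hornerD hornerN hornerM hornerX mul0r subr0.
have -> : s' = 'X^e * t - ('X^e * t - s') by ring.
by rewrite rE exprS; ring.
Qed.

Lemma poly_lead_uniq s e a e' a' : a != 0 -> a' != 0 ->
  poly_lead s e a -> poly_lead s e' a' -> e = e' /\ a = a'.
Proof.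
move=> a0 a0' [t [sE ta]] [t' [sE' ta']].
have Xn0 n : ('X^n : {poly F}) != 0 by rewrite expf_neq0 // polyX_eq0.
have key n m (r r' : {poly F}) : (n < m)%N -> r.[0] != 0 ->
    'X^n * r = 'X^m * r' -> False.
  move=> nm r0; rewrite -(subnKC nm) addSnnS exprD -mulrA => /(mulfI (Xn0 n)) re.
  by move: r0; rewrite re hornerM exprS hornerM hornerX !mul0r eqxx.
case: (ltngtP e e') => h.
- by case: (key e e' t t' h); rewrite ?ta // -sE -sE'.
- by case: (key e' e t' t h); rewrite ?ta' // -sE -sE'.
split=> //; rewrite -ta -ta'; congr _.[_]; apply: (mulfI (Xn0 e)).
by rewrite -sE sE' h.
Qed.

Lemma poly_lead_ex s : s != 0 -> exists e a, a != 0 /\ poly_lead s e a.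
Proof.
move=> s0; have := mup_geq 0 (mup 0 s) s0.
rewrite leqnn subr0 => /esym/dvdpP[t sE].
have := mup_leq 0 (mup 0 s) s0; rewrite leqnn subr0 => /esym nd.
exists (mup 0 s), t.[0]; split; last by exists t; rewrite mulrC.
apply: contra nd => t0; rewrite [X in _ %| X]sE exprS dvdp_mul //.
by rewrite -[X in X %| _]subr0 dvdp_XsubCl.
Qed.

Lemma poly_leadN s e a : poly_lead s e a -> poly_lead (- s) e (- a).
Proof. by case=> t [-> <-]; exists (- t); rewrite mulrN hornerN. Qed.

Lemma poly_leadD s s' e a a' : poly_lead s e a -> poly_lead s' e a' ->
  poly_lead (s + s') e (a + a').
Proof. by case=> t [-> <-] [t' [-> <-]]; exists (t + t'); rewrite mulrDr hornerD. Qed.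

Lemma poly_lead_comp s e a s' e' a' : (0 < e)%N -> poly_lead s e a ->
  poly_lead s' e' a' -> poly_lead (s' \Po s) (e' * e) (a' * a ^+ e').
Proof.
move=> e0 [t [-> ta]] [t' [-> ta']].
exists (t ^+ e' * (t' \Po ('X^e * t))); split.
  by rewrite comp_polyM rmorphXn /= comp_polyX exprMn -exprM mulrA mulnC.
by rewrite hornerM horner_exp horner_comp hornerM hornerXn expr0n gtn_eqF // mul0r ta ta' mulrC.
Qed.

(** The first nonzero term of the Taylor expansion at 0 of a map fixing 0. *)
Definition ldeg u e a :=
  a != 0 /\ exists m s, [/\ (e < m)%N, jet m u s & poly_lead s e a].

(** The leading term can be read off any sufficiently long truncation. *)
Lemma ldeg_jet u e a m s : ldeg u e a -> (e < m)%N -> jet m u s ->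
  poly_lead s e a.
Proof.
move=> [a0 [m' [s' [em' j' l']]]] em j.
apply: (poly_lead_mod (ltnSn e) _ l').
exact: jet_uniq (jet_le em' j') (jet_le em j).
Qed.

Lemma ldeg_uniq u e a e' a' : endo u -> u (Some 0) = Some 0 ->
  ldeg u e a -> ldeg u e' a' -> e = e' /\ a = a'.
Proof.
move=> eu u0 l l'; have [s j] := jet_ex (e + e').+1 eu u0.
apply: (poly_lead_uniq (s := s)); [by case: l|by case: l'| |].
  by apply: ldeg_jet l _ j; lia.
by apply: ldeg_jet l' _ j; lia.
Qed.

Lemma ldeg_ex u N D : germ u N D -> N != 0 -> exists e a, ldeg u e a.
Proof.
move=> gu N0; have [e [a [a0 [t [NE ta]]]]] := poly_lead_ex N0.
have [D0 _ _] := gu.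
have b0 : a / D.[0] != 0 by rewrite mulf_neq0 // invr_eq0.
exists e, (a / D.[0]); split=> //; exists e.+1, ('X^e * (a / D.[0])%:P); split=> //.
  exists N, D; split=> //.
  have -> : N - 'X^e * (a / D.[0])%:P * D = 'X^e * (t - (a / D.[0])%:P * D).
    by rewrite NE; ring.
  rewrite exprSr dvdp_mul2l ?expf_neq0 ?polyX_eq0 // -[X in X %| _]subr0 dvdp_XsubCl.
  by apply/rootP; rewrite hornerD hornerN hornerM hornerC ta divfK // subrr.
by exists (a / D.[0])%:P; rewrite hornerC.
Qed.

Lemma ldeg_gt0 u e a : ldeg u e a -> (0 < e)%N.
Proof.
move=> [a0 [m [s [em j [t [sE ta]]]]]].
have m0 : (0 < m)%N by lia.
have := jet_root m0 j; rewrite sE hornerM hornerXn ta; case: e em {sE} => // _.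
by rewrite mul1r => a00; rewrite a00 eqxx in a0.
Qed.

Lemma ldeg_comp u v e a e' a' : endo u -> u (Some 0) = Some 0 ->
  endo v -> v (Some 0) = Some 0 ->
  ldeg u e a -> ldeg v e' a' -> ldeg (v \o u) (e' * e) (a' * a ^+ e').
Proof.
move=> eu u0 ev v0 l l'; have e0 := ldeg_gt0 l; have e0' := ldeg_gt0 l'.
have [s j] := jet_ex (e' * e).+1 eu u0.
have [s' j'] := jet_ex (e' * e).+1 ev v0.
split; first by rewrite mulf_neq0 ?expf_neq0 //; [case: l'|case: l].
exists (e' * e).+1, (s' \Po s); split=> //; first exact: jet_comp.
by apply: poly_lead_comp => //; [apply: ldeg_jet l _ j|apply: ldeg_jet l' _ j']; nia.
Qed.

(** The cross difference [N * D' - N' * D] of two fractions is a nonzero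
    polynomial, hence of finite order at 0: distinct maps have distinct Taylor
    series, and their first difference does not depend on the truncation. *)
Lemma first_diff u v : endo u -> u (Some 0) = Some 0 ->
  endo v -> v (Some 0) = Some 0 -> u <> v ->
  exists m b, b != 0 /\ forall M s s', (m < M)%N -> jet M u s -> jet M v s' ->
    poly_lead (s - s') m b.
Proof.
move=> eu u0 ev v0 nuv.
have [N [D gu]] := endo_germ eu u0; have [N' [D' gv]] := endo_germ ev v0.
have D0 := germ_neq0 gu; have D0' := germ_neq0 gv.
have W0 : N * D' - N' * D != 0.
  apply/eqP => /eqP; rewrite subr_eq0 => /eqP eq; apply: nuv.
  have [r rP] := rootsP (mulf_neq0 D0 D0').
  apply: (endo_eq (s := r)) => // x; rewrite -rP hornerM mulf_eq0 negb_or.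
  move=> /andP[Dx Dx']; have [_ _ ->//] := gu; have [_ _ ->//] := gv.
  by congr Some; apply/eqP; rewrite eqr_div // -!hornerM eq.
pose M0 := size (N * D' - N' * D).
have [s j] := jet_ex M0 eu u0; have [s' j'] := jet_ex M0 ev v0.
have nd : ~~ ('X^M0 %| s - s').
  apply/negP => dv.
  have : 'X^M0 %| N * D' - N' * D.
    have [N1 [D1 [gu1 dv1]]] := j; have [N2 [D2 [gv2 dv2]]] := j'.
    have [D10 _ _] := gu1; have [D20 _ _] := gv2.
    rewrite -(Gauss_dvdpl _ (Xn_coprime M0 D10)) -(Gauss_dvdpl _ (Xn_coprime M0 D20)).
    have -> : (N * D' - N' * D) * D1 * D2 = (N * D1) * D' * D2 - (N' * D2) * D * D1.
      by ring.
    rewrite (germ_cross gu gu1) (germ_cross gv gv2).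
    have -> : N1 * D * D' * D2 - N2 * D' * D * D1 =
       D * D' * ((N1 - s * D1) * D2 - (N2 - s' * D2) * D1 + (s - s') * D1 * D2) by ring.
    rewrite dvdp_mull // dvdp_add //; last by rewrite !dvdp_mulr.
    by rewrite dvdp_sub // dvdp_mulr.
  by move/(dvdp_leq W0); rewrite size_polyXn ltnn.
have ss0 : s - s' != 0 by apply: contraNneq nd => ->; apply: dvdp0.
have [m [b [b0 lb]]] := poly_lead_ex ss0.
have mM : (m < M0)%N.
  rewrite ltnNge; apply: contra nd => le; case: lb => t [-> _].
  by apply: dvdp_mulr; apply: dvdp_exp2l.
exists m, b; split=> // M r r' hM jr jr'.
apply: (poly_lead_mod (ltnSn m) _ lb).
have d1 := jet_uniq (jet_le mM j) (jet_le hM jr).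
have d2 := jet_uniq (jet_le mM j') (jet_le hM jr').
have -> : s - s' - (r - r') = (s - r) - (s' - r') by ring.
exact: dvdp_sub.
Qed.

End Germs.

Section Charts.
Local Open Scope ring_scope.
Variable F : numClosedFieldType.
Local Notation P1 := (P1 F).
Implicit Types (N D s t p q : {poly F}) (f g u v : P1 -> P1) (z w : P1).

Definition inversion z : P1 :=
  if z is Some x then if x == 0 then None else Some x^-1 else Some 0.

Definition translation (a : F) z : P1 := if z is Some x then Some (x + a) else None.

Definition chart z : P1 -> P1 := if z is Some a then translation a else inversion.
Definition unchart z : P1 -> P1 := if z is Some a then translation (- a) else inversion.

Lemma inversionK : involutive inversion.
Proof.
case=> [x|] /=; last by rewrite eqxx.
by case: eqVneq => [->//|x0] /=; rewrite invr_eq0 (negPf x0) invrK.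
Qed.

Lemma chartK z : cancel (chart z) (unchart z).
Proof. by case: z => [a|] /=; [case=> [x|] //=; rewrite addrK|apply: inversionK]. Qed.

Lemma unchartK z : cancel (unchart z) (chart z).
Proof. by case: z => [a|] /=; [case=> [x|] //=; rewrite subrK|apply: inversionK]. Qed.

Lemma chart0 z : chart z (Some 0) = z.
Proof. by case: z => [a|] /=; rewrite ?add0r ?eqxx. Qed.

Lemma unchart0 z : unchart z z = Some 0.
Proof. by rewrite -{2}(chart0 z) chartK. Qed.

Lemma form1 p (x y : F) : form 1 p x y = p`_0 * y + p`_1 * x.
Proof. by rewrite /form big_ord_recr big_ord1 /= !expr0 !expr1; ring. Qed.

Lemma represents_translation a : represents 1 ('X + a%:P) 1 (translation a).
Proof.
have fE (x y : F) : form 1 ('X + a%:P) x y = x + a * y.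
  by rewrite form1 !coefD !coefX !coefC /=; ring.
have gE (x y : F) : form 1 1 x y = y by rewrite form1 !coef1 /=; ring.
split; rewrite ?size_XaddC ?size_poly1 //.
  move=> x y; rewrite fE gE !xpair_eqE; apply: contra => /andP[h /eqP y0].
  by move: h; rewrite y0 mulr0 addr0 eqxx andbT.
move=> x y xy; rewrite fE gE /hpt; case: eqP => //= /eqP y0.
by congr Some; field.
Qed.

Lemma represents_inversion : represents 1 1 'X inversion.
Proof.
have fE (x y : F) : form 1 'X x y = x by rewrite form1 !coefX /=; ring.
have gE (x y : F) : form 1 1 x y = y by rewrite form1 !coef1 /=; ring.
split; rewrite ?size_polyX ?size_poly1 //.
  by move=> x y; rewrite fE gE !xpair_eqE andbC.
move=> x y; rewrite fE gE /hpt xpair_eqE /inversion.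
case: (eqVneq y 0) => [->|y0]; first by rewrite andbT mul0r => /negPf->.
case: (eqVneq x 0) => [->|x0] _; first by rewrite mul0r eqxx.
by rewrite mulf_eq0 invr_eq0 (negPf x0) (negPf y0) invf_div.
Qed.

Lemma endo_chart z : endo (chart z).
Proof.
case: z => [a|] /=; last by exists 1%N, 1, 'X; apply: represents_inversion.
by exists 1%N, ('X + a%:P), 1; apply: represents_translation.
Qed.

Lemma endo_unchart z : endo (unchart z).
Proof.
case: z => [a|] /=; last by exists 1%N, 1, 'X; apply: represents_inversion.
by exists 1%N, ('X + (- a)%:P), 1; apply: represents_translation.
Qed.

Lemma deg_chart z : deg (chart z) = 1%N.
Proof.
case: z => [a|] /=; first exact: deg_eq (represents_translation a).
exact: deg_eq represents_inversion.
Qed.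

Lemma deg_unchart z : deg (unchart z) = 1%N.
Proof.
case: z => [a|] /=; first exact: deg_eq (represents_translation _).
exact: deg_eq represents_inversion.
Qed.

(** The germ of [f] at [z], in charts centred at [z] and at [f z]; these are
    translations and, at infinity, the inversion. *)
Definition loc f z : P1 -> P1 := unchart (f z) \o f \o chart z.

Lemma loc0 f z : loc f z (Some 0) = Some 0.
Proof. by rewrite /loc /= chart0 unchart0. Qed.

Lemma endo_loc f z : endo f -> endo (loc f z).
Proof.
move=> ef; apply: endo_comp (endo_chart z).
exact: endo_comp (endo_unchart _) ef.
Qed.

Lemma loc_comp f g z : loc (f \o g) z = loc f (g z) \o loc g z.
Proof. by apply/funext => x; rewrite /loc /= unchartK. Qed.

Lemma loc_inj f g z : f z = g z -> loc f z = loc g z -> f = g.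
Proof.
move=> e h; apply/funext => x.
have := congr1 (fun k => k (unchart z x)) h.
rewrite /loc /= unchartK -e => /(congr1 (chart (f z))).
by rewrite !unchartK.
Qed.

(** Local degree and leading coefficient of [f] at [z].  At an unramified fixed
    point [lead] is the multiplier. *)
Definition mult f z : nat := xget 0%N [set e | exists a, ldeg (loc f z) e a].
Definition lead f z : F := xget 0 [set a | exists e, ldeg (loc f z) e a].

Lemma ldeg_mult f z : End f -> ldeg (loc f z) (mult f z) (lead f z).
Proof.
move=> [ef nc]; have el := endo_loc z ef.
have [N [D gu]] := endo_germ el (loc0 f z).
have N0 : N != 0.
  apply/eqP => N0; apply: nc; exists (f z) => w.
  have D0 := germ_neq0 gu.
  have [s sP] := rootsP D0.
  have h : loc f z = fun=> Some 0.
    apply: (endo_eq (s := s)) => //.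
      exists 0%N, 0, 1; split; rewrite ?size_poly0 ?size_poly1 //.
      - by move=> x y _; rewrite /form !big_ord1 coef1 /= !expr0 !mulr1 xpair_eqE oner_eq0 andbF.
      - by move=> x y _; rewrite /form !big_ord1 coef1 coef0 /= !expr0 !mulr1 hpt_x1.
    by move=> x; rewrite -sP => Dx; have [_ _ ->//] := gu; rewrite N0 horner0 mul0r.
  have := congr1 (fun k => chart (f z) (k (unchart z w))) h.
  by rewrite /loc /= !unchartK chart0.
have [e [a l]] := ldeg_ex gu N0.
have -> : mult f z = e.
  rewrite /mult; case: xgetP => [n -> /= [b lb]|/(_ e)[]]; last by exists a.
  by have [] := ldeg_uniq el (loc0 f z) lb l.
have -> // : lead f z = a.
rewrite /lead; case: xgetP => [n -> /= [b lb]|/(_ a)[]]; last by exists e.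
by have [] := ldeg_uniq el (loc0 f z) lb l.
Qed.

Lemma ldegE f z e a : End f -> ldeg (loc f z) e a -> mult f z = e /\ lead f z = a.
Proof.
move=> Ef l; apply: (ldeg_uniq (endo_loc z _) (loc0 f z) _ l); first by case: Ef.
exact: ldeg_mult.
Qed.

Lemma mult_gt0 f z : End f -> (0 < mult f z)%N.
Proof. by move/(ldeg_mult z)/ldeg_gt0. Qed.

Lemma lead_neq0 f z : End f -> lead f z != 0.
Proof. by move/(ldeg_mult z); case. Qed.

Lemma End_comp f g : End f -> End g -> End (f \o g).
Proof.
move=> Ef Eg; have [ef _] := Ef; have [eg _] := Eg.
apply/(End_deg (endo_comp ef eg)); rewrite deg_comp //.
by rewrite muln_gt0 (proj1 (End_deg ef) Ef) (proj1 (End_deg eg) Eg).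
Qed.

Lemma mult_lead_comp f g z : End f -> End g ->
  mult (f \o g) z = (mult f (g z) * mult g z)%N /\
  lead (f \o g) z = lead f (g z) * lead g z ^+ mult f (g z).
Proof.
move=> Ef Eg; apply: ldegE; first exact: End_comp.
have [ef _] := Ef; have [eg _] := Eg.
rewrite loc_comp; apply: ldeg_comp; rewrite ?loc0 //.
- exact: endo_loc.
- exact: endo_loc.
- exact: ldeg_mult.
- exact: ldeg_mult.
Qed.

Lemma mult_comp f g z : End f -> End g ->
  mult (f \o g) z = (mult f (g z) * mult g z)%N.
Proof. by move=> Ef Eg; case: (mult_lead_comp z Ef Eg). Qed.

Lemma lead_comp f g z : End f -> End g ->
  lead (f \o g) z = lead f (g z) * lead g z ^+ mult f (g z).
Proof. by move=> Ef Eg; case: (mult_lead_comp z Ef Eg). Qed.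

End Charts.

(* These are defined by a choice, which is used only through the lemmas above. *)
#[global] Opaque deg mult lead.

(** * Fibres and ramification *)

Section Fibres.
Local Open Scope ring_scope.
Variable F : numClosedFieldType.
Local Notation P1 := (P1 F).
Implicit Types (p q r : {poly F}) (f g : P1 -> P1) (z w v : P1) (d e : nat).

Lemma endo_id : endo (@id P1).
Proof.
exists 1%N, 'X, 1; split; rewrite ?size_polyX ?size_poly1 //.
  by move=> x y; rewrite !form1 !coefX !coef1 /= !mul0r !mul1r add0r addr0.
by move=> x y _; rewrite !form1 !coefX !coef1 /= !mul0r !mul1r add0r addr0.
Qed.

Lemma End_id : End (@id P1).
Proof. by split; [exact: endo_id|case=> c h; have := h None; rewrite -(h (Some 0))]. Qed.

Lemma mult_lead_id z : mult id z = 1%N /\ lead id z = 1.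
Proof.
apply: ldegE; first exact: End_id.
split; first exact: oner_neq0.
exists 2%N, 'X; split=> //; last by exists 1; rewrite mulr1 hornerC.
have gi : germ (loc id z) 'X 1.
  split; rewrite ?hornerC ?hornerX ?oner_eq0 // => x _.
  by rewrite hornerC hornerX divr1 /loc /= chartK.
by exists 'X, 1; split=> //; rewrite mulr1 subrr dvdp0.
Qed.

Lemma mult_id z : mult id z = 1%N. Proof. by case: (mult_lead_id z). Qed.
Lemma lead_id z : lead id z = 1. Proof. by case: (mult_lead_id z). Qed.

Lemma mult_inv f g z : End f -> End g -> cancel f g -> mult f z = 1%N.
Proof.
move=> Ef Eg fK; have : mult (g \o f) z = 1%N.
  by rewrite (_ : g \o f = id) ?mult_id //; apply/funext => x /=; rewrite fK.
by rewrite mult_comp // => /eqP; rewrite muln_eq1 => /andP[_ /eqP].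
Qed.

Lemma mup_eq a r k t : r = ('X - a%:P) ^+ k * t -> t.[a] != 0 -> mup a r = k.
Proof.
move=> -> ta; rewrite mupMl; first by rewrite mup_XsubCX eqxx.
by apply: ta.
Qed.

Lemma mup_factor a r : r != 0 ->
  exists t, r = ('X - a%:P) ^+ (mup a r) * t /\ t.[a] != 0.
Proof.
move=> r0; have /dvdpP[t rE] : ('X - a%:P) ^+ (mup a r) %| r by rewrite -mup_geq.
exists t; split; first by rewrite mulrC.
have := mup_leq a (mup a r) r0; rewrite leqnn => /esym; apply: contra => ta.
by rewrite [X in _ %| X]rE exprS dvdp_mul // dvdp_XsubCl.
Qed.

(** The numerator of [f - v], or the denominator of [f] when [v] is infinity. *)
Definition fibre_poly p q v : {poly F} := if v is Some c then p - c *: q else q.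

Lemma fibre_polyE d p q f v a : represents d p q f ->
  (fibre_poly p q v).[a] = 0 <-> f (Some a) = v.
Proof.
move=> rf; rewrite (represents_fin _ rf) /hpt.
case: v => [c|] /=; last by case: eqP => qa; split.
rewrite hornerD hornerN hornerZ; split.
  move=> /eqP; rewrite subr_eq0 => /eqP pa.
  case: eqP => [qa|/eqP qa]; last by rewrite pa mulfK.
  by have := represents_no_root rf (x := a); rewrite pa qa mulr0 eqxx => /(_ erefl).
by case: eqP => // /eqP qa [<-]; rewrite divfK // subrr.
Qed.

Lemma fibre_poly_neq0 d p q f v : represents d p q f -> End f ->
  fibre_poly p q v != 0.
Proof.
move=> rf [ef nc]; apply/eqP => P0; apply: nc; exists v => z.
suff -> : f = fun=> v by [].
apply: (endo_eq (s := [::])) => //; last first.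
  by move=> x _; apply/(fibre_polyE _ _ rf); rewrite P0 horner0.
have [x [y [xy ->]]] := hpt_surj v.
exists 0%N, x%:P, y%:P; split; rewrite ?size_polyC_leq1 //.
  by move=> s t _; rewrite /form !big_ord1 !coefC /= !expr0 !mulr1.
by move=> s t _; rewrite /form !big_ord1 !coefC /= !expr0 !mulr1.
Qed.

(** After translation to 0, the fibre polynomial is the numerator of a fraction
    that expresses the germ of [f] at [a]. *)
Lemma mult_fin d p q f a : represents d p q f -> End f ->
  mult f (Some a) = mup a (fibre_poly p q (f (Some a))).
Proof.
move=> rf Ef; set P := fibre_poly _ _ _.
have P0 : P != 0 by apply: fibre_poly_neq0 rf Ef.
have [t [PE ta]] := mup_factor a P0.
pose D := (if f (Some a) is Some _ then q else p) \Po ('X + a%:P).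
have hA x : ('X + a%:P : {poly F}).[x] = x + a by rewrite hornerD hornerX hornerC.
have D0 : D.[0] != 0.
  rewrite horner_comp hA add0r; have := represents_fin a rf; rewrite /hpt.
  case: (f _) => [c|]; first by case: eqP => // /eqP.
  case: eqP => // qa _; apply/eqP => pa.
  by have := represents_no_root rf pa; rewrite qa eqxx.
have gE : germ (loc f (Some a)) (P \Po ('X + a%:P)) D.
  split=> //.
    by rewrite horner_comp hA add0r; apply/(fibre_polyE _ _ rf).
  move=> x; rewrite /D !horner_comp hA /loc /= /P.
  case: (f (Some a)) => [c|] /= Dx.
    rewrite (represents_finE rf Dx) /=; congr Some.
    by rewrite hornerD hornerN hornerZ; field.
  rewrite (represents_fin _ rf) /hpt.
  case: eqP => [->|/eqP qx] /=; first by rewrite mul0r.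
  by rewrite mulf_eq0 invr_eq0 (negPf Dx) (negPf qx) /= invf_div.
have PX : P \Po ('X + a%:P) = 'X^(mup a P) * (t \Po ('X + a%:P)).
  rewrite {1}PE comp_polyM rmorphXn /= comp_polyB comp_polyX comp_polyC.
  by congr (_ ^+ _ * _); ring.
have t0 : (t \Po ('X + a%:P)).[0] != 0 by rewrite horner_comp hA add0r.
have PX0 : P \Po ('X + a%:P) != 0.
  rewrite PX mulf_neq0 ?expf_neq0 ?polyX_eq0 //.
  by apply: contraNneq t0 => ->; rewrite horner0.
have [e [b l]] := ldeg_ex gE PX0.
have [-> _] := ldegE Ef l.
have [b0 _] := l.
have [s j] := jet_ex e.+1 (endo_loc (Some a) (proj1 Ef)) (loc0 f (Some a)).
have [N1 [D1 [g1 dv]]] := j.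
have [u [sE ub]] := ldeg_jet l (ltnSn e) j.
have cr := germ_cross gE g1.
have [D10 _ _] := g1.
have /dvdpP[c cE] := dv.
have N1E : N1 = 'X^e * (u * D1 + c * 'X).
  have -> : N1 = (N1 - s * D1) + s * D1 by ring.
  by rewrite cE sE exprSr; ring.
have lE : poly_lead ((P \Po ('X + a%:P)) * D1) e (b * D1.[0] * D.[0]).
  rewrite cr N1E -mulrA; exists ((u * D1 + c * 'X) * D); split=> //.
  by rewrite hornerM hornerD !hornerM hornerX mulr0 addr0 ub.
have lE' : poly_lead ((P \Po ('X + a%:P)) * D1) (mup a P) (t.[a] * D1.[0]).
  rewrite PX -mulrA; exists ((t \Po ('X + a%:P)) * D1); split=> //.
  by rewrite hornerM horner_comp hA add0r.
by have [] := poly_lead_uniq _ _ lE' lE; rewrite ?mulf_neq0.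
Qed.

Lemma poly_roots_sum r : r != 0 ->
  exists s : seq F, [/\ uniq s, forall x, (x \in s) = (r.[x] == 0)
    & (\sum_(x <- s) mup x r = (size r).-1)%N].
Proof.
move=> r0; have [rs rE] := closed_field_poly_normal r.
have lr0 : lead_coef r != 0 by rewrite lead_coef_eq0.
exists (undup rs); split; rewrite ?undup_uniq //.
  by move=> x; rewrite mem_undup -[RHS]/(root r x) rE rootZ // root_prod_XsubC.
rewrite [in RHS]rE size_scale // size_prod_XsubC /= -sum1_size.
rewrite -(big_undup_iterop_count _ rs xpredT (fun=> 1%N)) /=.
apply: eq_bigr => x _; rewrite Monoid.iteropE iter_addn_0 mul1n.
by rewrite rE -mul_polyC mupMr ?rootC // mu_prod_XsubC.
Qed.

End Fibres.

Section Ramification.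
Local Open Scope ring_scope.
Variable F : numClosedFieldType.
Local Notation P1 := (P1 F).
Implicit Types (p q r : {poly F}) (f g : P1 -> P1) (z w v : P1) (d e : nat).

(** Mutually inverse changes of coordinate that bring a given point to infinity,
    so that fibres and critical points can be counted as roots of polynomials of
    the expected degree. *)
Definition from_inf z0 : P1 -> P1 :=
  if z0 is Some a then translation a \o @inversion F else id.
Definition to_inf z0 : P1 -> P1 :=
  if z0 is Some a then @inversion F \o translation (- a) else id.

Lemma from_inf_None z : from_inf z None = z.
Proof. by case: z => [a|] //=; rewrite add0r. Qed.

Lemma from_infK z : cancel (from_inf z) (to_inf z).
Proof.
case: z => [a|] //= x /=; have /= -> := @chartK _ (Some a) (inversion x).
exact: inversionK.
Qed.

Lemma to_infK z : cancel (to_inf z) (from_inf z).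
Proof.
by case: z => [a|] //= x /=; rewrite inversionK; have /= -> := @unchartK _ (Some a) x.
Qed.

Lemma deg_id : deg (@id P1) = 1%N.
Proof.
have := deg_chart (None : P1); have := @endo_chart F None => e h.
have := deg_comp e e; rewrite (_ : chart None \o chart None = id) ?h //.
by apply/funext => x /=; rewrite inversionK.
Qed.

Lemma endo_from_inf z : endo (from_inf z) /\ endo (to_inf z).
Proof.
case: z => [a|] /=; last by split; apply: endo_id.
by split; apply: endo_comp; first [exact: (endo_chart (Some _))|exact: (endo_chart None)].
Qed.

Lemma deg_from_inf z : deg (from_inf z) = 1%N /\ deg (to_inf z) = 1%N.
Proof.
case: z => [a|] /=; last by rewrite deg_id.
have i1 : deg (@inversion F) = 1%N := deg_chart (None : P1).
have i2 : endo (@inversion F) := @endo_chart F None.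
have t1 b : deg (@translation F b) = 1%N := deg_chart (Some b : P1).
have t2 b : endo (@translation F b) := @endo_chart F (Some b).
by rewrite !deg_comp // i1 !t1.
Qed.

Lemma End_from_inf z : End (from_inf z) /\ End (to_inf z).
Proof.
have [e1 e2] := endo_from_inf z; have [d1 d2] := deg_from_inf z.
by split; apply/End_deg; rewrite // ?d1 ?d2.
Qed.

(** When infinity is not in the fibre, the fibre polynomial has degree [deg f]. *)
Lemma fibre_fin f v : End f -> f None <> v -> exists s : seq P1,
  [/\ uniq s, forall z, (z \in s) <-> f z = v
    & (\sum_(z <- s) mult f z = deg f)%N].
Proof.
move=> Ef fN; have [p [q rf]] := degP (proj1 Ef).
have P0 := fibre_poly_neq0 v rf Ef; set P := fibre_poly p q v in P0 *.
have [s [us sP sS]] := poly_roots_sum P0.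
exists (map Some s); split.
- by rewrite map_inj_uniq // => x y [].
- case=> [a|]; split.
  + by move/mapP => [b + [->]]; rewrite sP => /eqP/(fibre_polyE _ _ rf).
  + by move=> /(fibre_polyE _ _ rf) /eqP h; apply: map_f; rewrite sP.
  + by move/mapP => [b _].
  + by [].
rewrite big_map.
transitivity (\sum_(x <- s) mup x P)%N.
  apply: eq_big_seq => x; rewrite sP => /eqP/(fibre_polyE _ _ rf) fx.
  by rewrite (mult_fin _ rf) // fx.
rewrite {}sS; suff -> : size P = (deg f).+1 by [].
have [sp sq _ _] := rf.
have sP1 : (size P <= (deg f).+1)%N.
  rewrite /P; case: (v) => [c|] //=; apply: leq_trans (size_polyD _ _) _.
  by rewrite size_polyN geq_max sp /= (leq_trans (size_scale_leq _ _)).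
apply/eqP; rewrite eqn_leq sP1 ltnNge; apply/negP => /leq_sizeP/(_ _ (leqnn _)) Pd.
apply: fN; have := represents_inf rf; have := represents_top rf.
rewrite /hpt xpair_eqE; move: Pd; rewrite /P; case: (v) => [c|] /=.
  rewrite coefB coefZ => /eqP; rewrite subr_eq0 => /eqP ->.
  by have [->|qd] := eqVneq q`_(deg f) 0; [rewrite mulr0 eqxx|rewrite mulfK].
by move=> ->; rewrite eqxx.
Qed.

Lemma sum_precomp f M M' (s : seq P1) : End f -> End M -> End M' -> cancel M M' ->
  (\sum_(z <- map M s) mult f z = \sum_(z <- s) mult (f \o M) z)%N.
Proof.
move=> Ef EM EM' K; rewrite big_map; apply: eq_bigr => z _.
by rewrite mult_comp // (mult_inv _ EM EM' K) muln1.
Qed.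

(** A change of coordinate moves the fibre away from infinity. *)
Lemma fibre f v : End f -> exists s : seq P1,
  [/\ uniq s, forall z, (z \in s) <-> f z = v
    & (\sum_(z <- s) mult f z = deg f)%N].
Proof.
move=> Ef; have [z0 fz0] : exists z0, f z0 <> v.
  by apply/not_existsP => h; case: Ef => _; apply; exists v => z; apply: contrapT (h z).
have [EM EM'] := End_from_inf z0; have K := from_infK z0; have K' := to_infK z0.
have [|s [us sP sS]] := @fibre_fin (f \o from_inf z0) v (End_comp Ef EM).
  by rewrite /= from_inf_None.
exists (map (from_inf z0) s); split.
- by rewrite map_inj_uniq //; apply: can_inj K.
- move=> z; rewrite -(K' z) mem_map; last exact: can_inj K.
  exact: sP.
rewrite (sum_precomp _ Ef EM EM' K) sS deg_comp; [|by case: Ef|by case: EM].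
by rewrite (proj1 (deg_from_inf z0)) muln1.
Qed.

Lemma End_surj f v : End f -> exists z, f z = v.
Proof.
move=> Ef; have [s [us sP sS]] := fibre v Ef.
have := proj1 (End_deg (proj1 Ef)) Ef; rewrite -sS.
by case: s us sP {sS} => [|z s] _ sP; [rewrite big_nil|exists z; apply/sP; rewrite inE eqxx].
Qed.

Lemma mult_le_deg f z : End f -> (mult f z <= deg f)%N.
Proof.
move=> Ef; have [s [us sP <-]] := fibre (f z) Ef.
rewrite (bigD1_seq z) //=; first exact: leq_addr.
exact/sP.
Qed.

Lemma deriv_eq0_size p : p^`() = 0 -> (size p <= 1)%N.
Proof.
move=> p0; apply/leq_sizeP => -[//|i] _; have := congr1 (fun r : {poly F} => r`_i) p0.
rewrite coef_deriv coef0 => /eqP; rewrite -mulr_natr mulf_eq0 pnatr_eq0 orbF.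
by move/eqP.
Qed.

(** The numerator of the derivative of [p / q]; its roots are the finite critical
    points. *)
Definition wronskian p q := p^`() * q - p * q^`().

(** If it vanished, the coprime [p] and [q] would have zero derivatives, hence be
    constant in characteristic zero. *)
Lemma wronskian_neq0 d p q f : represents d p q f -> End f -> wronskian p q != 0.
Proof.
move=> rf Ef; apply/eqP => /eqP; rewrite subr_eq0 => /eqP W.
have cpq := represents_coprime rf.
have q0 : q != 0 by have := fibre_poly_neq0 None rf Ef.
have q'0 : q^`() = 0.
  apply/eqP; apply: contraT => q'0.
  have : q %| q^`().
    by rewrite coprimep_sym in cpq; rewrite -(Gauss_dvdpr _ cpq) -W dvdp_mull.
  by move/(dvdp_leq q'0); rewrite leqNgt lt_size_deriv.
have p'0 : p^`() = 0.
  by move/eqP: W; rewrite q'0 mulr0 mulf_eq0 (negPf q0) orbF => /eqP.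
have := represents_size rf; have := deriv_eq0_size p'0; have := deriv_eq0_size q'0.
move=> h1 h2 h; have d0 : d = 0%N by lia.
by have := proj1 (End_deg (proj1 Ef)) Ef; rewrite (deg_eq rf) d0.
Qed.

(** The wronskian of [p] and [q] is also that of [p - c q] and [q], so one of the
    two polynomials may be replaced by the fibre polynomial, which vanishes at
    [a] to the order [mult f (Some a)]. *)
Lemma mult_wronskian d p q f a : represents d p q f -> End f ->
  mup a (wronskian p q) = (mult f (Some a)).-1.
Proof.
move=> rf Ef; rewrite (mult_fin _ rf) //.
have P0 := fibre_poly_neq0 (f (Some a)) rf Ef.
have Pa : (fibre_poly p q (f (Some a))).[a] = 0 by apply/(fibre_polyE _ _ rf).
set P := fibre_poly _ _ _ in P0 Pa *.
have [t [PE ta]] := mup_factor a P0.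
have e0 : (0 < mup a P)%N by rewrite -XsubC_dvd // dvdp_XsubCl; apply/rootP.
case: (mup a P) e0 PE => // e _ PE /=.
have hA : ('X - a%:P : {poly F}).[a] = 0 by rewrite hornerD hornerN hornerX hornerC subrr.
have dE : P^`() = ('X - a%:P) ^+ e * (e.+1%:R%:P * t + ('X - a%:P) * t^`()).
  rewrite PE derivM deriv_exp derivB derivX derivC subr0 mul1r exprS polyC_natr -pred_Sn.
  by rewrite -[_ *+ e.+1]mulr_natl; ring.
have e0 : (e.+1%:R : F) != 0 by rewrite pnatr_eq0.
case fa : (f (Some a)) => [c|]; rewrite fa /= in @P P0 Pa PE dE ta.
  have qa : q.[a] != 0.
    by have := represents_fin a rf; rewrite fa /hpt; case: eqP => // /eqP.
  apply: (@mup_eq _ _ _ _ ((e.+1%:R%:P * t + ('X - a%:P) * t^`()) * q - ('X - a%:P) * t * q^`())).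
    have -> : wronskian p q = P^`() * q - P * q^`().
      rewrite /P derivB derivZ /wronskian -!mul_polyC; ring.
    by rewrite dE PE exprS; ring.
  rewrite !(hA, hornerD, hornerN, hornerM, hornerC) !mul0r subr0 addr0.
  by rewrite !mulf_neq0.
have pa : p.[a] != 0.
  apply/eqP => pa; have := represents_no_root rf pa.
  by rewrite -/P Pa eqxx.
apply: (@mup_eq _ _ _ _ (('X - a%:P) * t * p^`() - p * (e.+1%:R%:P * t + ('X - a%:P) * t^`()))).
  by rewrite /wronskian -/P dE PE exprS; ring.
rewrite !(hA, hornerD, hornerN, hornerM, hornerC) !mul0r add0r addr0 oppr_eq0.
by rewrite !mulf_neq0.
Qed.

(** The terms of degree [2 d - 2] of the two products are in the ratio of [d] to
    [d - 1] and do not cancel. *)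
Lemma size_wronskian p q d : (0 < d)%N -> size p = d.+1 -> size q = d ->
  size (wronskian p q) = (2 * d - 1)%N.
Proof.
move=> d0 sp sq.
have pd : p`_d != 0 by rewrite -[d]/(d.+1.-1) -sp -lead_coefE lead_coef_eq0 -size_poly_eq0 sp.
have qd : q`_d.-1 != 0 by rewrite -sq -lead_coefE lead_coef_eq0 -size_poly_eq0 sq -lt0n.
have sp' : (size p^`() <= d.-1.+1)%N by rewrite prednK // -ltnS -sp lt_size_deriv // -size_poly_eq0 sp.
have c1 : (p^`() * q)`_(d.-1 + d.-1) = p`_d * q`_d.-1 *+ d.
  have sq1 : (size q <= d.-1.+1)%N by rewrite sq prednK.
  by rewrite (coef_formM sp' sq1) coef_deriv prednK // mulrnAl.
have c2 : (p * q^`())`_(d.-1 + d.-1) = p`_d * q`_d.-1 *+ d.-1.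
  case: d d0 sp sq {sp' c1} pd qd => // -[|d] _ sp sq pd qd.
    have -> : q^`() = 0 by rewrite [q]size1_polyC ?sq // derivC.
    by rewrite mulr0 coef0 mulr0n.
  have -> : (d.+2.-1 + d.+2.-1 = d.+2 + d)%N by lia.
  have sq2 : (size q^`() <= d.+1)%N.
    by rewrite -ltnS -sq lt_size_deriv // -size_poly_eq0 sq.
  have sp2 : (size p <= d.+3)%N by rewrite sp.
  by rewrite (coef_formM sp2 sq2) coef_deriv mulrnAr.
have cW : (wronskian p q)`_(d.-1 + d.-1) != 0.
  rewrite coefB c1 c2 -mulrnBr ?leq_pred //.
  have -> : (d - d.-1 = 1)%N by lia.
  by rewrite mulr1n mulf_neq0.
apply/eqP; rewrite eqn_leq; apply/andP; split; last first.
  have -> : (2 * d - 1 = (d.-1 + d.-1).+1)%N by lia.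
  by rewrite ltnNge; apply: contra cW => h; rewrite nth_default.
apply: leq_trans (size_polyD _ _) _; rewrite size_polyN geq_max.
have h1 := size_polyMleq p^`() q; have h2 := size_polyMleq p q^`().
have sq' : (size q^`() <= d.-1)%N.
  by rewrite -ltnS prednK // -[X in (_ < X)%N]sq lt_size_deriv // -size_poly_eq0 sq -lt0n.
rewrite sq in h1; rewrite sp in h2.
have key1 (a b : nat) : (0 < d -> a <= (b + d).-1 -> b <= d.-1.+1 -> a <= 2 * d - 1)%N by lia.
have key2 (a b : nat) : (0 < d -> a <= (d.+1 + b).-1 -> b <= d.-1 -> a <= 2 * d - 1)%N by lia.
by rewrite (key1 _ _ d0 h1 sp') (key2 _ _ d0 h2 sq').
Qed.

(** With infinity fixed and unramified, the denominator has degree one less than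
    the numerator, and all critical points are roots of the wronskian. *)
Lemma critical_fin f : End f -> f None = None -> mult f None = 1%N ->
  exists s : seq P1, [/\ uniq s, forall z, (z \in s) = (1 < mult f z)%N
    & (\sum_(z <- s) (mult f z).-1 = 2 * deg f - 2)%N].
Proof.
move=> Ef fN mN; have [p [q rf]] := degP (proj1 Ef).
have d0 := proj1 (End_deg (proj1 Ef)) Ef.
have [sp sq _ _] := rf.
have q0 : q != 0 by have := fibre_poly_neq0 None rf Ef.
have sqE : size q = deg f.
  have [s [us sP sS]] := fibre None Ef.
  have [t [ut tP tS]] := poly_roots_sum q0.
  have ps : perm_eq s (None :: map Some t).
    apply: uniq_perm => //.
      rewrite /= map_inj_uniq ?ut ?andbT; last by move=> x y [].
      by apply/mapP => -[].
    have NS : None \in s by apply/sP.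
    case=> [a|]; rewrite inE /=; last by rewrite NS.
    rewrite mem_map; last by move=> x y [].
    rewrite tP; apply/idP/eqP; first by move/sP/(fibre_polyE None a rf).
    by move=> h; apply/sP/(fibre_polyE None a rf).
  rewrite -sS (perm_big _ ps) /= big_cons mN big_map.
  rewrite (_ : \sum_(j <- t) _ = (size q).-1)%N.
    by rewrite add1n prednK // lt0n size_poly_eq0.
  rewrite -tS; apply: eq_big_seq => x; rewrite tP => /eqP/(fibre_polyE None x rf) fx.
  by rewrite (mult_fin _ rf) // fx.
have spE : size p = (deg f).+1.
  have := represents_size rf; rewrite sqE; lia.
have W0 := wronskian_neq0 rf Ef.
have [s [us sP sS]] := poly_roots_sum W0.
exists (map Some s); split.
- by rewrite map_inj_uniq // => x y [].
- case=> [a|]; last by rewrite mN; apply/mapP => -[].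
  rewrite mem_map; last by move=> x y [].
  rewrite sP -[LHS]/(root _ a) -dvdp_XsubCl XsubC_dvd // (mult_wronskian _ rf) //.
  by case: (mult _ _) => [|[]].
rewrite big_map; transitivity (\sum_(x <- s) mup x (wronskian p q))%N.
  by apply: eq_bigr => x _; rewrite (mult_wronskian _ rf).
rewrite sS (size_wronskian d0 spE sqE); lia.
Qed.

(** The Riemann-Hurwitz formula: changes of coordinate at the source and at the
    target make infinity an unramified fixed point, and the critical points are
    then counted by the degree of the wronskian. *)
Lemma critical f : End f ->
  exists s : seq P1, [/\ uniq s, forall z, (z \in s) = (1 < mult f z)%N
    & (\sum_(z <- s) (mult f z).-1 = 2 * deg f - 2)%N].
Proof.
move=> Ef; have [z0 mz0] : exists z0, mult f z0 = 1%N.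
  have [p [q rf]] := degP (proj1 Ef).
  have W0 := wronskian_neq0 rf Ef; have [s sP] := rootsP W0.
  have [x] := cofinite_exists s; rewrite -sP => Wx.
  exists (Some x); have := mult_wronskian x rf Ef; rewrite mupNroot //.
  by have := mult_gt0 (Some x) Ef; case: (mult _ _) => // n _ /= <-.
have [EM EM'] := End_from_inf z0; have K := from_infK z0; have K' := to_infK z0.
have [EN EN'] := End_from_inf (f z0); have J := from_infK (f z0); have J' := to_infK (f z0).
have mE z : mult (to_inf (f z0) \o (f \o from_inf z0)) z = mult f (from_inf z0 z).
  rewrite mult_comp //; last exact: End_comp.
  by rewrite mult_comp // (mult_inv _ EN' EN J') (mult_inv _ EM EM' K) muln1 mul1n.
have EfM := End_comp Ef EM.
have [|||s [us sP sS]] := @critical_fin (to_inf (f z0) \o (f \o from_inf z0)).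
- exact: End_comp.
- by rewrite /= from_inf_None -[in X in to_inf _ X](from_inf_None (f z0)) J.
- by rewrite mE from_inf_None.
exists (map (from_inf z0) s); split.
- by rewrite map_inj_uniq //; apply: can_inj K.
- move=> z; rewrite -(K' z) mem_map; last exact: can_inj K.
  by rewrite sP mE.
rewrite big_map -(eq_bigr _ (fun z _ => congr1 predn (mE z))) sS.
rewrite (deg_comp (proj1 EN') (proj1 EfM)) (deg_comp (proj1 Ef) (proj1 EM)).
by rewrite (proj1 (deg_from_inf z0)) (proj2 (deg_from_inf _)) mul1n muln1.
Qed.

Lemma ramification_le f (s : seq P1) : End f -> uniq s ->
  (\sum_(z <- s) (mult f z).-1 <= 2 * deg f - 2)%N.
Proof.
move=> Ef us; have [t [ut tP <-]] := critical Ef.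
rewrite (bigID (mem t)) /= [X in (_ + X)%N]big1 ?addn0; last first.
  by move=> z; rewrite tP; case: (mult f z) => [|[]].
rewrite -big_filter; set s' := [seq z <- s | z \in t].
have [r pr] : exists r : seq P1, perm_eq t (s' ++ r).
  exists [seq z <- t | z \notin s'].
  apply: uniq_perm => //.
    rewrite cat_uniq !filter_uniq // andbT /=.
    by apply/hasPn => z; rewrite mem_filter => /andP[].
  move=> z; rewrite mem_cat [X in _ || X]mem_filter.
  by have [|] := boolP (z \in s'); rewrite //= mem_filter => /andP[->].
by rewrite (perm_big _ pr) big_cat leq_addr.
Qed.

(** The coincidences of distinct morphisms are the zeros of a binary form of
    degree [deg f + deg g]; infinity is one when the top coefficient vanishes. *)
Lemma coincidence f g (s : seq P1) : endo f -> endo g -> uniq s ->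
  (forall z, z \in s -> f z = g z) -> (deg f + deg g < size s)%N -> f = g.
Proof.
move=> ef eg us eq; have [p [q rf]] := degP ef; have [p' [q' rg]] := degP eg.
have [sp sq nz _] := rf; have [sp' sq' nz' _] := rg.
set d := deg f in rf sp sq nz *; set e := deg g in rg sp' sq' nz' *.
pose W := p * q' - p' * q.
have [W0|W0 lt] := eqVneq W 0.
  by move=> _; apply: represents_cross rf rg _; apply/eqP; rewrite -subr_eq0; apply/eqP.
have sW : (size W <= (d + e).+1)%N.
  rewrite /W (leq_trans (size_polyD _ _)) // size_polyN geq_max.
  by rewrite size_formM //= addnC size_formM.
pose t : seq F := pmap id s.
have ut : uniq t by rewrite (pmap_uniq (g := Some)) // => -[].
have rt : all (root W) t.
  apply/allP => x; rewrite mem_pmap map_id => /eq; apply/contra_eqT => Wx.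
  have := nz x 1 (pair_x1 x); have := nz' x 1 (pair_x1 x).
  rewrite !form_y1 // => h1 h2.
  rewrite (represents_fin _ rf) (represents_fin _ rg); apply/eqP.
  move/(hpt_eq h2 h1) => h; move: Wx.
  by rewrite /root hornerD hornerN !hornerM h subrr eqxx.
have h := max_poly_roots W0 rt ut.
have sE : size s = (size t + (None \in s))%N.
  rewrite size_pmap -(count_predC (isSome \o id) s); congr (_ + _)%N.
  by rewrite -(count_uniq_mem None us); apply: eq_count => -[].
have [sN|sN] := boolP (None \in s); last first.
  by have := leq_trans h sW; rewrite sE (negPf sN) addn0 in lt; rewrite ltnS leqNgt lt.
have WN : W`_(d + e) = 0.
  have := nz 1 0 (pair_10 F); have := nz' 1 0 (pair_10 F).
  rewrite !form_y0 !expr1n !mulr1 => h1 h2.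
  have := eq _ sN; rewrite (represents_inf rf) (represents_inf rg).
  move/(hpt_eq h2 h1) => h3.
  by rewrite coefB coef_formM // [X in _ - _`_X]addnC coef_formM // h3 subrr.
have sW' : (size W <= d + e)%N.
  rewrite leqNgt; apply/negP => h1; have := WN; have h2 : size W = (d + e).+1 by apply/eqP; rewrite eqn_leq sW.
  by move/eqP; rewrite -[(d + e)%N]/((d + e).+1.-1) -h2 -lead_coefE lead_coef_eq0 (negPf W0).
by have := leq_trans h sW'; rewrite sE sN addn1 ltnS in lt; rewrite ltnNge lt.
Qed.

End Ramification.

(** * Rigidity of commuting germs *)

Section Rigidity.
Local Open Scope ring_scope.
Variable F : numClosedFieldType.
Local Notation P1 := (P1 F).
Implicit Types (p q r s A B : {poly F}) (f g u v : P1 -> P1) (z w : P1).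

Lemma Xn_neq0 n : ('X^n : {poly F}) != 0.
Proof. by rewrite expf_neq0 // polyX_eq0. Qed.

Lemma comp_poly_sub p A B : exists c, (p \Po A) - (p \Po B) = (A - B) * c.
Proof.
elim/poly_ind: p => [|p a [c IH]]; first by exists 0; rewrite !comp_poly0 subrr mulr0.
exists (p \Po A + c * B).
rewrite !comp_polyD !comp_polyM !comp_polyX !comp_polyC.
have -> : (p \Po A) = (p \Po B) + (A - B) * c by rewrite -IH; ring.
by ring.
Qed.

(** The mean value theorem for leading terms: as [p] begins with [k X^K], its
    difference quotient between [A] and [B], both beginning with [a X^l], begins
    with [k K (a X^l)^(K-1)]. *)
Lemma poly_lead_sub_comp p K k A B l a m b : (0 < l)%N -> (0 < K)%N ->
  poly_lead p K k -> poly_lead A l a -> poly_lead B l a -> poly_lead (A - B) m b ->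
  poly_lead ((p \Po A) - (p \Po B)) (m + l * K.-1) (k * (a ^+ K.-1 *+ K) * b).
Proof.
move=> l0 K0 [p1 [pE pk]] [A1 [AE Aa]] [B1 [BE Ba]] [d [dE db]].
have [c cE] := comp_poly_sub p1 A B.
have A0 : A.[0] = 0 by rewrite AE hornerM hornerXn expr0n gtn_eqF // mul0r.
pose S := \sum_(i < K) A1 ^+ (K.-1 - i) * B1 ^+ i.
exists (d * (S * (p1 \Po A) + 'X^l * B1 ^+ K * c)); split.
  have -> : (p \Po A) - (p \Po B) = A ^+ K * (p1 \Po A) - B ^+ K * (p1 \Po B).
    by rewrite pE !comp_polyM !rmorphXn /= !comp_polyX.
  have -> : (p1 \Po B) = (p1 \Po A) - (A - B) * c by rewrite -cE; ring.
  have -> : A ^+ K * (p1 \Po A) - B ^+ K * ((p1 \Po A) - (A - B) * c) =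
    (A ^+ K - B ^+ K) * (p1 \Po A) + B ^+ K * (A - B) * c by ring.
  have -> : A ^+ K - B ^+ K = (A - B) * ('X^(l * K.-1) * S).
    rewrite subrXX /S; congr (_ * _); rewrite big_distrr /=; apply: eq_bigr => i _.
    rewrite {1}AE {1}BE !exprMn -!exprM.
    have -> : (l * K.-1 = l * (K.-1 - i) + l * i)%N.
      by rewrite -mulnDr subnK // -ltnS prednK.
    by rewrite exprD; ring.
  rewrite dE exprD.
  have -> : B ^+ K = 'X^(l * K.-1) * 'X^l * B1 ^+ K.
    rewrite {1}BE exprMn -exprM -exprD; congr ('X^ _ * _).
    by rewrite -{1}(prednK K0) mulnS addnC.
  by ring.
rewrite hornerM db hornerD !hornerM hornerXn expr0n gtn_eqF // !mul0r addr0.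
rewrite horner_comp A0 pk /S horner_sum mulrC; congr (_ * _); rewrite mulrC; congr (_ * _).
rewrite (eq_bigr (fun=> a ^+ K.-1)); last first.
  move=> i _; rewrite hornerM !horner_exp Aa Ba -exprD subnK //.
  by rewrite -ltnS prednK.
by rewrite sumr_const card_ord.
Qed.

Lemma mult_lead_loc f z m s : End f -> (mult f z < m)%N -> jet m (loc f z) s ->
  poly_lead s (mult f z) (lead f z).
Proof. by move=> Ef; apply: ldeg_jet; apply: ldeg_mult. Qed.

(** If [u] and [v] first differed in degree [m], larger than their common order
    [l], then [Phi \o u - Phi \o v] would have order [m + l * K.-1] by the mean
    value theorem above, whereas [u \o Phi - v \o Phi] has the larger order
    [m * K]. *)
Lemma rigid_super Phi u v z : End Phi -> End u -> End v ->
  Phi z = z -> Phi (u z) = u z -> u z = v z ->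
  (1 < mult Phi z)%N -> mult Phi (u z) = mult Phi z ->
  mult u z = mult v z -> lead u z = lead v z ->
  Phi \o u = u \o Phi -> Phi \o v = v \o Phi -> u = v.
Proof.
move=> EP Eu Ev Pz Pw uv K1 Kw muv luv cu cv.
case: (pselect (loc u z = loc v z)) => [|nl]; first exact: loc_inj.
have [eu _] := Eu; have [ev _] := Ev; have [eP _] := EP.
have [m [b [b0 mb]]] := first_diff (endo_loc z eu) (loc0 _ _) (endo_loc z ev) (loc0 _ _) nl.
set K := mult Phi z in K1 Kw; set l := mult u z in muv; set a := lead u z in luv.
have [X XE] : exists X, X = (l * K.-1)%N by eexists.
pose M := (m + X + l + K).+1.
have [su ju] := jet_ex M (endo_loc z eu) (loc0 u z).
have [sv jv] := jet_ex M (endo_loc z ev) (loc0 v z).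
have [pz jz] := jet_ex M (endo_loc z eP) (loc0 Phi z).
have [pw jw] := jet_ex M (endo_loc (u z) eP) (loc0 Phi (u z)).
have Lu : poly_lead su l a by apply: (mult_lead_loc Eu _ ju); rewrite -/l /M; lia.
have Lv : poly_lead sv l a.
  by rewrite muv luv; apply: (mult_lead_loc Ev _ jv); rewrite -muv /M; lia.
have Lw : poly_lead pw K (lead Phi (u z)).
  by rewrite -Kw; apply: (mult_lead_loc EP _ jw); rewrite Kw /M; lia.
have Lz : poly_lead pz K (lead Phi z).
  by apply: (mult_lead_loc EP _ jz); rewrite -/K /M; lia.
have Ld : poly_lead (su - sv) m b by apply: mb ju jv; rewrite /M; lia.
have l0 : (0 < l)%N by apply: mult_gt0.
have lm : (l < m)%N.
  have := poly_leadD Lu (poly_leadN Lv); rewrite subrr => -[t [tE t0]].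
  have {t0} /dvdpP[t' t'E] : 'X %| t by rewrite -[X in X %| _]subr0 dvdp_XsubCl; apply/rootP.
  rewrite ltnNge; apply/negP => ml; case: Ld => d [dE db].
  move: dE; rewrite tE t'E -(subnK ml) addnC exprD -!mulrA => /(mulfI (Xn_neq0 _)) dE.
  move: b0; rewrite -db -dE.
  by rewrite !hornerM hornerX !mulr0 eqxx.
have L1 := poly_lead_sub_comp l0 (ltnW K1) Lw Lu Lv Ld.
have M0 : (0 < M)%N by [].
have d1 : 'X^M %| (pw \Po su) - (su \Po pz).
  apply: (@jet_uniq _ _ (loc (Phi \o u) z)); first by rewrite loc_comp; apply: jet_comp.
  by rewrite cu loc_comp Pz; apply: jet_comp.
have d2 : 'X^M %| (pw \Po sv) - (sv \Po pz).
  apply: (@jet_uniq _ _ (loc (Phi \o v) z)).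
    by rewrite loc_comp -uv; apply: jet_comp.
  by rewrite cv loc_comp Pz; apply: jet_comp.
have L2 := poly_lead_comp (ltnW K1) Lz Ld.
rewrite -XE in L1.
have d3 : 'X^((m + X).+1) %| (pw \Po su) - (pw \Po sv).
  have -> : (pw \Po su) - (pw \Po sv) =
     ((pw \Po su) - (su \Po pz)) - ((pw \Po sv) - (sv \Po pz)) + ((su - sv) \Po pz).
    by rewrite comp_polyB; ring.
  apply: dvdp_add.
    by apply: dvdp_trans (dvdp_sub d1 d2); apply: dvdp_exp2l; rewrite /M; lia.
  have [t [-> _]] := L2; apply: dvdp_mulr; apply: dvdp_exp2l.
  have -> : (m * K = m + m * K.-1)%N by rewrite -{1}(prednK (ltnW K1)) mulnS.
  rewrite XE -addnS leq_add2l.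
  have K2 : (0 < K.-1)%N by case: (K) K1 => [|[]].
  by rewrite ltn_mul2r K2.
have [t [tE tb]] := L1.
have bad : lead Phi (u z) * (a ^+ K.-1 *+ K) * b != 0.
  by rewrite !mulf_neq0 ?lead_neq0 // mulrn_eq0 negb_or -lt0n (ltnW K1) expf_neq0 // lead_neq0.
move: d3; rewrite tE exprSr dvdp_mul2l ?expf_neq0 ?polyX_eq0 //.
by rewrite -[X in X %| _]subr0 dvdp_XsubCl /root tb (negPf bad).
Qed.

Lemma iter_loc n f z : f z = z -> iter n (loc f z) =1 unchart z \o iter n f \o chart z.
Proof.
move=> fz; elim: n => [|n IH] x /=; first by rewrite chartK.
by rewrite IH /loc /= fz unchartK.
Qed.

(** Let [b X^m] be the first term of [f \o g - g \o f].  It propagates: the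
    coefficient of [X^m] in [iter j f \o g - g \o iter j f] is [b] times
    [\sum_(i < j) mu ^+ (j - 1 - i) * la ^+ (i * m)], where [la] and
    [mu = la ^+ k] are the multipliers at [z] and [g z].  As [m] differs from
    [k], this sum is nonzero for [la] equal to 1 or of infinite order. *)
Lemma rigid_linear f g z n : End f -> End g -> f z = z -> f (g z) = g z ->
  mult f z = 1%N -> mult f (g z) = 1%N ->
  lead f (g z) = lead f z ^+ mult g z ->
  lead f z = 1 \/ (forall i, (0 < i)%N -> lead f z ^+ i != 1) ->
  (0 < n)%N -> (forall x, iter n f (g x) = g (iter n f x)) -> f \o g = g \o f.
Proof.
move=> Ef Eg fz fw mz mw lw hl n0 comm.
have [ef _] := Ef; have [eg _] := Eg.
case: (pselect (loc (f \o g) z = loc (g \o f) z)) => [|nl].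
  by apply: loc_inj; rewrite /= fz fw.
have [m [b [b0 mb]]] := first_diff (endo_loc z (endo_comp ef eg)) (loc0 _ _)
   (endo_loc z (endo_comp eg ef)) (loc0 _ _) nl.
set k := mult g z in lw; set a := lead g z.
set la := lead f z in lw hl; set mu := lead f (g z) in lw.
pose M := (m + k + 1).+1; have M0 : (0 < M)%N by [].
have [p jp] := jet_ex M (endo_loc z ef) (loc0 f z).
have [q jq] := jet_ex M (endo_loc (g z) ef) (loc0 f (g z)).
have [s js] := jet_ex M (endo_loc z eg) (loc0 g z).
have Lp : poly_lead p 1 la by rewrite -mz; apply: (mult_lead_loc Ef _ jp); rewrite mz /M; lia.
have Lq : poly_lead q 1 mu by rewrite -mw; apply: (mult_lead_loc Ef _ jq); rewrite mw /M; lia.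
have Ls : poly_lead s k a by apply: (mult_lead_loc Eg _ js); rewrite -/k /M; lia.
have k0 : (0 < k)%N by apply: mult_gt0.
have la0 : la != 0 by apply: lead_neq0.
have j1 : jet M (loc (f \o g) z) (q \Po s) by rewrite loc_comp; apply: jet_comp.
have j2 : jet M (loc (g \o f) z) (s \Po p) by rewrite loc_comp fz; apply: jet_comp.
have Ld : poly_lead ((q \Po s) - (s \Po p)) m b by apply: mb j1 j2; rewrite /M; lia.
(* the terms of degree [k] agree because the multipliers correspond *)
have km : (k != m)%N.
  have L1 := poly_lead_comp k0 Ls Lq; have L2 := poly_lead_comp (ltn0Sn 0) Lp Ls.
  rewrite mul1n expr1 in L1; rewrite muln1 -lw mulrC in L2.
  have := poly_leadD L1 (poly_leadN L2); rewrite subrr => -[t [tE t0]].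
  apply/eqP => E; case: Ld => d [dE db]; move: dE; rewrite tE E.
  move/(mulfI (Xn_neq0 _)) => td.
  by move: b0; rewrite -db -td t0 eqxx.
(* [c j] is the sum above; [pj j] truncates the [j]-th iterate of [f] at [z] *)
pose c j := iteri j (fun i x => mu * x + la ^+ (i * m)) 0.
pose pj j := iter j (fun r => p \Po r) 'X.
have Lpj j : poly_lead (pj j) 1 (la ^+ j).
  elim: j => [|j IH]; first by exists 1; rewrite mulr1 hornerC.
  by have := poly_lead_comp (ltn0Sn 0) IH Lp; rewrite muln1 expr1 -exprS.
have LA j : poly_lead (iter j (fun r => q \Po r) s) k (mu ^+ j * a).
  elim: j => [|j IH]; first by rewrite mul1r.
  by have := poly_lead_comp k0 IH Lq; rewrite mul1n expr1 mulrA -exprS.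
have LB j : poly_lead (s \Po pj j) k (mu ^+ j * a).
  have := poly_lead_comp (ltn0Sn 0) (Lpj j) Ls.
  by rewrite muln1 -exprM mulnC exprM -lw mulrC.
have key j : poly_lead (iter j (fun r => q \Po r) s - (s \Po pj j)) m (b * c j).
  elim: j => [|j IH].
    by exists 0; rewrite /= comp_polyXr subrr mulr0 horner0 mulr0.
  have -> : iter j.+1 (fun r => q \Po r) s - (s \Po pj j.+1) =
     ((q \Po iter j (fun r => q \Po r) s) - (q \Po (s \Po pj j)))
     + (((q \Po s) - (s \Po p)) \Po pj j).
    by rewrite comp_polyB /pj !iterS !comp_polyA; ring.
  have L1 := poly_lead_sub_comp k0 (ltn0Sn 0) Lq (LA j) (LB j) IH.
  have L2 := poly_lead_comp (ltn0Sn 0) (Lpj j) Ld.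
  rewrite muln0 addn0 expr0 mulr1n mulr1 in L1; rewrite muln1 in L2.
  have := poly_leadD L1 L2; rewrite -exprM.
  by rewrite (_ : mu * (b * c j) + b * la ^+ (j * m) = b * c j.+1) // /c /=; ring.
have JA j : jet M (iter j (loc f (g z)) \o loc g z) (iter j (fun r => q \Po r) s).
  elim: j => [|j IH] //.
  by apply: (jet_comp M0 IH jq).
have JB j : jet M (iter j (loc f z)) (pj j).
  elim: j => [|j IH]; last exact: (jet_comp M0 IH jp).
  have gi : germ (iter 0 (loc f z)) 'X 1.
    by split; rewrite ?hornerC ?hornerX ?oner_eq0 // => x _; rewrite hornerC hornerX divr1.
  by exists 'X, 1; split=> //; rewrite mulr1 subrr dvdp0.
have JC : jet M (iter n (loc f (g z)) \o loc g z) (s \Po pj n).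
  rewrite (_ : _ \o _ = loc g z \o iter n (loc f z)); first exact: jet_comp.
  apply/funext => x /=; rewrite !iter_loc // /loc /= !unchartK.
  by rewrite comm.
have cn : b * c n = 0.
  have dv := jet_uniq (JA n) JC; have [t [tE <-]] := key n.
  have : ('X^(m.+1) : {poly F}) %| 'X^m * t.
    by rewrite -tE; apply: dvdp_trans dv; apply: dvdp_exp2l; rewrite /M; lia.
  rewrite exprSr dvdp_mul2l ?expf_neq0 ?polyX_eq0 //.
  by rewrite -[X in X %| _]subr0 dvdp_XsubCl => /rootP.
have {cn} cn : c n = 0 by apply/eqP; move/eqP: cn; rewrite mulf_eq0 (negPf b0).
case: hl => [la1|lar].
  have cj j : c j = j%:R.
    elim: j => // j IH; rewrite /c /= -/(c j) IH lw la1 !expr1n mul1r.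
    by rewrite -[in RHS]addn1 natrD.
  by move/eqP: cn; rewrite cj pnatr_eq0 => /eqP n00; rewrite n00 in n0.
have cj j : c j * (mu - la ^+ m) = mu ^+ j - la ^+ (j * m).
  elim: j => [|j IH]; first by rewrite mul0r mul0n !expr0 subrr.
  rewrite /c /= -/(c j) mulrDl -mulrA IH mulSn exprD exprS; ring.
have := cj n; rewrite cn mul0r => /esym/eqP; rewrite subr_eq0 lw -exprM => /eqP E.
exfalso; have [i [j [ij E']]] : exists i j : nat, (i < j)%N /\ la ^+ i = la ^+ j.
  case: (ltngtP k m) km => // h _.
    by exists (k * n)%N, (n * m)%N; split=> //; rewrite [X in (X < _)%N]mulnC ltn_mul2l n0.
  by exists (n * m)%N, (k * n)%N; split=> //; rewrite [X in (_ < X)%N]mulnC ltn_mul2l n0.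
have := lar (j - i)%N; rewrite subn_gt0 => /(_ ij).
have : la ^+ i * la ^+ (j - i) = la ^+ i * 1 by rewrite -exprD subnKC ?mulr1 // ltnW.
by move/(mulfI (expf_neq0 i la0)) ->; rewrite eqxx.
Qed.

End Rigidity.

(** * Iterates *)

Section Iterates.
Local Open Scope ring_scope.
Variable F : numClosedFieldType.
Local Notation P1 := (P1 F).
Implicit Types (f g u v : P1 -> P1) (x y z w : P1).

Lemma End_iter n f : End f -> End (iter n f).
Proof. by move=> Ef; elim: n => [|n IH]; [exact: End_id|exact: End_comp Ef IH]. Qed.

Lemma deg_gt0 f : End f -> (0 < deg f)%N.
Proof. by move=> Ef; apply/(End_deg (proj1 Ef)). Qed.

Lemma deg_iter n f : End f -> deg (iter n f) = (deg f ^ n)%N.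
Proof.
move=> Ef; elim: n => [|n IH]; first exact: deg_id.
by rewrite (deg_comp (proj1 Ef) (proj1 (End_iter n Ef))) IH expnS.
Qed.

Lemma mult_iterD a b f z : End f ->
  mult (iter (a + b) f) z = (mult (iter a f) (iter b f z) * mult (iter b f) z)%N.
Proof.
move=> Ef; rewrite -mult_comp; try exact: End_iter.
by congr (mult _ z); apply/funext => x /=; rewrite iterD.
Qed.

Lemma mult_iterS n f z : End f ->
  mult (iter n.+1 f) z = (mult (iter n f) (f z) * mult f z)%N.
Proof. by move=> Ef; rewrite -addn1 mult_iterD. Qed.

Lemma mult_iter_le a b f z : End f -> (a <= b)%N ->
  (mult (iter a f) z <= mult (iter b f) z)%N.
Proof.
move=> Ef /subnK <-; rewrite mult_iterD // leq_pmull //.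
by apply: mult_gt0; apply: End_iter.
Qed.

Lemma mult_iter_prod n f z : End f ->
  mult (iter n f) z = (\prod_(y <- traject f z n) mult f y)%N.
Proof.
move=> Ef; elim: n z => [|n IH] z; first by rewrite big_nil mult_id.
by rewrite mult_iterS // trajectS big_cons IH mulnC.
Qed.

Lemma prod_mult_dvd f (s t : seq P1) : uniq s -> uniq t ->
  (forall z, (z \in t) = (1 < mult f z)%N) -> End f ->
  (\prod_(z <- s) mult f z %| \prod_(z <- t) mult f z)%N.
Proof.
move=> us ut tP Ef; rewrite (bigID (mem t)) /= [X in (_ * X)%N]big1 ?muln1; last first.
  by move=> z; rewrite tP; have := mult_gt0 z Ef; case: (mult f z) => [|[]].
rewrite [X in (_ %| X)%N](bigID (mem s)) /= dvdn_mulr //.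
rewrite -[X in (X %| _)%N]big_filter -[X in (_ %| X)%N]big_filter.
rewrite (perm_big [seq z <- t | z \in s]) //.
apply: uniq_perm; rewrite ?filter_uniq // => z.
by rewrite !mem_filter andbC.
Qed.

Definition comm g f n := forall z, g (iter n f z) = iter n f (g z).

Lemma comm_mul g f n m : comm g f n -> comm g f (n * m).
Proof.
move=> c; elim: m => [|m IH] z; first by rewrite muln0.
by rewrite mulnS !iterD c IH.
Qed.

Lemma comm_dvd g f n m : (n %| m)%N -> comm g f n -> comm g f m.
Proof. by move=> /dvdnP[k ->]; rewrite mulnC; apply: comm_mul. Qed.

Lemma comm_iter_self a f n : comm (iter a f) f n.
Proof. by move=> z; rewrite -!iterD addnC. Qed.

(** The conclusion sought for [f]: the exponent must not depend on [g] and [n]. *)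
Definition stabilizes f := exists N, (0 < N)%N /\
  forall g n, End g -> (0 < n)%N -> comm g f n -> comm g f N.

Definition periodic f z := exists n, (0 < n)%N /\ iter n f z = z.
Definition preperiodic f z := exists i j, (i < j)%N /\ iter i f z = iter j f z.

Lemma iter_cycle f z n a k : iter n f z = z -> iter (a + n * k) f z = iter a f z.
Proof.
move=> h; rewrite iterD; congr (iter a f _).
by elim: k => [|k IH]; rewrite ?muln0 // mulnS iterD IH.
Qed.

Lemma preperiodic_cycle f z i j a k : (i <= j)%N -> iter i f z = iter j f z -> (i <= a)%N ->
  iter (a + (j - i) * k) f z = iter a f z.
Proof.
move=> ij h ia; have c : iter (j - i) f (iter i f z) = iter i f z.
  by rewrite -iterD subnK.
have := iter_cycle (a - i) k c.
by rewrite -!iterD subnK // addnAC subnK.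
Qed.

Lemma preperiodic_iter f z i : preperiodic f (iter i f z) -> preperiodic f z.
Proof.
by move=> [a [b [ab h]]]; exists (a + i)%N, (b + i)%N; rewrite ltn_add2r !iterD.
Qed.

Lemma preperiodic_comm g f n z : (0 < n)%N -> comm g f n ->
  preperiodic f z -> preperiodic f (g z).
Proof.
move=> n0 c [i [j [ij h]]]; exists (n * i)%N, (n * j)%N; split.
  by rewrite ltn_mul2l n0.
rewrite -(comm_mul i c z) -(comm_mul j c z); congr g.
have := preperiodic_cycle n (ltnW ij) h (leq_pmull i n0).
by rewrite [((j - i) * n)%N]mulnC -mulnDr subnKC // ltnW.
Qed.

Lemma orbit_inj f z : ~ preperiodic f z -> injective (fun i => iter i f z).
Proof.
move=> np i j /= h; case: (ltngtP i j) => // ij; case: np.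
- by exists i, j.
- by exists j, i.
Qed.

Lemma avoid (T : eqType) (phi : nat -> T) (s : seq T) a : injective phi ->
  exists i, (a <= i)%N /\ phi i \notin s.
Proof.
move=> inj; apply: contrapT => h.
have : (size [seq phi i | i <- iota a (size s).+1] <= size s)%N.
  apply: uniq_leq_size; first by rewrite map_inj_uniq // iota_uniq.
  move=> y hy; have [i hi ->] := mapP hy.
  move: hi; rewrite mem_iota => /andP[ai _].
  by apply: contrapT => /negP n; apply: h; exists i.
by rewrite size_map size_iota ltnn.
Qed.

Lemma pigeonhole (T : eqType) (phi : nat -> T) (s : seq T) :
  (forall i, phi i \in s) -> exists i j, (i < j <= size s)%N /\ phi i = phi j.
Proof.
move=> h; apply: contrapT => nh.
have : (size [seq phi i | i <- iota 0 (size s).+1] <= size s)%N.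
  apply: uniq_leq_size; last by move=> y /mapP[i _ ->].
  rewrite map_inj_in_uniq ?iota_uniq // => i j.
  rewrite !mem_iota !add0n !ltnS /= => ls ls' e.
  by case: (ltngtP i j) => // ij; case: nh; [exists i, j|exists j, i]; rewrite ij ?ls ?ls'.
by rewrite size_map size_iota ltnn.
Qed.

(** The number of coincidences of distinct morphisms is bounded.  Arithmetic
    progressions of times are enough, which leaves room for imposing that an
    exponent be a multiple of [n]. *)
Lemma orbit_eq u v f x a b : End u -> End v -> (0 < b)%N -> ~ preperiodic f x ->
  (forall i, u (iter (a + b * i) f x) = v (iter (a + b * i) f x)) -> u = v.
Proof.
move=> Eu Ev b0 np h.
pose s := [seq iter (a + b * i) f x | i <- iota 0 (deg u + deg v).+1].
apply: (@coincidence _ u v s); rewrite /s ?size_map ?size_iota //.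
- by case: Eu.
- by case: Ev.
- rewrite map_inj_uniq ?iota_uniq // => i j /(orbit_inj np) /addnI /eqP.
  by rewrite eqn_mul2l gtn_eqF //= => /eqP.
by move=> z /mapP[i _ ->].
Qed.

End Iterates.

(** * A critical point with infinite orbit *)

Section InfiniteCriticalOrbit.
Local Open Scope ring_scope.
Variable F : numClosedFieldType.
Local Notation P1 := (P1 F).
Variable f : P1 -> P1.
Hypothesis Ef : End f.
Variable Cr : seq P1.
Hypothesis uCr : uniq Cr.
Hypothesis CrP : forall z, (z \in Cr) = (1 < mult f z)%N.
Variable c0 : P1.
Hypothesis c0_crit : c0 \in Cr.
Hypothesis c0_wander : ~ preperiodic f c0.
Implicit Types (g : P1 -> P1) (x y z w : P1).

(** An infinite orbit meets each critical point at most once, so its total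
    ramification divides the product of all local degrees. *)
Lemma max_mult : exists M, (exists x j, ~ preperiodic f x /\ mult (iter j f) x = M)
  /\ forall x j, ~ preperiodic f x -> (mult (iter j f) x <= M)%N.
Proof.
pose P M := `[< exists x j, ~ preperiodic f x /\ mult (iter j f) x = M >].
have bnd : forall M, P M -> (M <= \prod_(z <- Cr) mult f z)%N.
  move=> M /asboolP[x [j [np <-]]]; rewrite mult_iter_prod //.
  apply: dvdn_leq.
    rewrite big_seq; apply: (big_ind (fun n => 0 < n)%N) => //.
      by move=> a b a0 b0; rewrite muln_gt0 a0.
    by move=> z _; apply: mult_gt0.
  apply: prod_mult_dvd => //; elim: j x np => [|j IH] y np //.
  rewrite trajectS cons_uniq IH ?andbT; last first.
    by move=> h; apply: np; apply: (@preperiodic_iter _ f y 1).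
  apply/trajectP => -[i _ h]; apply: np; exists 0%N, i.+1; split=> //.
  by rewrite iterSr.
have ex : exists M, P M.
  by exists (mult (iter 0 f) c0); apply/asboolP; exists c0, 0%N.
exists (ex_maxn ex bnd); case: ex_maxnP => M /asboolP PM hM; split=> // x j np.
by apply: hM; apply/asboolP; exists x, j.
Qed.

Section Maximal.
Variable M : nat.
Hypothesis maxM : forall x j, ~ preperiodic f x -> (mult (iter j f) x <= M)%N.

(** The points of infinite orbit whose total ramification along the orbit is
    the greatest possible. *)
Definition top x := ~ preperiodic f x /\ exists j, mult (iter j f) x = M.

Lemma top_M : (1 < M)%N.
Proof.
apply: leq_trans (maxM 1 c0_wander); rewrite (_ : iter 1 f = f) -?CrP //.
Qed.

Lemma top_crit x : top x -> exists i, top (iter i f x) /\ iter i f x \in Cr.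
Proof.
move=> [np [j]]; elim: j x np => [|j IH] x np.
  by rewrite mult_id => h; have := top_M; rewrite -h.
move=> e; have e' := e; move: e; rewrite mult_iterS //.
have [m1 _|] := boolP (x \in Cr); first by exists 0%N; split=> //; split=> //; exists j.+1.
rewrite CrP; have := mult_gt0 x Ef; case: (mult f x) => [|[|n]] //= _ _.
rewrite muln1; case/IH.
  by move=> h; apply: np; apply: (@preperiodic_iter _ f x 1).
by move=> i [t m]; exists i.+1; rewrite iterSr.
Qed.

(** Far along the orbit of [z] the map [g] is unramified, and comparing local
    degrees in [g \o iter J f = iter J f \o g] for large [J] shows that the
    ramification of [f] along the orbit of [z] is [M * mult g z]; by maximality of
    [M] it is [M]. *)
Lemma top_preim g n z : End g -> (0 < n)%N -> comm g f n -> top (g z) -> top z.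
Proof.
move=> Eg n0 c [np [j e]].
have npz : ~ preperiodic f z by move=> h; apply: np; apply: preperiodic_comm n0 c h.
split=> //; have [Cg [uCg CgP _]] := critical Eg.
have inj : injective (fun i => iter (n * i) f z).
  move=> a b /(orbit_inj npz) /eqP; rewrite eqn_mul2l gtn_eqF //= => /eqP//.
have [i [ji]] := avoid Cg j inj.
rewrite CgP -leqNgt => m1; exists (n * i)%N.
have m1' : mult g (iter (n * i) f z) = 1%N by apply/eqP; rewrite eqn_leq m1 mult_gt0.
have EI := End_iter (n * i) Ef.
have h1 : mult (g \o iter (n * i) f) z = mult (iter (n * i) f) z.
  by rewrite mult_comp // m1' mul1n.
have h2 : mult (iter (n * i) f \o g) z = (M * mult g z)%N.
  rewrite mult_comp //; congr (_ * _)%N; apply/eqP; rewrite eqn_leq maxM //=.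
  rewrite -e; apply: mult_iter_le => //; apply: leq_trans ji _.
  exact: leq_pmull.
have h3 : g \o iter (n * i) f = iter (n * i) f \o g.
  by apply/funext => x /=; rewrite (comm_mul i c).
apply/eqP; rewrite eqn_leq maxM //= -h1 h3 h2 leq_pmulr // mult_gt0 //.
Qed.

(** Two of the backward paths described at [step] end at the same critical point
    [c1].  Along the orbit of [c1] the maps [iter (j' - j) f \o g] and
    [g \o iter (i' - i) f] agree, hence they are equal, and comparing degrees
    gives [i' - i = j' - j]. *)
Lemma commute_bounded_exponent g n c : End g -> (0 < n)%N -> comm g f n -> top c ->
  exists t, (0 < t <= size Cr)%N /\ comm g f t.
Proof.
move=> Eg n0 cg tc.
(* pull [c] back by [iter j f], then by [g], and flow to a critical point *)
have step j : exists zi : P1 * nat, [/\ iter j f (g zi.1) = c,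
    ~ preperiodic f (iter zi.2 f zi.1) & iter zi.2 f zi.1 \in Cr].
  have Ej := End_iter j Ef; have [w wE] := End_surj c Ej.
  have [z zE] := End_surj w Eg.
  have tw : top w.
    by apply: (top_preim Ej (ltn0Sn 0) (comm_iter_self j f 1)); rewrite wE.
  have tz : top z by apply: (top_preim Eg n0 cg); rewrite zE.
  have [i [ti ci]] := top_crit tz; exists (z, i); split=> //=; first by rewrite zE.
  by case: ti.
have [phi phiP] := choice step.
have [j [j' [/andP[jj js] e]]] := @pigeonhole _ (fun j => iter (phi j).2 f (phi j).1) Cr
  (fun j => let: And3 _ _ h := phiP j in h).
have [h1 np _] := phiP j; have [h1' _ _] := phiP j'.
exists (j' - j)%N; split; first by rewrite subn_gt0 jj (leq_trans (leq_subr _ _)).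
move: np e h1 h1'; set i := (phi j).2; set i' := (phi j').2.
set z := (phi j).1; set z' := (phi j').1.
have [c1 c1E] : exists c1, c1 = iter i f z by eexists.
rewrite -c1E => np e h1 h1'.
have key m k y : (i <= m)%N -> (j <= m)%N -> (n %| m)%N -> iter k f (g y) = c ->
   (k <= m)%N -> g (iter m f y) = iter (m - k) f c.
  move=> _ _ nm hc km; rewrite (comm_dvd nm cg) -{1}(subnK km) iterD hc //.
have d2 : (1 < deg f)%N.
  by apply: leq_trans (mult_le_deg c0 Ef); rewrite -CrP.
(* times [n * (a0 + q)] are multiples of [n] exceeding all of [i], [i'], [j], [j'] *)
pose a0 := (i + i' + j + j')%N.
have m0 q : (a0 + q <= n * (a0 + q))%N by apply: leq_pmull.
have eq1 q : g (iter (n * (a0 + q) - i) f c1) = iter (n * (a0 + q) - j) f c.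
  have := m0 q; rewrite {1}/a0 => hm.
  rewrite c1E -iterD subnK; last by lia.
  by apply: key; rewrite ?dvdn_mulr //; lia.
have eq2 q : g (iter (n * (a0 + q) - i') f c1) = iter (n * (a0 + q) - j') f c.
  have := m0 q; rewrite {1}/a0 => hm.
  rewrite e -iterD subnK; last by lia.
  by apply: key; rewrite ?dvdn_mulr //; lia.
have EI k := End_iter k Ef.
have dI k : deg (iter k f) = (deg f ^ k)%N by apply: deg_iter.
have eg := proj1 Eg; have g0 := deg_gt0 Eg.
have [le|lt] := leqP i i'.
  have E : iter (j' - j) f \o g = g \o iter (i' - i) f.
    apply: (@orbit_eq _ _ _ f c1 (n * a0 - i') n) => //; try exact: End_comp.
    move=> q; have hm := m0 q; have hm0 := m0 0%N; rewrite /a0 addn0 in hm hm0.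
    rewrite -/a0 in hm hm0.
    have -> : (n * a0 - i' + n * q = n * (a0 + q) - i')%N.
      by rewrite mulnDr addnBAC //; rewrite /a0 in hm0 *; lia.
    rewrite /= eq2 -!iterD.
    have -> : (i' - i + (n * (a0 + q) - i') = n * (a0 + q) - i)%N.
      by rewrite /a0 in hm *; lia.
    by rewrite eq1; congr (iter _ f c); rewrite /a0 in hm *; lia.
  have := congr1 (@deg _) E.
  rewrite (deg_comp (proj1 (EI _)) eg) (deg_comp eg (proj1 (EI _))) !dI mulnC.
  move/eqP; rewrite eqn_mul2l gtn_eqF //= => /eqP/(expnI d2) tE.
  by move=> x; have := congr1 (fun k => k x) E; rewrite /= -tE.
(* for [i' < i] the same comparison contradicts the multiplicativity of degrees *)
have E : iter (j' - j) f \o g \o iter (i - i') f = g.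
  apply: (@orbit_eq _ _ _ f c1 (n * a0 - i) n) => //.
    by apply: End_comp => //; apply: End_comp.
  move=> q; have hm := m0 q; have hm0 := m0 0%N; rewrite addn0 in hm0.
  have -> : (n * a0 - i + n * q = n * (a0 + q) - i)%N.
    by rewrite mulnDr addnBAC //; rewrite /a0 in hm0 *; lia.
  rewrite /= -iterD.
  have -> : (i - i' + (n * (a0 + q) - i) = n * (a0 + q) - i')%N.
    by rewrite /a0 in hm *; lia.
  by rewrite eq1 eq2 -iterD; congr (iter _ f c); rewrite /a0 in hm *; lia.
have := congr1 (@deg _) E.
rewrite (deg_comp (endo_comp (proj1 (EI _)) eg) (proj1 (EI _))).
rewrite (deg_comp (proj1 (EI _)) eg) !dI => /eqP.
rewrite mulnAC -[X in _ == X]mul1n eqn_mul2r gtn_eqF //= -expnD.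
by rewrite -(expn0 (deg f)) => /eqP/(expnI d2); lia.
Qed.

End Maximal.

Lemma stabilizes_infinite_critical_orbit : stabilizes f.
Proof.
have [M [[x [j [np e]]] maxM]] := max_mult.
exists (size Cr)`!; split; first exact: fact_gt0.
move=> g n Eg n0 cg.
have [|t [/andP[t0 ts] ct]] := @commute_bounded_exponent M maxM g n x Eg n0 cg.
  by split=> //; exists j.
by apply: comm_dvd ct; rewrite dvdn_fact // t0.
Qed.

End InfiniteCriticalOrbit.

(** * Invariant finite sets of periodic points *)

Section FiniteSets.
Local Open Scope ring_scope.
Variable F : numClosedFieldType.
Local Notation P1 := (P1 F).
Implicit Types (f g u v : P1 -> P1) (x y z w : P1).

Lemma common_multiple (T : eqType) (s : seq T) (Q : T -> nat -> Prop) :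
  (forall a, a \in s -> exists n, (0 < n)%N /\ Q a n) ->
  (forall a n k, (0 < n)%N -> (0 < k)%N -> Q a n -> Q a (n * k)%N) ->
  exists n, (0 < n)%N /\ forall a, a \in s -> Q a n.
Proof.
move=> h hM; elim: s h => [|a s IH] h; first by exists 1%N.
have [|n [n0 hn]] := IH; first by move=> b bs; apply: h; rewrite inE bs orbT.
have [m [m0 hm]] := h a (mem_head _ _).
exists (m * n)%N; split; first by rewrite muln_gt0 m0.
move=> b; rewrite inE => /orP[/eqP->|bs]; first exact: hM.
by rewrite mulnC; apply: hM => //; apply: hn.
Qed.

Lemma seq_of_bounded (T : eqType) (P : T -> Prop) K :
  (forall s : seq T, uniq s -> (forall z : T, z \in s -> P z) -> (size s <= K)%N) ->
  exists s : seq T, uniq s /\ forall z : T, z \in s <-> P z.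
Proof.
move=> h; apply: contrapT => nh.
have big n : exists s : seq T, [/\ uniq s, (forall z : T, z \in s -> P z) & size s = n].
  elim: n => [|n [s [us sP sn]]]; first by exists [::].
  have [z [Pz zs]] : exists z : T, P z /\ z \notin s.
    apply: contrapT => h'; apply: nh; exists s; split=> // z; split; first exact: sP.
    by move=> Pz; apply: contrapT => /negP zs; apply: h'; exists z.
  exists (z :: s); split; rewrite /= ?zs ?sn // => w.
  by rewrite inE => /orP[/eqP->|/sP].
by have [s [us sP sn]] := big K.+1; have := h s us sP; rewrite sn ltnn.
Qed.

Lemma lead_iter_fixed f a k : End f -> f a = a -> mult f a = 1%N ->
  lead (iter k f) a = lead f a ^+ k /\ mult (iter k f) a = 1%N.
Proof.
move=> Ef fa ma; elim: k => [|k [IH1 IH2]]; first by rewrite lead_id mult_id.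
have ik : iter k f a = a by elim: (k) => // j /= ->.
have Ek := End_iter k Ef.
have E : iter k.+1 f = f \o iter k f by [].
by rewrite E lead_comp // mult_comp // ik ma IH1 IH2 expr1 exprS.
Qed.

Lemma iter_mul m n f z : iter (m * n) f z = iter n (iter m f) z.
Proof. by rewrite mulnC iterM. Qed.

Lemma iter_mulE m n f : iter (m * n) f = iter n (iter m f).
Proof. by apply/funext => z; rewrite iter_mul. Qed.

Lemma periodic_comm g f n z : comm g f n -> (0 < n)%N -> periodic f z -> periodic f (g z).
Proof.
move=> c n0 [m [m0 h]]; exists (n * m)%N; split; first by rewrite muln_gt0 n0.
rewrite -(comm_mul m c); congr g.
have := iter_cycle 0 n h; by rewrite add0n mulnC.
Qed.

(** The two kinds of multiplier to which [rigid_linear] applies. *)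
Definition root_free (la : F) := la = 1 \/ forall i, (0 < i)%N -> la ^+ i != 1.

(** An iterate [G] of [f] fixes [A] pointwise, with multipliers equal to 1 or of
    infinite order.  By [rigid_linear] at [p], the map [g] commutes with
    [iter N G] once the multipliers of [iter N G] at [p] and [g p] correspond.
    They do for [iter n G]; as the multiplier at [p] has infinite order or is 1,
    the exponents with this property for one [n] serve for all, and [A] is
    finite. *)
Lemma stabilizes_finite_set f (A : seq P1) p : End f -> p \in A ->
  (forall a, a \in A -> periodic f a /\ forall i, mult (iter i f) a = 1%N) ->
  (forall g n a, End g -> (0 < n)%N -> comm g f n -> a \in A -> g a \in A) ->
  stabilizes f.
Proof.
move=> Ef pA AP Ainv.
pose Q a n := iter n f a = a /\ root_free (lead (iter n f) a).
have [m [m0 mQ]] : exists m, (0 < m)%N /\ forall a, a \in A -> a \in A /\ Q a m.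
  apply: (@common_multiple _ A (fun a m => a \in A /\ Q a m)).
    move=> a aA; have [[n [n0 an]] am] := AP a aA.
    have [rf|] := pselect (forall i, (0 < i)%N -> lead (iter n f) a ^+ i != 1).
      by exists n; split=> //; split=> //; split=> //; right.
    move=> /existsNP[i /not_implyP[i0 /negP]]; rewrite negbK => /eqP l1.
    exists (n * i)%N; split; first by rewrite muln_gt0 n0.
    rewrite /Q iter_mulE.
    have [-> _] := lead_iter_fixed i (End_iter n Ef) an (am n).
    split=> //; split; last by left.
    by have := iter_cycle 0 i an; rewrite add0n iter_mulE.
  move=> a n k n0 k0 [aA [an rf]]; have [_ am] := AP a aA.
  rewrite /Q iter_mulE; have [-> _] := lead_iter_fixed k (End_iter n Ef) an (am n).
  split=> //; split; first by have := iter_cycle 0 k an; rewrite add0n iter_mulE.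
  case: rf => [->|rf]; first by left; rewrite expr1n.
  by right=> i i0; rewrite -exprM rf // muln_gt0 k0.
pose G := iter m f; have EG : End G := End_iter m Ef.
have Gfix a : a \in A -> G a = a by case/mQ => _ [].
have Gm a : a \in A -> mult G a = 1%N by move=> /AP[_ ->].
have Grf a : a \in A -> root_free (lead G a) by case/mQ => _ [].
(* [q] stands for [g p] and [k] for the local degree of [g] at [p] *)
pose R q N := forall k n, (0 < n)%N -> lead G q ^+ n = lead G p ^+ (k * n) ->
  lead G q ^+ N = lead G p ^+ (k * N).
have [N [N0 RN]] : exists N, (0 < N)%N /\ forall q, q \in A -> R q N.
  apply: (@common_multiple _ A R); last first.
    by move=> q n k n0 k0 h k' n' n'0 /(h _ _ n'0) e; rewrite exprM e -exprM mulnA.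
  move=> q qA.
  have [[[k n] /= [n0 e]]|ne] := pselect (exists kn : nat * nat,
      (0 < kn.2)%N /\ lead G q ^+ kn.2 = lead G p ^+ (kn.1 * kn.2)); last first.
    by exists 1%N; split=> // k n n0 e; case: ne; exists (k, n).
  exists n; split=> // k' n' n'0 e'.
  case: (Grf p pA) => [l1|rf]; first by rewrite e l1 !expr1n.
  rewrite e; congr (_ ^+ (_ * n)).
  have E : lead G p ^+ (k * n * n') = lead G p ^+ (k' * n' * n).
    transitivity (lead G q ^+ (n * n')); first by rewrite exprM -e -exprM.
    by rewrite [in RHS]exprM -e' -exprM mulnC.
  have lp0 : lead G p != 0 by apply: lead_neq0.
  have inj a b : (a < b)%N -> lead G p ^+ a = lead G p ^+ b -> False.
    move=> ab h; have := rf (b - a)%N; rewrite subn_gt0 => /(_ ab).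
    have : lead G p ^+ a * lead G p ^+ (b - a) = lead G p ^+ a * 1.
      by rewrite -exprD subnKC ?mulr1 // ltnW.
    by move/(mulfI (expf_neq0 a lp0)) ->; rewrite eqxx.
  apply/eqP; have : (k * n * n' == k' * n' * n)%N.
    by case: ltngtP => // /inj; case.
  by rewrite -!mulnA [(n' * n)%N]mulnC eqn_mul2r muln_eq0 (gtn_eqF n0) (gtn_eqF n'0).
exists (m * N)%N; split; first by rewrite muln_gt0 m0.
move=> g n Eg n0 cg.
have qA := Ainv g n p Eg n0 cg pA.
have cG : comm g G n by move=> z; rewrite -!iter_mul (comm_dvd _ cg) // dvdn_mull.
have [ln mn] := lead_iter_fixed n EG (Gfix _ qA) (Gm _ qA).
have [ln' mn'] := lead_iter_fixed n EG (Gfix _ pA) (Gm _ pA).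
have EGn := End_iter n EG.
have Gnp : iter n G p = p by elim: (n) => // j /= ->; apply: Gfix.
have rel : lead G (g p) ^+ n = lead G p ^+ (mult g p * n).
  have h : iter n G \o g = g \o iter n G by apply/funext => z /=; rewrite cG.
  have := congr1 (fun u => lead u p) h.
  rewrite (lead_comp p EGn Eg) (lead_comp p Eg EGn) Gnp ln ln' mn expr1 mulrC.
  by move/(mulfI (lead_neq0 p Eg)) ->; rewrite -exprM mulnC.
have relN := RN _ qA _ _ n0 rel.
have [lN mN] := lead_iter_fixed N EG (Gfix _ qA) (Gm _ qA).
have [lN' mN'] := lead_iter_fixed N EG (Gfix _ pA) (Gm _ pA).
have EGN := End_iter N EG.
have fixN a : a \in A -> iter N G a = a.
  by move=> aA; elim: (N) => // j /= ->; apply: Gfix.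
have := @rigid_linear F (iter N G) g p n EGN Eg (fixN _ pA) (fixN _ qA) mN' mN.
rewrite lN lN' => /(_ _ _ n0) h z; rewrite iter_mulE.
have E : iter N G \o g = g \o iter N G.
  apply: h.
  - by rewrite relN -exprM mulnC.
  - case: (Grf p pA) => [->|rf]; first by left; rewrite expr1n.
    by right=> i i0; rewrite -exprM rf // muln_gt0 N0.
  by move=> x; rewrite -iter_mulE (comm_dvd _ cG) // dvdn_mull.
by have := congr1 (fun u => u z) E.
Qed.

Lemma fixed_point f : End f -> exists z, f z = z.
Proof.
move=> Ef; have [p [q rf]] := degP (proj1 Ef).
have [fN|fN] := pselect (f None = None); first by exists None.
have [sp sq _ _] := rf.
have qd : q`_(deg f) != 0.
  by apply/eqP => qd; apply: fN; rewrite (represents_inf rf) /hpt qd eqxx.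
have sqE : size q = (deg f).+1.
  apply/eqP; rewrite eqn_leq sq ltnNge; apply: contra qd => h.
  by rewrite nth_default.
have q0 : q != 0 by rewrite -size_poly_eq0 sqE.
have sX : size ('X * q) = (deg f).+2 by rewrite mulrC size_mulX // sqE.
have sr : size (p - 'X * q) = (deg f).+2.
  by rewrite addrC size_polyDl size_polyN sX // ltnS.
have /closed_rootP[x /rootP] : size (p - 'X * q) != 1%N by rewrite sr.
rewrite hornerD hornerN hornerM hornerX => /eqP; rewrite subr_eq0 => /eqP px.
have qx : q.[x] != 0.
  apply/eqP => qx; have := represents_no_root rf (x := x).
  by rewrite px qx mulr0 eqxx => /(_ erefl).
by exists (Some x); rewrite (represents_finE rf qx) px mulfK.
Qed.

(** Three periodic points would make an iterate the identity, since two maps of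
    degree one agreeing at three points are equal.  So there are at most two, and
    a fixed point exists. *)
Lemma stabilizes_automorphism f : End f -> deg f = 1%N -> stabilizes f.
Proof.
move=> Ef d1.
have [[n [n0 fn]]|inf] := pselect (exists n, (0 < n)%N /\ iter n f = id).
  by exists n; split=> // g m _ _ _ z; rewrite fn.
have [A [uA AP]] : exists s : seq P1, uniq s /\ forall z, z \in s <-> periodic f z.
  apply: (@seq_of_bounded _ _ 2) => s us sP; rewrite leqNgt; apply/negP => s3.
  apply: inf.
  have [|a n k _ _ h|n [n0 hn]] := @common_multiple _ s (fun z n => iter n f z = z).
  - exact: sP.
  - by have := iter_cycle 0 k h; rewrite add0n.
  exists n; split=> //.
  apply: (@coincidence _ _ _ s) => //; first by case: (End_iter n Ef).
    exact: endo_id.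
  by rewrite deg_iter // d1 exp1n deg_id.
have [p fp] := fixed_point Ef.
apply: (@stabilizes_finite_set f A p) => //.
- by apply/AP; exists 1%N.
- move=> a /AP pa; split=> // i; apply/eqP; rewrite eqn_leq mult_gt0; last exact: End_iter.
  rewrite andbT; apply: leq_trans (mult_le_deg _ _) _; first exact: End_iter.
  by rewrite deg_iter // d1 exp1n.
- by move=> g n a Eg n0 c /AP pa; apply/AP; apply: periodic_comm c n0 pa.
Qed.

Lemma mult_iter_crit f n x : End f -> (1 < mult (iter n f) x)%N ->
  exists i, (i < n)%N /\ (1 < mult f (iter i f x))%N.
Proof.
move=> Ef; elim: n x => [|n IH] x; first by rewrite mult_id.
rewrite mult_iterS //; have [m1 _|] := ltnP 1 (mult f x); first by exists 0%N.
have := mult_gt0 x Ef; case: (mult f x) => [|[|k]] // _ _.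
by rewrite muln1 => /IH[i [ii mi]]; exists i.+1; rewrite iterSr.
Qed.

Lemma orbits_seq f (s : seq P1) : (forall c, c \in s -> preperiodic f c) ->
  exists L : seq P1, forall c a, c \in s -> iter a f c \in L.
Proof.
elim: s => [|c s IH] h; first by exists [::].
have [|L LP] := IH; first by move=> b bs; apply: h; rewrite inE bs orbT.
have [i [j [ij e]]] := h c (mem_head _ _).
exists ([seq iter b f c | b <- iota 0 j] ++ L) => b a.
rewrite inE mem_cat => /orP[/eqP->|bs]; last by rewrite LP ?orbT.
apply/orP; left.
elim/ltn_ind: a => a IHa; have [aj|ja] := ltnP a j.
  by apply/mapP; exists a; rewrite // mem_iota.
have -> : iter a f c = iter (a - j + i) f c.
  by rewrite iterD e -iterD subnK.
by apply: IHa; lia.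
Qed.

(** The periodic points that are not superattracting and on which an orbit lands
    after some ramification form a finite set [A], as such orbits pass through
    critical points.  It is preserved by [g]: if [x] is ramified and lands on [y],
    then [x] is not periodic, its iterated preimages are infinitely many, and
    [g] is unramified at one of them, [w]; so [g w] lands on [g y] with at least
    the ramification of [w]. *)
Lemma stabilizes_repelling_landing f (Cr : seq P1) c i : End f ->
  (forall z, (z \in Cr) = (1 < mult f z)%N) ->
  (forall z, z \in Cr -> preperiodic f z) ->
  c \in Cr -> periodic f (iter i f c) ->
  (forall j, mult (iter j f) (iter i f c) = 1%N) -> stabilizes f.
Proof.
move=> Ef CrP pre cCr per ns.
have [L LP] := orbits_seq pre.
pose P y := [/\ periodic f y, (forall j, mult (iter j f) y = 1%N)
  & exists x j, iter j f x = y /\ (1 < mult (iter j f) x)%N].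
pose A : seq P1 := [seq y <- L | `[< P y >]].
have AP y : y \in A <-> P y.
  rewrite mem_filter; split; first by case/andP => /asboolP.
  move=> Py; rewrite (asboolT Py) /=; have [_ _ [x [j [xy mj]]]] := Py.
  have [k [kj mk]] := mult_iter_crit Ef mj.
  rewrite -xy -(subnK (ltnW kj)) iterD; apply: LP.
  by rewrite CrP.
apply: (@stabilizes_finite_set f A (iter i f c)) => //.
- apply/AP; split=> //; exists c, i; split=> //.
  case: i per ns => [|i] per ns.
    by have := ns 1%N; rewrite (_ : iter 1 f = f) //= => h; move: cCr; rewrite CrP h.
  rewrite mult_iterS //; rewrite CrP in cCr; apply: leq_trans cCr _.
  by rewrite leq_pmull // mult_gt0 //; apply: End_iter.
- by move=> a /AP[].
move=> g n y Eg n0 cg /AP[py nsy [x [j [xy mj]]]]; apply/AP; split.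
- exact: periodic_comm cg n0 py.
- have [m [m0 my]] := py.
  have key k : mult (iter (n * m * k) f) (g y) = 1%N.
    have EI := End_iter (n * m * k) Ef.
    have h : iter (n * m * k) f \o g = g \o iter (n * m * k) f.
      by apply/funext => z /=; rewrite -mulnA (comm_mul _ cg).
    have yk : iter (n * m * k) f y = y.
      by have := iter_cycle 0 (n * k) my; rewrite add0n mulnA [(m * n)%N]mulnC.
    have := congr1 (fun u => mult u y) h.
    rewrite (mult_comp y EI Eg) (mult_comp y Eg EI) yk nsy muln1 => /eqP.
    by rewrite -[X in _ == X]mul1n eqn_mul2r gtn_eqF ?mult_gt0 //= => /eqP.
  move=> k; apply/eqP; rewrite eqn_leq mult_gt0; last exact: End_iter.
  rewrite andbT -(key k); apply: mult_iter_le => //.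
  by rewrite leq_pmull // muln_gt0 n0.
have npx : ~ periodic f x.
  move=> [m [m0 xm]].
  have yx : iter (m * j - j) f y = x.
    rewrite -xy -iterD subnK; last exact: leq_pmull.
    by have := iter_cycle 0 j xm.
  have := nsy (j + (m * j - j))%N; rewrite mult_iterD // yx => /eqP.
  by rewrite muln_eq1 => /andP[/eqP h _]; rewrite h in mj.
have [phi phiE] := choice (fun b => End_surj x (End_iter b Ef)).
have inj : injective phi.
  move=> a b e; case: (ltngtP a b) => // ab; case: npx.
    exists (b - a)%N; rewrite subn_gt0 ab; split=> //.
    by rewrite -{1}(phiE a) e -iterD subnK ?phiE // ltnW.
  exists (a - b)%N; rewrite subn_gt0 ab; split=> //.
  by rewrite -{1}(phiE b) -e -iterD subnK ?phiE // ltnW.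
have [Cg [uCg CgP _]] := critical Eg.
have hj b : (j <= n * (b + j))%N.
  by apply: leq_trans (leq_pmull (b + j) n0); apply: leq_addl.
have inj' : injective (fun b => phi (n * (b + j) - j)%N).
  move=> a b /inj e; have := congr1 (addn^~ j) e; rewrite /= !subnK // => /eqP.
  by rewrite eqn_mul2l gtn_eqF //= eqn_add2r => /eqP.
have [b [_]] := avoid Cg 0 inj'; rewrite CgP -leqNgt.
set J := (n * (b + j))%N; set w := phi _ => mw.
have mw1 : mult g w = 1%N by apply/eqP; rewrite eqn_leq mw mult_gt0.
have wJ : iter J f w = y.
  by rewrite -xy -[in RHS](phiE (J - j)%N) -iterD subnKC // /J.
have EJ := End_iter J Ef.
exists (g w), J; split; first by rewrite -(comm_mul (b + j) cg) -/J wJ.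
have h : iter J f \o g = g \o iter J f.
  by apply/funext => z /=; rewrite (comm_mul _ cg).
have := congr1 (fun u => mult u w) h.
rewrite (mult_comp w EJ Eg) (mult_comp w Eg EJ) mw1 muln1 wJ => ->.
have -> : iter J f = iter (j + (J - j)) f by rewrite subnKC // /J.
rewrite mult_iterD // phiE; apply: leq_trans mj _.
by rewrite mulnCA leq_pmulr // muln_gt0 !mult_gt0 //; apply: End_iter.
Qed.

End FiniteSets.

(** * Lueroth's theorem for the rational functions equalizing two morphisms *)

Section Bivariate.
Local Open Scope ring_scope.
Variable F : numClosedFieldType.
Implicit Types (f g N : {poly {poly F}}) (c A B w : {poly F}) (x y : F).

(** Polynomials in [T] over [F[x]], and their specializations at [x = y]. *)
Definition spec y f : {poly F} := map_poly (horner_eval y) f.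

Lemma spec_coef y f i : (spec y f)`_i = (f`_i).[y].
Proof. by rewrite coef_map. Qed.

Lemma specM y f g : spec y (f * g) = spec y f * spec y g.
Proof. exact: rmorphM. Qed.

Lemma specB y f g : spec y (f - g) = spec y f - spec y g.
Proof. exact: rmorphB. Qed.

Lemma specC y c : spec y c%:P = (c.[y])%:P.
Proof. exact: map_polyC. Qed.

Lemma spec_cst y A : spec y (map_poly polyC A) = A.
Proof. by apply/polyP => i; rewrite spec_coef coef_map hornerC. Qed.

Lemma spec_eq0 x f : spec x f = 0 -> exists g, f = ('X - x%:P)%:P * g.
Proof.
move=> f0; pose g := \poly_(i < size f) (f`_i %/ ('X - x%:P)).
exists g; apply/polyP => i; rewrite coefCM coef_poly; case: ifP => h; last first.
  by rewrite nth_default ?mulr0 // leqNgt h.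
rewrite mulrC divpK // dvdp_XsubCl; apply/rootP.
by rewrite -spec_coef f0 coef0.
Qed.

Definition primitive f := forall x, spec x f != 0.

Lemma primitive_part f : f != 0 ->
  exists c g, [/\ c != 0, f = c%:P * g & primitive g].
Proof.
move: {2}(size (lead_coef f)) (leqnn (size (lead_coef f))) => n.
elim: n f => [|n IH] f ln f0.
  by move: ln; rewrite leqn0 size_poly_eq0 lead_coef_eq0 (negPf f0).
have [pf|] := pselect (primitive f).
  by exists 1, f; rewrite oner_neq0 mul1r.
move=> /existsNP[x /negP]; rewrite negbK => /eqP /spec_eq0 [g fE].
have g0 : g != 0 by apply: contraNneq f0 => g0; rewrite fE g0 mulr0.
have lE : lead_coef f = ('X - x%:P) * lead_coef g by rewrite fE lead_coefM lead_coefC.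
have [] := IH g _ g0.
  rewrite -ltnS; apply: leq_trans ln; rewrite lE.
  by rewrite mulrC size_Mmonic ?monicXsubC ?lead_coef_eq0 // size_XsubC addn2.
move=> c [g' [c0 gE pg']]; exists (('X - x%:P) * c), g'; split=> //.
  by rewrite mulf_neq0 // polyXsubC_eq0.
by rewrite fE gE polyCM mulrA.
Qed.

Lemma dvdp_scale (k : F) A w : w %| A -> w %| k *: A.
Proof. by rewrite -mul_polyC; apply: dvdp_mull. Qed.

(** Gauss's lemma: a root of [c] annihilates the specialization of [g], as it does
    not annihilate that of the primitive [f], and can be cancelled. *)
Lemma gauss c f g N : primitive f -> c != 0 -> c%:P * N = g * f ->
  exists g', N = g' * f.
Proof.
move=> pf; move: {2}(size c) (leqnn (size c)) => n.
elim: n c g => [|n IH] c g ln c0 e.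
  by move: ln; rewrite leqn0 size_poly_eq0 (negPf c0).
have [/closed_rootP [x cx]|] := boolP (size c != 1%N); last first.
  rewrite negbK => /size_poly1P[a a0 cE]; exists ((a^-1)%:P%:P * g).
  by rewrite -mulrA -e cE mulrA -!polyCM mulVf // mul1r.
have : spec x g * spec x f = 0 by rewrite -specM -e specM specC (rootP cx) mul0r.
move/eqP; rewrite mulf_eq0 (negPf (pf x)) orbF => /eqP/spec_eq0[g' gE].
move: cx; rewrite -dvdp_XsubCl => /dvdpP[c' cE].
have c'0 : c' != 0 by apply: contraNneq c0 => h; rewrite cE h mul0r.
apply: (IH c' g') => //.
  rewrite -ltnS; apply: leq_trans ln; rewrite cE.
  by rewrite size_Mmonic ?monicXsubC // size_XsubC addn2.
have X0 : ('X - x%:P)%:P != 0 :> {poly {poly F}} by rewrite polyC_eq0 polyXsubC_eq0.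
apply: (mulfI X0); rewrite mulrA -polyCM [_ * c']mulrC -cE e gE; ring.
Qed.

(** The numerator of [A(T)/B(T) - A(x)/B(x)]. *)
Definition biv A B : {poly {poly F}} :=
  map_poly polyC A * B%:P - map_poly polyC B * A%:P.

(** Its roots are the points where [A / B] takes the same value as at [y]. *)
Definition bez A B y : {poly F} := B.[y] *: A - A.[y] *: B.

Lemma spec_biv A B y : spec y (biv A B) = bez A B y.
Proof. by rewrite /biv specB !specM !spec_cst !specC /bez -!mul_polyC ![_%:P * _]mulrC. Qed.

Lemma horner_bez A B y x : (bez A B y).[x] = B.[y] * A.[x] - A.[y] * B.[x].
Proof. by rewrite /bez hornerD hornerN !hornerZ. Qed.

Lemma size_swap_biv A B : (size (swapXY (biv A B)) <= maxn (size A) (size B))%N.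
Proof.
rewrite /biv rmorphB !rmorphM /= !swapXY_map_polyC !swapXY_polyC.
apply: leq_trans (size_polyD _ _) _; rewrite size_polyN geq_max.
rewrite !mul_polyC; apply/andP; split; apply: leq_trans (size_scale_leq _ _) _;
  by rewrite size_map_polyC leq_max leqnn ?orbT.
Qed.

End Bivariate.

Section Lueroth.
Local Open Scope ring_scope.
Variable F : numClosedFieldType.
Local Notation P1 := (P1 F).
Implicit Types (f : {poly {poly F}}) (A B w : {poly F}) (r u v b : P1 -> P1) (z : P1).

Fact size_factor_le1 (a b m : nat) :
  (0 < b -> m <= b -> (a + b).-1 <= m -> a <= 1)%N.
Proof. lia. Qed.

Lemma hpt_scale (k x y : F) : k != 0 -> hpt (k * x) (k * y) = hpt x y.
Proof.
move=> k0; rewrite /hpt mulf_eq0 (negPf k0) /=; case: eqP => // /eqP y0.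
by congr Some; field; rewrite y0 k0.
Qed.

(** Conversely to [represents_coprime]. *)
Lemma mk_represents A B : coprimep A B ->
  exists r, represents (maxn (size A) (size B)).-1 A B r.
Proof.
move=> cAB; set d := _.-1.
pose r z := if z is Some x then hpt A.[x] B.[x] else hpt A`_d B`_d.
exists r.
have [sA sB] : (size A <= d.+1)%N /\ (size B <= d.+1)%N by rewrite /d; split; lia.
have nr x : (A.[x], B.[x]) != (0, 0).
  rewrite xpair_eqE; apply/negP => /andP[/eqP Ax /eqP Bx].
  have := coprimep_root cAB (introT rootP Ax).
  by rewrite Bx eqxx.
have top : (A`_d, B`_d) != (0, 0).
  rewrite xpair_eqE; apply/negP => /andP[/eqP Ad /eqP Bd].
  have : (0 < maxn (size A) (size B))%N.
    rewrite lt0n; apply/negP; rewrite -leqn0 geq_max !leqn0 !size_poly_eq0.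
    by move=> /andP[/eqP A0 /eqP B0]; move: (nr 0); rewrite A0 B0 horner0 eqxx.
  case: (leqP (size A) (size B)) => h h0.
    have dE : d = (size B).-1 by rewrite /d; congr predn; lia.
    move: Bd; rewrite dE -lead_coefE => /eqP; rewrite lead_coef_eq0 -size_poly_eq0.
    by rewrite gtn_eqF.
  have dE : d = (size A).-1 by rewrite /d; congr predn; lia.
  move: Ad; rewrite dE -lead_coefE => /eqP; rewrite lead_coef_eq0 -size_poly_eq0.
  by rewrite gtn_eqF.
have fE (x y : F) : y != 0 -> (form d A x y, form d B x y) =
    (y ^+ d * A.[x / y], y ^+ d * B.[x / y]).
  by move=> y0; rewrite !form_neq0.
split=> //.
  move=> x y; have [->|y0 _] := eqVneq y 0.
    rewrite !form_y0 !xpair_eqE eqxx andbT => x0.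
    by rewrite !mulf_eq0 expf_eq0 (negPf x0) andbF !orbF -xpair_eqE.
  rewrite fE // xpair_eqE !mulf_eq0 expf_eq0 (negPf y0) andbF /= -xpair_eqE.
  exact: nr.
move=> x y; have [->|y0 _] := eqVneq y 0.
  rewrite !form_y0 xpair_eqE eqxx andbT => x0 /=.
  have -> : hpt x 0 = None by rewrite /hpt eqxx.
  by rewrite /= [A`_d * _]mulrC [B`_d * _]mulrC hpt_scale // expf_neq0.
have -> : hpt x y = Some (x / y) by rewrite /hpt (negPf y0).
by have [-> ->] := fE x y y0; rewrite hpt_scale // expf_neq0.
Qed.

Lemma mk_endo A B : (A, B) != (0, 0) -> exists r, endo r /\
  forall x, (A.[x], B.[x]) != (0, 0) -> r (Some x) = hpt A.[x] B.[x].
Proof.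
move=> nz; pose D := gcdp A B.
have D0 : D != 0 by rewrite gcdp_eq0 -xpair_eqE.
have AE : A = (A %/ D) * D by rewrite divpK // dvdp_gcdl.
have BE : B = (B %/ D) * D by rewrite divpK // dvdp_gcdr.
have cop : coprimep (A %/ D) (B %/ D).
  by apply: coprimep_div_gcd; rewrite -negb_and -xpair_eqE.
have [r rr] := mk_represents cop; exists r; split; first by exists (maxn (size (A %/ D)) (size (B %/ D))).-1, (A %/ D), (B %/ D).
move=> x; rewrite (represents_fin _ rr).
have -> : A.[x] = D.[x] * (A %/ D).[x] by rewrite [in LHS]AE hornerM mulrC.
have -> : B.[x] = D.[x] * (B %/ D).[x] by rewrite [in LHS]BE hornerM mulrC.
have [->|Dx] := eqVneq D.[x] 0; first by rewrite !mul0r eqxx.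
by rewrite hpt_scale.
Qed.

Lemma comb_neq0 d A B r (s t : F) : represents d A B r -> End r ->
  (s, t) != (0, 0) -> s *: A + t *: B != 0.
Proof.
move=> rr Er; have [->|s0 _] := eqVneq s 0.
  rewrite xpair_eqE eqxx scale0r add0r scaler_eq0 negb_or => -> /=.
  by have := fibre_poly_neq0 None rr Er.
have := fibre_poly_neq0 (Some (- (t / s))) rr Er; rewrite /=.
apply: contra => /eqP h; have : s *: (A - - (t / s) *: B) = 0.
  by rewrite scalerBr scaleNr scalerN opprK scalerA mulrC divfK.
by move/eqP; rewrite scaler_eq0 (negPf s0).
Qed.

Lemma finite_preimage r (s : seq P1) : End r ->
  exists t : seq F, forall x, x \notin t -> r (Some x) \notin s.
Proof.
move=> Er; elim: s => [|z s [t tP]]; first by exists [::].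
have [l [_ lP _]] := fibre z Er; exists (pmap id l ++ t) => x.
rewrite mem_cat negb_or inE => /andP[xl xt]; rewrite negb_or tP // andbT.
apply/eqP => h; move: xl; rewrite mem_pmap map_id => /negP[].
exact/lP.
Qed.

Variables h G : P1 -> P1.
Hypothesis Eh : End h.
Hypothesis EG : End G.

Definition equalizes r := r \o h = r \o G.

Definition equalizing_fraction d A B := exists r, represents d A B r /\ equalizes r.

Lemma equal_points d A B r x y y' : represents d A B r -> equalizes r ->
  G (Some x) = Some y -> h (Some x) = Some y' -> A.[y] * B.[y'] = A.[y'] * B.[y].
Proof.
move=> rr eq Gx hx.
have := congr1 (fun k => k (Some x)) eq; rewrite /= Gx hx !(represents_fin _ rr).
have [sA sB nz _] := rr.
have := nz y 1 (pair_x1 y); have := nz y' 1 (pair_x1 y').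
by rewrite !form_y1 // => h1 h2 /(hpt_eq h1 h2) ->.
Qed.

(** By the identity principle generic points suffice, and at these both images
    are finite and avoid any given finite set. *)
Lemma equalizesI r (s : seq F) : endo r ->
  (forall x y y', G (Some x) = Some y -> h (Some x) = Some y' ->
     y \notin s -> y' \notin s -> r (Some y) = r (Some y')) -> equalizes r.
Proof.
move=> er H.
have [t tP] := finite_preimage (None :: map Some s) EG.
have [t' tP'] := finite_preimage (None :: map Some s) Eh.
apply: (@endo_eq _ (t ++ t')).
- by apply: endo_comp => //; case: Eh.
- by apply: endo_comp => //; case: EG.
move=> x; rewrite mem_cat negb_or => /andP[/tP + /tP'] /=.
have sm (a : F) : (Some a \in map Some s) = (a \in s) by rewrite mem_map // => ? ? [].
case Gx : (G (Some x)) => [y|]; rewrite inE //= sm => ys.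
case hx : (h (Some x)) => [y'|]; rewrite inE //= sm => ys'.
by apply/esym/(H x).
Qed.

(** A substitute for the ideal generated by the [biv A B] over the fractions in
    [x]: divisibility is only required of specializations. *)
Definition in_ideal f := forall y w,
  (forall d A B, equalizing_fraction d A B -> w %| bez A B y) -> w %| spec y f.

(** A nonzero element [f0] of the ideal of least degree in [T] divides all [biv A B];
    let [f1] be its primitive part.  If [h] and [G] send a point to [y'] and [y],
    then [bez A B y] and [bez A B y'] are proportional for all equalizing
    [A / B], hence so are the specializations of [f1] at [y] and [y'].  So the
    ratios of the coefficients of [f1] are equalizing functions; a nonconstant
    one is [b = P / Q].  Comparing degrees in [x], [biv P Q] is [f1] up to a
    constant. *)
Lemma lueroth_common_divisor r0 : End r0 -> equalizes r0 ->
  exists b, [/\ End b, equalizes b & forall e P Q d A B y,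
    represents e P Q b -> equalizing_fraction d A B -> bez P Q y %| bez A B y].
Proof.
move=> E0 eq0.
have biv_neq0 d A B r : represents d A B r -> End r -> biv A B != 0.
  move=> rr Er; apply/eqP => N0.
  have := spec_biv A B 0; rewrite N0 /spec map_poly0 /bez -scaleNr => /esym/eqP.
  have [sA sB nz _] := rr; have := nz 0 1 (pair_x1 0).
  rewrite !form_y1 // xpair_eqE => h1; apply/negP; apply: comb_neq0 rr Er _.
  by rewrite xpair_eqE oppr_eq0 andbC.
pose Pn n := `[< exists f, [/\ in_ideal f, f != 0 & size f = n] >].
have exP : exists n, Pn n.
  have [A [B rr]] := degP (proj1 E0).
  exists (size (biv A B)); apply/asboolP; exists (biv A B); split=> //.
    move=> y w hw; rewrite spec_biv; apply: (hw (deg r0)); by exists r0.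
  exact: biv_neq0 rr E0.
have [n /asboolP[f0 [If0 f00 sf0]] minn] := ex_minnP exP.
have If_sub f f' g : in_ideal f -> in_ideal f' -> in_ideal (f - g * f').
  move=> If If' y w hw; rewrite specB specM dvdp_sub //; first exact: If.
  by apply: dvdp_mull; apply: If'.
have IfM f g : in_ideal f -> in_ideal (g * f).
  by move=> If y w hw; rewrite specM; apply: dvdp_mull; apply: If.
have [c0 [f1 [c00 f0E pf1]]] := primitive_part f00.
have div1 d A B : equalizing_fraction d A B -> exists g, biv A B = g * f1.
  move=> iL; pose N := biv A B.
  have E := Pdiv.Idomain.divp_eq N f0.
  set c := lead_coef f0 ^+ _ in E.
  have c_neq0 : c != 0 by rewrite expf_neq0 // lead_coef_eq0.
  have R0 : N %% f0 = 0.
    apply/eqP; apply: contraT => Rn0.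
    have : (n <= size (N %% f0)%R)%N.
      apply: minn; apply/asboolP; exists (N %% f0); split=> //.
      have -> : N %% f0 = c%:P * N - (N %/ f0) * f0.
        by rewrite mul_polyC E; ring.
      apply: If_sub => //; apply: IfM => y w hw.
      by rewrite spec_biv; apply: hw iL.
    by rewrite leqNgt -sf0 ltn_modp f00.
  rewrite R0 addr0 -mul_polyC in E.
  apply: (@gauss _ c _ (N %/ f0 * c0%:P)) => //.
  by rewrite E f0E; ring.
have dvd1 d A B y : equalizing_fraction d A B -> spec y f1 %| bez A B y.
  by move=> /div1[g gE]; rewrite -spec_biv gE specM dvdp_mull.
have f10 : f1 != 0 by apply: contraNneq f00 => z; rewrite f0E z mulr0.
pose D1 := lead_coef f1; have D10 : D1 != 0 by rewrite lead_coef_eq0.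
have c0D1 : c0 * D1 != 0 by rewrite mulf_neq0.
have [bad badP] := rootsP c0D1.
have badE y : y \notin bad -> c0.[y] != 0 /\ D1.[y] != 0.
  by rewrite -badP hornerM mulf_eq0 negb_or => /andP[].
(* equivalent points have proportional specializations *)
have prop x y y' i : G (Some x) = Some y -> h (Some x) = Some y' ->
    y \notin bad -> y' \notin bad -> (f1`_i).[y'] * D1.[y] = (f1`_i).[y] * D1.[y'].
  move=> Gx hx yb yb'; have [cy Dy] := badE y yb; have [cy' Dy'] := badE y' yb'.
  have : spec y' f1 %| spec y f0.
    apply: If0 => d A B iL; have [r [rr eqr]] := iL.
    have e := equal_points rr eqr Gx hx.
    have dv := dvd1 d A B y' iL.
    have [k kE] : exists k, bez A B y = k *: bez A B y'.
      have [sA sB nz _] := rr; have := nz y' 1 (pair_x1 y'); rewrite !form_y1 //.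
      have [By|By] := eqVneq B.[y'] 0.
        rewrite xpair_eqE By eqxx andbT => Ay.
        exists (A.[y] / A.[y']); rewrite /bez By scale0r sub0r.
        have -> : B.[y] = 0.
          by apply/eqP; move/eqP: e; rewrite By mulr0 eq_sym mulf_eq0 (negPf Ay).
        by rewrite scale0r sub0r scalerN scalerA divfK.
      exists (B.[y] / B.[y']); rewrite /bez scalerBr !scalerA divfK //.
      congr (_ - _ *: _); rewrite mulrAC [B.[y] * _]mulrC -e; by field.
    by rewrite kE; apply: dvdp_scale dv.
  rewrite f0E specM specC mul_polyC dvdpZr // => dv.
  have sE (z : F) : z \notin bad -> size (spec z f1) = size f1.
    move=> /badE[_ Dz]; rewrite /spec size_map_poly_id0 //.
  have eqs : spec y' f1 %= spec y f1.
    by rewrite -dvdp_size_eqp // !sE.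
  have lE (z : F) : D1.[z] != 0 -> lead_coef (spec z f1) = D1.[z].
    by move=> Dz; rewrite /spec lead_coef_map_id0 // horner_evalE horner0.
  have := eqp_eq eqs; rewrite !lE // => /(congr1 (fun q : {poly F} => q`_i)).
  by rewrite !coefZ !spec_coef mulrC => ->; rewrite mulrC.
have [i [y1 [y2 ne]]] : exists i (y1 y2 : F),
    (f1`_i).[y1] * D1.[y2] - (f1`_i).[y2] * D1.[y1] != 0.
  apply: contrapT => nex.
  have al i y1 y2 : (f1`_i).[y1] * D1.[y2] = (f1`_i).[y2] * D1.[y1].
    apply/eqP; rewrite -subr_eq0; apply: contraT => h'; case: nex.
    by exists i, y1, y2.
  have [y0] := cofinite_exists bad; move=> /badE[cy0 Dy0].
  have m0 : spec y0 f1 = 0.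
    apply: (@poly_eq0_cofinite _ _ bad) => y yb; have [cy Dy] := badE y yb.
    have eqs : D1.[y0] *: spec y f1 = D1.[y] *: spec y0 f1.
      apply/polyP => i; rewrite !coefZ !spec_coef mulrC al mulrC //.
    have : ('X - y%:P) %| spec y f0.
      apply: If0 => d A B _; rewrite dvdp_XsubCl; apply/rootP.
      by rewrite horner_bez; ring.
    rewrite f0E specM specC mul_polyC dvdpZr // dvdp_XsubCl => /rootP h'.
    have := congr1 (fun q : {poly F} => q.[y]) eqs; rewrite !hornerZ h' mulr0.
    by move/esym/eqP; rewrite mulf_eq0 (negPf Dy) => /eqP.
  by have := pf1 y0; rewrite m0 eqxx.
pose E := gcdp f1`_i D1.
have En0 : E != 0 by rewrite gcdp_eq0 negb_and D10 orbT.
have PE : f1`_i = (f1`_i %/ E) * E by rewrite divpK // dvdp_gcdl.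
have QE : D1 = (D1 %/ E) * E by rewrite divpK // dvdp_gcdr.
have cPQ : coprimep (f1`_i %/ E) (D1 %/ E).
  by apply: coprimep_div_gcd; rewrite D10 orbT.
set P := f1`_i %/ E in PE cPQ; set Q := D1 %/ E in QE cPQ.
have [b rb] := mk_represents cPQ; set mu := _.-1 in rb.
have eb : endo b by exists mu, P, Q.
have Q0 : Q != 0 by apply: contraNneq D10 => z; rewrite QE z mul0r.
have QnE (z : F) : D1.[z] != 0 -> E.[z] != 0 /\ Q.[z] != 0.
  by rewrite {1}QE hornerM mulf_eq0 negb_or andbC => /andP[].
have eqb : equalizes b.
  apply: (equalizesI (s := bad) eb) => x y y' Gx hx yb yb'.
  have [cy Dy] := badE y yb; have [cy' Dy'] := badE y' yb'.
  have [Ey Qy] := QnE y Dy; have [Ey' Qy'] := QnE y' Dy'.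
  rewrite !(represents_finE rb) //; congr Some; apply/eqP; rewrite eqr_div //.
  have := prop x y y' i Gx hx yb yb'; rewrite PE QE !hornerM => e.
  have EE : E.[y] * E.[y'] != 0 by rewrite mulf_neq0.
  apply/eqP; apply: (mulIf EE).
  have -> : P.[y] * Q.[y'] * (E.[y] * E.[y']) = P.[y] * E.[y] * (Q.[y'] * E.[y']) by ring.
  by rewrite -e; ring.
have Eb : End b.
  split=> //; case=> z bz; move/negP: ne; apply; rewrite subr_eq0.
  have [sP sQ nz _] := rb.
  have := nz y1 1 (pair_x1 y1); have := nz y2 1 (pair_x1 y2).
  rewrite !form_y1 // => h2 h1.
  have : b (Some y1) = b (Some y2) by rewrite !bz.
  rewrite !(represents_fin _ rb) => /(hpt_eq h1 h2) e.
  rewrite PE QE !hornerM; apply/eqP.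
  have -> : P.[y1] * E.[y1] * (Q.[y2] * E.[y2]) = P.[y1] * Q.[y2] * E.[y1] * E.[y2] by ring.
  by rewrite e; ring.
exists b; split=> // e P' Q' d A B y rb' iL.
have [q' q'E] := div1 mu P Q (ex_intro _ b (conj rb eqb)).
(* [f1] has at least the degree in [x] of [biv P Q], so the quotient is free of [x] *)
have [m mE] : exists m, q' = map_poly polyC m.
  have q'0 : q' != 0.
    apply/eqP => z; have := biv_neq0 _ _ _ _ rb Eb.
    by rewrite q'E z mul0r eqxx.
  have sq' : (size (swapXY q') <= 1)%N.
    have := size_swap_biv P Q; rewrite q'E rmorphM /=.
    rewrite size_mul ?swapXY_eq0 //.
    have s1 : (size P <= size (swapXY f1))%N.
      rewrite -sizeYE; apply: leq_trans (max_size_coefXY f1 i).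
      have [->|P0] := eqVneq P 0; first by rewrite size_poly0.
      by rewrite PE dvdp_leq ?mulf_neq0 // dvdp_mulr.
    have s2 : (size Q <= size (swapXY f1))%N.
      rewrite -sizeYE; apply: leq_trans (max_size_lead_coefXY f1).
      by rewrite -/D1 QE dvdp_leq ?mulf_neq0 // dvdp_mulr.
    have s3 : (0 < size (swapXY f1))%N by rewrite lt0n size_poly_eq0 swapXY_eq0.
    have s4 : (maxn (size P) (size Q) <= size (swapXY f1))%N by rewrite geq_max s1.
    exact: (size_factor_le1 s3 s4).
  exists (swapXY q')`_0; rewrite -swapXY_polyC -(size1_polyC sq') swapXYK //.
have specN (z : F) : bez P Q z = m * spec z f1.
  by rewrite -spec_biv q'E specM mE spec_cst.
(* [m] divides two independent combinations of [P] and [Q], which are coprime *)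
have m1 : size m == 1%N.
  have [x1 [x2 nx]] : exists x1 x2 : F, Q.[x1] * P.[x2] - P.[x1] * Q.[x2] != 0.
    exists y2, y1; apply: contraNneq ne => h'; rewrite PE QE !hornerM.
    have -> : P.[y1] * E.[y1] * (Q.[y2] * E.[y2]) - P.[y2] * E.[y2] * (Q.[y1] * E.[y1])
       = E.[y1] * E.[y2] * (Q.[y2] * P.[y1] - P.[y2] * Q.[y1]) by ring.
    by rewrite h' mulr0.
  have d1 : m %| bez P Q x1 by rewrite specN dvdp_mulr.
  have d2 : m %| bez P Q x2 by rewrite specN dvdp_mulr.
  have dP : m %| P.
    rewrite -(dvdpZr _ _ nx).
    have -> : (Q.[x1] * P.[x2] - P.[x1] * Q.[x2]) *: P =
      P.[x2] *: bez P Q x1 - P.[x1] *: bez P Q x2.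
      rewrite /bez !scalerBr !scalerA scalerBl [P.[x1] * P.[x2]]mulrC.
      by rewrite [P.[x2] * Q.[x1]]mulrC -!mul_polyC; ring.
    by apply: dvdp_sub; apply: dvdp_scale.
  have dQ : m %| Q.
    rewrite -(dvdpZr _ _ nx).
    have -> : (Q.[x1] * P.[x2] - P.[x1] * Q.[x2]) *: Q =
      Q.[x2] *: bez P Q x1 - Q.[x1] *: bez P Q x2.
      rewrite /bez !scalerBr !scalerA scalerBl [Q.[x1] * Q.[x2]]mulrC.
      by rewrite [Q.[x2] * P.[x1]]mulrC -!mul_polyC; ring.
    by apply: dvdp_sub; apply: dvdp_scale.
  have : m %| gcdp P Q by rewrite dvdp_gcd dP.
  by rewrite -dvdp1 => /dvdp_trans; apply; rewrite dvdp1.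
have eqp1 (z : F) : bez P Q z %= spec z f1.
  rewrite specN; move: m1 => /size_poly1P[a a0 ->].
  by rewrite mul_polyC eqp_scale.
have prQ : P' * Q = P * Q'.
  exact: (represents_cross_conv (s := [::]) rb' rb).
have cPQ' := represents_coprime rb'.
have [k k0 [P'E Q'E]] : exists2 k : F, k != 0 & P' = k *: P /\ Q' = k *: Q.
  have : Q %= Q'.
    apply/andP; split.
      by rewrite coprimep_sym in cPQ; rewrite -(Gauss_dvdpr _ cPQ) -prQ dvdp_mull.
    by rewrite coprimep_sym in cPQ'; rewrite -(Gauss_dvdpr _ cPQ') prQ dvdp_mull.
  case/eqpP => -[k1 k2] /= /andP[k10 k20] kE.
  have QE' : Q' = (k1 / k2) *: Q by rewrite mulrC -scalerA kE scalerA mulVf // scale1r.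
  exists (k1 / k2); first by rewrite mulf_neq0 // invr_eq0.
  by split=> //; apply: (mulIf Q0); rewrite prQ QE' -!mul_polyC; ring.
have -> : bez P' Q' y = (k * k) *: bez P Q y.
  by rewrite P'E Q'E /bez !hornerZ -!mul_polyC !polyCM; ring.
rewrite dvdpZl ?mulf_neq0 // (eqp_dvdl _ (eqp1 y)); exact: dvd1 iL.
Qed.

End Lueroth.

Section LuerothFactor.
Local Open Scope ring_scope.
Variable F : numClosedFieldType.
Local Notation P1 := (P1 F).
Implicit Types (A B P Q U V w : {poly F}) (r u v b : P1 -> P1) (z : P1).

Fact size_cofactor_le (a a' m e n : nat) : (m <= n.+1 -> a + e = m.+1 ->
  a' + e = m.+1 -> 0 < e -> (maxn a a').-1 <= n)%N.
Proof. lia. Qed.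

Lemma hpt_cross (x y x' y' : F) : (x, y) != (0, 0) -> (x', y') != (0, 0) ->
  x * y' = x' * y -> hpt x y = hpt x' y'.
Proof. by move=> h h' e; apply/hpt_eq. Qed.

Lemma represents_nz d A B r x : represents d A B r -> (A.[x], B.[x]) != (0, 0).
Proof. by move=> [sA sB nz _]; have := nz x 1 (pair_x1 x); rewrite !form_y1. Qed.

Variables h G : P1 -> P1.
Hypothesis Eh : End h.
Hypothesis EG : End G.

Lemma size_bez d A B r x : represents d A B r -> End r ->
  r (Some x) <> r None -> size (bez A B x) = d.+1.
Proof.
move=> rr Er ne; have [sA sB _ _] := rr.
apply/eqP; rewrite eqn_leq; apply/andP; split.
  rewrite /bez (leq_trans (size_polyD _ _)) // size_polyN geq_max.
  by rewrite !(leq_trans (size_scale_leq _ _)).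
rewrite ltnNge; apply/negP => /leq_sizeP/(_ d (leqnn d)).
rewrite /bez coefB !coefZ => /eqP; rewrite subr_eq0 => /eqP e; apply: ne.
rewrite (represents_fin _ rr) (represents_inf rr).
apply: hpt_cross; [exact: represents_nz rr|exact: represents_top rr|].
by rewrite -e mulrC.
Qed.

(** Induction on the degree of [r = A / B].  For two base points [x0] and [x1], the
    quotients of [bez A B x0] and [bez A B x1] by the corresponding polynomials of
    [b] are coprime and form an equalizing function [r'] of smaller degree, which
    is [u' \o b] by induction.  As [(r - r x0) / (r - r x1)] is up to a constant
    the product of [r'] and [(b - b x0) / (b - b x1)], it is a function of [b],
    and so is [r]. *)
Theorem lueroth r0 : End r0 -> equalizes h G r0 ->
  exists b, [/\ End b, equalizes h G b & forall r, endo r -> equalizes h G r ->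
    exists u, endo u /\ r = u \o b].
Proof.
move=> E0 eq0; have [b [Eb eqb dvb]] := lueroth_common_divisor Eh EG E0 eq0.
exists b; split=> // r; have [P [Q rb]] := degP (proj1 Eb).
move: {2}(deg r) (leqnn (deg r)) => n.
elim: n r => [|n IH] r.
  rewrite leqn0 => /eqP d0 er _; exists r; split=> //.
  have [c cE] : exists c, forall z, r z = c.
    apply: contrapT => nc; have := proj1 (End_deg er) (conj er nc).
    by rewrite d0.
  by apply/funext => z; rewrite /= !cE.
move=> ln er eqr; have [nEr|Er] := pselect (exists c, forall z, r z = c).
  by have [c cE] := nEr; exists r; split=> //; apply/funext => z; rewrite /= !cE.
have {}Er : End r by [].
have [A [B rr]] := degP er.
have iL : equalizing_fraction h G (deg r) A B by exists r.
have dv y : bez P Q y %| bez A B y by apply: dvb rb iL.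
(* generic base points *)
have [l [_ lP _]] := fibre (r None) Er; have [l' [_ lP' _]] := fibre (b None) Eb.
have gen (m : seq P1) : exists x : F, Some x \notin m.
  have [x xm] := cofinite_exists (pmap id m); exists x.
  by apply: contra xm; rewrite mem_pmap map_id.
have [x0] := gen (l ++ l'); rewrite mem_cat negb_or => /andP[x0l x0l'].
have [l0 [_ lP0 _]] := fibre (r (Some x0)) Er.
have [x1] := gen (l ++ l' ++ l0); rewrite !mem_cat !negb_or => /and3P[x1l x1l' x10].
have notin (s : seq P1) (z w : P1) (g : P1 -> P1) :
  (forall z, z \in s <-> g z = w) -> z \notin s -> g z <> w.
  by move=> sP /negP zs /sP.
have r0N := notin _ _ _ _ lP x0l; have r1N := notin _ _ _ _ lP x1l.
have b0N := notin _ _ _ _ lP' x0l'; have b1N := notin _ _ _ _ lP' x1l'.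
have r10 := notin _ _ _ _ lP0 x10.
have nz0 := represents_nz x0 rr; have nz1 := represents_nz x1 rr.
have /dvdpP[q0 q0E] := dv x0; have /dvdpP[q1 q1E] := dv x1.
have sA0 := size_bez rr Er r0N; have sA1 := size_bez rr Er r1N.
have sP0 := size_bez rb Eb b0N; have sP1 := size_bez rb Eb b1N.
pose Dt := B.[x0] * A.[x1] - A.[x0] * B.[x1].
have Dt0 : Dt != 0.
  apply/eqP => /eqP; rewrite subr_eq0 => /eqP e; apply: r10.
  rewrite !(represents_fin _ rr); apply: hpt_cross => //.
  by rewrite mulrC e mulrC mulrC.
have combA t : Dt * A.[t] = A.[x1] * (bez A B x0).[t] - A.[x0] * (bez A B x1).[t].
  by rewrite !horner_bez /Dt; ring.
have combB t : Dt * B.[t] = B.[x1] * (bez A B x0).[t] - B.[x0] * (bez A B x1).[t].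
  by rewrite !horner_bez /Dt; ring.
have b00 : bez P Q x0 != 0 by rewrite -size_poly_eq0 sP0.
have b10 : bez P Q x1 != 0 by rewrite -size_poly_eq0 sP1.
have q00 : q0 != 0 by apply/eqP => z; move: sA0; rewrite q0E z mul0r size_poly0.
have q10 : q1 != 0 by apply/eqP => z; move: sA1; rewrite q1E z mul0r size_poly0.
have db := deg_gt0 Eb.
have sq0 : (size q0 + deg b = (deg r).+1)%N.
  by move: sA0; rewrite q0E size_mul // sP0 addnS.
have sq1 : (size q1 + deg b = (deg r).+1)%N.
  by move: sA1; rewrite q1E size_mul // sP1 addnS.
have cq : coprimep q0 q1.
  apply: contraT => /closed_rootP[t]; rewrite root_gcd => /andP[/rootP t0 /rootP t1].
  have nzt := represents_nz t rr; move: nzt; rewrite xpair_eqE.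
  have h0 : (bez A B x0).[t] = 0 by rewrite q0E hornerM t0 mul0r.
  have h1 : (bez A B x1).[t] = 0 by rewrite q1E hornerM t1 mul0r.
  have := combA t; have := combB t; rewrite h0 h1 !mulr0 subrr => /eqP + /eqP.
  by rewrite !mulf_eq0 (negPf Dt0) /= => -> ->.
have [r' rr'] := mk_represents cq; set d' := _.-1 in rr'.
have er' : endo r' by exists d', q0, q1.
have [bad badP] := rootsP (mulf_neq0 b00 b10).
have badE y : y \notin bad -> (bez P Q x0).[y] != 0 /\ (bez P Q x1).[y] != 0.
  by rewrite -badP hornerM mulf_eq0 negb_or => /andP[].
have eqr' : equalizes h G r'.
  apply: (equalizesI Eh EG (s := bad) er') => x y y' Gx hx yb yb'.
  have [p0 p1] := badE y yb; have [p0' p1'] := badE y' yb'.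
  have eA := equal_points rr eqr Gx hx; have eP := equal_points rb eqb Gx hx.
  have crA : (bez A B x0).[y] * (bez A B x1).[y'] = (bez A B x0).[y'] * (bez A B x1).[y].
    apply/eqP; rewrite -subr_eq0; apply/eqP; rewrite !horner_bez.
    transitivity ((B.[x0] * A.[x1] - A.[x0] * B.[x1]) * (A.[y'] * B.[y] - A.[y] * B.[y'])).
      by ring.
    by rewrite eA subrr mulr0.
  have crP : (bez P Q x0).[y] * (bez P Q x1).[y'] = (bez P Q x0).[y'] * (bez P Q x1).[y].
    apply/eqP; rewrite -subr_eq0; apply/eqP; rewrite !horner_bez.
    transitivity ((Q.[x0] * P.[x1] - P.[x0] * Q.[x1]) * (P.[y'] * Q.[y] - P.[y] * Q.[y'])).
      by ring.
    by rewrite eP subrr mulr0.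
  rewrite !(represents_fin _ rr'); apply: hpt_cross; try exact: represents_nz rr'.
  have pp : (bez P Q x0).[y] * (bez P Q x1).[y'] != 0 by rewrite mulf_neq0.
  apply: (mulfI pp); move: crA; rewrite q0E q1E !hornerM => crA.
  transitivity (q0.[y] * (bez P Q x0).[y] * (q1.[y'] * (bez P Q x1).[y'])); first by ring.
  by rewrite crA crP; ring.
have dr' : (deg r' <= n)%N.
  by rewrite (deg_eq rr'); apply: size_cofactor_le ln sq0 sq1 db.
have [u' [eu' r'E]] := IH r' dr' er' eqr'.
have [U [V ru']] := degP eu'.
pose L0 : {poly F} := Q.[x0] *: 'X - (P.[x0])%:P.
pose L1 : {poly F} := Q.[x1] *: 'X - (P.[x1])%:P.
pose N1 := A.[x1] *: (L0 * U) - A.[x0] *: (L1 * V).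
pose N2 := B.[x1] *: (L0 * U) - B.[x0] *: (L1 * V).
have LE (x : F) s : (Q.[x] *: 'X - (P.[x])%:P).[s] = Q.[x] * s - P.[x].
  by rewrite hornerD hornerN hornerZ hornerX hornerC.
have Q0 : Q != 0 by have := fibre_poly_neq0 None rb Eb.
have [bad2 badP2] := rootsP Q0.
(* at a generic point, the numerators of [r] are those of [u] at [b t] *)
have main t : t \notin bad2 -> exists k, [/\ k != 0, b (Some t) = Some (P.[t] / Q.[t]),
    A.[t] = k * N1.[P.[t] / Q.[t]] & B.[t] = k * N2.[P.[t] / Q.[t]]].
  rewrite -badP2 => Qt; set s := P.[t] / Q.[t].
  have bt : b (Some t) = Some s by apply: represents_finE rb Qt.
  have := congr1 (fun g => g (Some t)) r'E; rewrite /= bt.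
  rewrite (represents_fin _ rr') (represents_fin _ ru').
  move/(hpt_eq (represents_nz t rr') (represents_nz s ru')) => e.
  have [k [k0 [kU kV]]] : exists k, k != 0 /\ (q0.[t] = k * U.[s] /\ q1.[t] = k * V.[s]).
    have := represents_nz s ru'; have := represents_nz t rr'; rewrite !xpair_eqE.
    have [Vs|Vs] := eqVneq V.[s] 0.
      rewrite andbT => nq Us; move: e; rewrite Vs mulr0 => /esym/eqP.
      rewrite mulf_eq0 (negPf Us) /= => /eqP qt1; rewrite qt1 eqxx andbT in nq *.
      exists (q0.[t] / U.[s]); rewrite mulf_neq0 ?invr_eq0 // mulr0 divfK //.
    move=> nq _; exists (q1.[t] / V.[s]).
    have q1t : q1.[t] != 0.
      apply: contra nq => /eqP qt1; move: e; rewrite qt1 mulr0 => /eqP.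
      by rewrite mulf_eq0 (negPf Vs) orbF => ->; rewrite eqxx.
    rewrite mulf_neq0 ?invr_eq0 // divfK //; split=> //; split=> //.
    by rewrite mulrAC [q1.[t] * _]mulrC -e mulfK.
  have bE x : (bez P Q x).[t] = Q.[t] * (Q.[x] * s - P.[x]).
    by rewrite horner_bez /s; field.
  exists (Q.[t] * k / Dt); split=> //.
  - by rewrite !mulf_neq0 ?invr_eq0.
  - apply: (mulfI Dt0); rewrite combA q0E q1E !hornerM !bE kU kV.
    by rewrite /N1 hornerD hornerN !hornerZ !hornerM !LE; field.
  - apply: (mulfI Dt0); rewrite combB q0E q1E !hornerM !bE kU kV.
    by rewrite /N2 hornerD hornerN !hornerZ !hornerM !LE; field.
have NN : (N1, N2) != (0, 0).
  have [t tb] := cofinite_exists bad2; have [k [k0 _ At Bt]] := main t tb.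
  apply/eqP => -[z1 z2]; have := represents_nz t rr.
  by rewrite At Bt z1 z2 !horner0 !mulr0 eqxx.
have [u [eu uE]] := mk_endo NN; exists u; split=> //.
apply: (@endo_eq _ bad2) => //; first by apply: endo_comp => //; case: Eb.
move=> t tb; have [k [k0 bt At Bt]] := main t tb.
have nzt := represents_nz t rr.
rewrite /= bt (represents_fin _ rr) uE; first by rewrite At Bt hpt_scale.
by move: nzt; rewrite At Bt !xpair_eqE !mulf_eq0 (negPf k0).
Qed.

End LuerothFactor.

(** * Rotations of a superattracting germ *)

Section Rotations.
Local Open Scope ring_scope.
Variable F : numClosedFieldType.
Local Notation P1 := (P1 F).
Implicit Types (f g u b : P1 -> P1) (x y z w v : P1).

Lemma preimage_seq u (s : seq P1) : End u -> exists t : seq P1, forall z, u z \in s -> z \in t.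
Proof.
move=> Eu; elim: s => [|v s [t tP]]; first by exists [::].
have [l [_ lP _]] := fibre v Eu; exists (l ++ t) => z.
rewrite inE mem_cat => /orP[/eqP h|/tP->]; last by rewrite orbT.
by apply/orP; left; apply/lP.
Qed.

Lemma mult_iter_fixed f a j : End f -> f a = a -> mult (iter j f) a = (mult f a ^ j)%N.
Proof.
by move=> Ef fa; elim: j => [|j IH]; rewrite ?mult_id // mult_iterS // fa IH expnSr.
Qed.

Lemma iter_fixed f a j : f a = a -> iter j f a = a.
Proof. by move=> fa; elim: j => // j /= ->. Qed.

(** Before falling on a fixed point an orbit meets each critical point at most once. *)
Lemma mult_iter_landing f (Cr : seq P1) J y q : End f -> uniq Cr ->
  (forall z, (z \in Cr) = (1 < mult f z)%N) -> f q = q -> iter J f y = q ->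
  (mult (iter J f) y %| mult f q ^ J * \prod_(z <- Cr) mult f z)%N.
Proof.
move=> Ef uC CP fq yJ; have ex : exists j, iter j f y == q by exists J; apply/eqP.
have [j /eqP yj minj] := ex_minnP ex.
have jJ : (j <= J)%N by apply: minj; apply/eqP.
rewrite -(subnK jJ) mult_iterD // yj mult_iter_fixed //.
rewrite expnD -mulnA dvdn_mul //; apply: dvdn_mull.
rewrite mult_iter_prod //; apply: prod_mult_dvd => //.
apply/(uniqP y) => a c; rewrite !inE size_traject => aj cj.
rewrite !nth_traject // => e.
have key a' c' : (a' < c')%N -> (c' < j)%N -> iter a' f y = iter c' f y -> False.
  move=> ac cj' e'; have : (j <= (j - c') + a')%N.
    by apply: minj; rewrite iterD e' -iterD subnK ?yj // ltnW.
  by lia.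
by case: (ltngtP a c) => // h; [case: (key a c)|case: (key c a)].
Qed.

(** The fibres of the three values would each contribute at least
    [2/3 * deg b] to the Riemann-Hurwitz formula, which allows less than
    [2 * deg b]. *)
Lemma three_ramified b v1 v2 v3 : End b -> v1 != v2 -> v1 != v3 -> v2 != v3 ->
  (forall x, b x = v1 \/ b x = v2 \/ b x = v3 -> (3 <= mult b x)%N) -> False.
Proof.
move=> Eb n12 n13 n23 h3.
have [s1 [u1 P1' S1]] := fibre v1 Eb; have [s2 [u2 P2' S2]] := fibre v2 Eb.
have [s3 [u3 P3' S3]] := fibre v3 Eb.
have us : uniq (s1 ++ s2 ++ s3).
  rewrite !cat_uniq u1 u2 u3 /= andbT; apply/andP; split.
    apply/hasPn => z; rewrite mem_cat => zs; apply/negP => /P1' z1.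
    by case/orP: zs => [/P2'|/P3'] z2; [case/eqP: n12|case/eqP: n13]; rewrite -z1 -z2.
  apply/hasPn => z /P3' z3; apply/negP => /P2' z2.
  by case/eqP: n23; rewrite -z2 -z3.
have := ramification_le Eb us; rewrite !big_cat /=.
have key (s : seq P1) v : (forall z, z \in s <-> b z = v) ->
    (v = v1 \/ v = v2 \/ v = v3) -> (\sum_(z <- s) mult b z = deg b)%N ->
    (2 * deg b <= 3 * \sum_(z <- s) (mult b z).-1)%N.
  move=> sP hv <-; rewrite !big_distrr /=.
  rewrite big_seq [X in (_ <= X)%N]big_seq; apply: leq_sum => z /sP bz.
  have : (3 <= mult b z)%N.
    by apply: h3; rewrite bz; case: hv => [->|[->|->]]; [left|right; left|right; right].
  by case: (mult b z) => [|[|[|m]]] // _; lia.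
have k1 := key s1 v1 P1' (or_introl erefl) S1.
have k2 := key s2 v2 P2' (or_intror (or_introl erefl)) S2.
have k3 := key s3 v3 P3' (or_intror (or_intror erefl)) S3.
have d0 := deg_gt0 Eb; move: k1 k2 k3 d0; clear.
move: (\sum_(_ <- s1) _)%N (\sum_(_ <- s2) _)%N (\sum_(_ <- s3) _)%N (deg b).
by move=> a c e d; lia.
Qed.

(** As [b \o iter 2 f = iter 2 Phi \o b], the high ramification of [b] over [v0]
    persists, up to the factor [deg f ^ 2], over every [v] with
    [Phi (Phi v) = v0].  If [Phi v] were not [v0], then [v0], [Phi v] and [v] would
    contradict [three_ramified].  So all iterated preimages of [v0] under [Phi] are
    preimages of [v0]. *)
Lemma finite_backward_orbit b Phi f v0 R : End b -> End Phi -> End f ->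
  b \o f = Phi \o b -> Phi v0 = v0 ->
  (forall x, b x = v0 -> (R <= mult b x)%N) -> (3 * deg f ^ 2 <= R)%N ->
  exists L : seq P1, forall j z, b (iter j f z) = v0 -> z \in L.
Proof.
move=> Eb EP Ef E fix0 hR big.
have dP : deg Phi = deg f.
  have := congr1 (@deg _) E.
  rewrite (deg_comp (proj1 Eb) (proj1 Ef)) (deg_comp (proj1 EP) (proj1 Eb)) mulnC => /eqP.
  by rewrite eqn_mul2r gtn_eqF ?deg_gt0 //= => /eqP.
have Ej j z : b (iter j f z) = iter j Phi (b z).
  elim: j => //= j IH; have /= -> := congr1 (fun k => k (iter j f z)) E.
  by rewrite IH.
have ram v x : Phi (Phi v) = v0 -> b x = v -> (3 <= mult b x)%N.
  move=> v2 bx.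
  have h : b \o iter 2 f = iter 2 Phi \o b by apply/funext => z; apply: Ej 2 z.
  have := congr1 (fun u => mult u x) h.
  rewrite (mult_comp x Eb (End_iter 2 Ef)) (mult_comp x (End_iter 2 EP) Eb) => e.
  have h1 : (R <= mult b (iter 2 f x) * mult (iter 2 f) x)%N.
    rewrite -[R]muln1 leq_mul //; last by apply: mult_gt0; apply: End_iter.
    by apply: hR; rewrite Ej bx.
  have h2 : (mult (iter 2 Phi) (b x) <= deg f ^ 2)%N.
    by rewrite -dP -deg_iter //; apply: mult_le_deg; apply: End_iter.
  have d0 : (0 < deg f ^ 2)%N by rewrite expn_gt0 deg_gt0.
  rewrite -(leq_pmul2l d0) mulnC; apply: leq_trans big _.
  apply: leq_trans h1 _; rewrite e leq_mul2r h2 orbT //.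
have inv v : Phi (Phi v) = v0 -> Phi v = v0.
  move=> v2; apply: contrapT => ne.
  apply: (@three_ramified b v0 (Phi v) v Eb).
  - by apply/eqP => h; apply: ne; rewrite -h.
  - by apply/eqP => h; apply: ne; rewrite -h fix0.
  - by apply/eqP => h; apply: ne; rewrite -[in RHS]v2 h h.
  by move=> x [bx|[bx|bx]]; apply: (ram _ _ _ bx); rewrite ?fix0 ?v2 ?fix0.
have inv' j v : iter j Phi v = v0 -> Phi v = v0.
  elim: j v => [|j IH] v /=; first by move=> ->.
  by rewrite -iterS iterSr => /IH/inv.
have [l [_ lP _]] := fibre v0 EP; have [t tP] := preimage_seq l Eb.
by exists t => j z; rewrite Ej => /inv' h; apply/tP/lP.
Qed.

Definition scaling (c : F) z : P1 := if z is Some x then Some (c * x) else None.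
Definition power (n : nat) z : P1 := if z is Some x then Some (x ^+ n) else None.

Lemma represents_scaling c : c != 0 -> represents 1 (c *: 'X) 1 (scaling c).
Proof.
move=> c0; have fE (x y : F) : form 1 (c *: 'X) x y = c * x.
  by rewrite form1 !coefZ !coefX /=; ring.
have gE (x y : F) : form 1 1 x y = y by rewrite form1 !coef1 /=; ring.
split; rewrite ?size_scale ?size_polyX ?size_poly1 //.
  by move=> x y; rewrite fE gE !xpair_eqE mulf_eq0 (negPf c0).
by move=> x y _; rewrite fE gE /hpt; case: eqP => //= _; rewrite mulrA.
Qed.

Lemma represents_power n : (0 < n)%N -> represents n 'X^n 1 (power n).
Proof.
move=> n0; have fE (x y : F) : form n 'X^n x y = x ^+ n.
  have [->|y0] := eqVneq y 0; first by rewrite form_y0 coefXn eqxx mul1r.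
  rewrite form_neq0 ?size_polyXn // hornerXn expr_div_n mulrC divfK //.
  by rewrite expf_neq0.
have gE (x y : F) : form n 1 x y = y ^+ n.
  have [->|y0] := eqVneq y 0.
    by rewrite form_y0 coef1 gtn_eqF // mul0r expr0n gtn_eqF.
  by rewrite form_neq0 ?size_poly1 // hornerC mulr1.
split; rewrite ?size_polyXn ?size_poly1 //.
  by move=> x y; rewrite fE gE !xpair_eqE !expf_eq0 n0.
move=> x y _; rewrite fE gE /hpt expf_eq0 n0 /=; case: eqP => //= _.
by rewrite expr_div_n.
Qed.

Lemma End_scaling c : c != 0 -> End (scaling c).
Proof.
move=> c0; have r := represents_scaling c0; apply/End_deg; first by exists 1%N, (c *: 'X), 1.
by rewrite (deg_eq r).
Qed.

Lemma End_power n : (0 < n)%N -> End (power n).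
Proof.
move=> n0; have r := represents_power n0; apply/End_deg; first by exists n, 'X^n, 1.
by rewrite (deg_eq r).
Qed.

Lemma mult_lead_scaling c : c != 0 ->
  mult (scaling c) (Some 0) = 1%N /\ lead (scaling c) (Some 0) = c.
Proof.
move=> c0; apply: ldegE; first exact: End_scaling.
split=> //; exists 2%N, (c *: 'X); split=> //; last first.
  by exists c%:P; rewrite hornerC -mul_polyC mulrC.
have gi : germ (loc (scaling c) (Some 0)) (c *: 'X) 1.
  split; rewrite ?hornerC ?hornerZ ?hornerX ?oner_eq0 ?mulr0 // => x _.
  by rewrite hornerC hornerZ hornerX divr1 /loc /= mulr0 oppr0 !addr0.
by exists (c *: 'X), 1; split=> //; rewrite mulr1 subrr dvdp0.
Qed.

Lemma mult_power n : (0 < n)%N -> mult (power n) (Some 0) = n.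
Proof.
move=> n0; rewrite (mult_fin _ (represents_power n0) (End_power n0)).
rewrite /= expr0n gtn_eqF // scale0r subr0.
by apply: (@mup_eq _ _ _ _ 1); rewrite ?hornerC ?oner_eq0 // mulr1 subr0.
Qed.

Section Resolvent.
Variables (h G : P1 -> P1) (p : P1) (R : nat) (eta : F).
Hypotheses (Eh : End h) (EG : End G) (hp : h p = p) (Gp : G p = p).
Hypothesis hG : h \o G = G \o h.
Hypothesis R0 : (0 < R)%N.
Hypothesis hR : iter R h = iter R G.
Hypothesis etaR : eta ^+ R = 1.
Hypothesis mhG : mult h p = mult G p.
Hypothesis etaM : eta ^+ mult G p = eta.
Hypothesis lhG : lead h p = eta * lead G p.

Lemma hG_iter j i z : iter j h (iter i G z) = iter i G (iter j h z).
Proof.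
have c1 i' w : h (iter i' G w) = iter i' G (h w).
  elim: i' w => // i' IH w /=; rewrite -IH.
  by have /= -> := congr1 (fun k => k (iter i' G w)) hG.
by elim: j => //= j ->; rewrite c1.
Qed.

(** The products [h ^ j * G ^ (R - 1 - j)], indexed cyclically.  As [h ^ R = G ^ R],
    composing with [h] instead of [G] on the right shifts the index by one. *)
Definition word j : P1 -> P1 := iter (j %% R) h \o iter (R.-1 - j %% R) G.

Lemma End_word j : End (word j).
Proof. by apply: End_comp; apply: End_iter. Qed.

Lemma word_fixed j : word j p = p.
Proof. by rewrite /word /= !iter_fixed. Qed.

Lemma wordS j z : word j (h z) = word j.+1 (G z).
Proof.
rewrite /word /=; set i := (j %% R)%N.
have iR : (i < R)%N by rewrite ltn_mod.
have -> : (j.+1 %% R = if i.+1 == R then 0 else i.+1)%N.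
  rewrite -addn1 -modnDml -/i addn1; case: eqP => [->|/eqP ne]; first exact: modnn.
  by rewrite modn_small // ltn_neqAle ne.
rewrite -[h z]/(iter 1 h z) -hG_iter -iterD addn1.
case: eqP => [e|/eqP ne].
  have -> : (R.-1 - i = 0)%N by rewrite -e /= subnn.
  by rewrite e hR /= subn0 -iterSr prednK.
rewrite -iterSr; congr (iter _ h (iter _ G z)).
by move/eqP: ne iR; clear; lia.
Qed.

Lemma mult_lead_word j :
  mult (word j) p = mult (word 0) p /\ lead (word j) p = eta ^+ j * lead (word 0) p.
Proof.
have key u i : End u -> u p = p ->
    mult (iter i h \o u) p = mult (iter i G \o u) p /\
    lead (iter i h \o u) p = eta ^+ i * lead (iter i G \o u) p.
  move=> Eu up; elim: i => [|i [IH1 IH2]]; first by rewrite mul1r.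
  have e1 := End_comp (End_iter i Eh) Eu; have e2 := End_comp (End_iter i EG) Eu.
  have E1 : iter i.+1 h \o u = h \o (iter i h \o u) by [].
  have E2 : iter i.+1 G \o u = G \o (iter i G \o u) by [].
  rewrite E1 E2 (mult_comp p Eh e1) (mult_comp p EG e2) (lead_comp p Eh e1).
  rewrite (lead_comp p EG e2) /= up !iter_fixed // IH1 IH2 mhG lhG; split=> //.
  by rewrite exprMn -exprM [(i * _)%N]mulnC exprM etaM exprS -!mulrA; congr (_ * _); rewrite mulrCA.
have [] := key (iter (R.-1 - j %% R) G) (j %% R)%N (End_iter _ EG) (iter_fixed _ Gp).
have -> : iter (j %% R) G \o iter (R.-1 - j %% R) G = word 0.
  apply/funext => z; rewrite /word /= mod0n subn0 -iterD subnKC //.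
  by rewrite -ltnS prednK // ltn_mod.
by rewrite -/(word j) expr_mod.
Qed.

(** The Lagrange resolvent [\sum_(j < R) eta ^- j * word j], computed in the chart
    at [p]: the shift of the index produces the factor [eta].  It is not
    constant, because its [R] summands have the same leading term. *)
Lemma resolvent : exists la, [/\ End la, la p = Some 0
  & forall z, la (h z) = scaling eta (la (G z))].
Proof.
have eta0 : eta != 0.
  by apply: contra_eq_neq etaR => ->; rewrite expr0n gtn_eqF // eq_sym oner_eq0.
have [E EE] : exists E, E = mult (word 0) p by eexists.
have [a aE] : exists a, a = lead (word 0) p by eexists.
have a0 : a != 0 by rewrite aE; apply/lead_neq0/End_word.
have E0 : (0 < E)%N by rewrite EE; apply/mult_gt0/End_word.
have exg j : exists ND : {poly F} * {poly F}, germ (loc (word j) p) ND.1 ND.2.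
  have [N [D gu]] := endo_germ (endo_loc p (proj1 (End_word j))) (loc0 _ _).
  by exists (N, D).
have [nd ndP] := choice exg; pose N j := (nd j).1; pose D j := (nd j).2.
have D0 j : (D j).[0] != 0 by have [] := ndP j.
have Dn0 j : D j != 0 by apply: germ_neq0 (ndP j).
have NE j : exists t : {poly F}, N j = 'X^E * t /\ t.[0] = eta ^+ j * a * (D j).[0].
  have [mj lj] := mult_lead_word j.
  have l := ldeg_mult p (End_word j); rewrite mj lj -EE -aE in l.
  have [s jt] := jet_ex E.+1 (endo_loc p (proj1 (End_word j))) (loc0 (word j) p).
  have [t [sE ts]] := ldeg_jet l (ltnSn E) jt.
  have [N1 [D1 [g1 /dvdpP[q qE]]]] := jt; have cr := germ_cross (ndP j) g1.
  have [D10 _ _] := g1.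
  have NX : 'X^E %| N j.
    rewrite -(Gauss_dvdpl _ (Xn_coprime E D10)) cr.
    have -> : N1 = (N1 - s * D1) + s * D1 by ring.
    rewrite qE sE; apply: dvdp_mulr; apply: dvdp_add.
      by apply: dvdp_mull; apply: dvdp_exp2l.
    by rewrite -mulrA dvdp_mulr.
  case/dvdpP: NX => t' t'E; exists t'; split; first by rewrite mulrC.
  have e : t' * D1 = (t * D1 + q * 'X) * D j.
    apply: (mulfI (Xn_neq0 F E)).
    transitivity (N j * D1); first by rewrite t'E; ring.
    rewrite cr; have -> : N1 = (N1 - s * D1) + s * D1 by ring.
    by rewrite qE sE exprSr; ring.
  have := congr1 (fun r : {poly F} => r.[0]) e.
  rewrite !(hornerM, hornerD) hornerX mulr0 addr0 ts => e'.
  by apply: (mulIf D10); rewrite e'; ring.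
have [t tE] := choice NE.
pose Qd := \prod_(j < R) D j.
pose Pn := \sum_(j < R) (eta ^- j) *: (N j * \prod_(i < R | i != j) D i).
have Qd0 : Qd.[0] != 0.
  by rewrite horner_prod; apply/prodf_neq0 => i _; apply: D0.
have valE (x : F) : Qd.[x] != 0 -> Pn.[x] / Qd.[x] = \sum_(j < R) eta ^- j * ((N j).[x] / (D j).[x]).
  rewrite /Qd horner_prod => /prodf_neq0 Dx.
  rewrite /Pn horner_sum mulr_suml; apply: eq_bigr => j _.
  have Djx : (D j).[x] != 0 by apply: Dx.
  rewrite hornerZ hornerM horner_prod [X in _ / X = _](bigD1 j) //=.
  have Px : \prod_(i < R | i != j) (D i).[x] != 0 by apply/prodf_neq0 => i _; apply: Dx.
  by field; rewrite Px Djx expf_neq0.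
pose T := \sum_(j < R) (eta ^- j) *: (t j * \prod_(i < R | i != j) D i).
have PnT : Pn = 'X^E * T.
  rewrite /Pn /T big_distrr /=; apply: eq_bigr => j _.
  by have [-> _] := tE j; rewrite -!mul_polyC; ring.
have T0 : T.[0] != 0.
  have -> : T.[0] = \sum_(j < R) a * Qd.[0].
    rewrite /T horner_sum; apply: eq_bigr => j _.
    have [_ t0] := tE j; rewrite hornerZ hornerM t0 /Qd [X in _ = _ * X.[_]](bigD1 j) //= hornerM.
    by field; rewrite expf_neq0.
  by rewrite sumr_const card_ord mulrn_eq0 negb_or -lt0n R0 mulf_neq0.
have PQ : (Pn, Qd) != (0, 0).
  by rewrite xpair_eqE; apply/nandP; right; apply: contraNneq Qd0 => ->; rewrite horner0.
have [la [ela laE]] := mk_endo PQ.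
have laQ (x : F) : Qd.[x] != 0 -> la (Some x) = Some (\sum_(j < R) eta ^- j * ((N j).[x] / (D j).[x])).
  move=> Qx; rewrite laE; last by rewrite xpair_eqE (negPf Qx) andbF.
  by rewrite /hpt (negPf Qx) valE.
have Pn0 : Pn.[0] = 0 by rewrite PnT hornerM hornerXn expr0n gtn_eqF // mul0r.
have la0 : la (Some 0) = Some 0.
  rewrite laE; last by rewrite xpair_eqE (negPf Qd0) andbF.
  by rewrite /hpt (negPf Qd0) Pn0 mul0r.
have Qn0 : Qd != 0 by apply: contraNneq Qd0 => ->; rewrite horner0.
have PnN0 : Pn != 0.
  by rewrite PnT mulf_neq0 ?Xn_neq0 //; apply: contraNneq T0 => ->; rewrite horner0.
have Ela : End la.
  split=> //; case=> c lac; have [bad badP] := rootsP (mulf_neq0 PnN0 Qn0).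
  have [x] := cofinite_exists bad; rewrite -badP hornerM mulf_eq0 negb_or => /andP[Px Qx].
  have := lac (Some x); rewrite -(lac (Some 0)) la0 laQ // -valE // => -[] /eqP.
  by rewrite mulf_eq0 invr_eq0 (negPf Px) (negPf Qx).
have Eun : End (unchart p) by apply/End_deg; [exact: endo_unchart|rewrite deg_unchart].
have Ech : End (chart p) by apply/End_deg; [exact: endo_chart|rewrite deg_chart].
exists (la \o unchart p); split; first exact: End_comp.
  by rewrite /= unchart0.
move=> z; rewrite -(unchartK p z); set x0 := unchart p z.
suff : la \o loc h p = scaling eta \o (la \o loc G p).
  by move/(congr1 (fun k => k x0)); rewrite /loc /= hp Gp.
have Elh : End (loc h p) by rewrite /loc hp; apply: End_comp Ech; apply: End_comp.
have ElG : End (loc G p) by rewrite /loc Gp; apply: End_comp Ech; apply: End_comp.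
have [bad badP] := rootsP Qn0.
have [s1 s1P] := finite_preimage (None :: map Some bad) Elh.
have [s2 s2P] := finite_preimage (None :: map Some bad) ElG.
apply: (@endo_eq _ (s1 ++ s2)).
- by apply: endo_comp => //; case: Elh.
- apply: endo_comp; first by case: (End_scaling eta0).
  by apply: endo_comp => //; case: ElG.
have sm (c : F) : (Some c \in map Some bad) = (c \in bad) by rewrite mem_map // => ? ? [].
move=> x; rewrite mem_cat negb_or => /andP[/s1P + /s2P] /=.
case hx : (loc h p (Some x)) => [y|]; rewrite inE //= sm => yb.
case Gx : (loc G p (Some x)) => [y'|]; rewrite inE //= sm => yb'.
rewrite -!badP in yb yb'; rewrite !laQ //=; congr Some.
have Dy (j : nat) : (D (j %% R)%N).[y] != 0 /\ (D (j %% R)%N).[y'] != 0.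
  have jR : (j %% R < R)%N by rewrite ltn_mod.
  move: yb yb'; rewrite /Qd !horner_prod => /prodf_neq0 h1 /prodf_neq0 h2.
  by have := h1 (Ordinal jR) isT; have := h2 (Ordinal jR) isT.
have vE (j : nat) (c : F) : (D (j %% R)%N).[c] != 0 ->
    word j (chart p (Some c)) = chart p (Some ((N (j %% R)%N).[c] / (D (j %% R)%N).[c])).
  move=> Dc; have [_ _ /(_ c Dc)] := ndP (j %% R)%N.
  rewrite /loc /= word_fixed => e.
  have -> : word j = word (j %% R)%N by rewrite /word modn_mod.
  by rewrite -(unchartK p (word _ _)) e.
have hx' : h (chart p (Some x)) = chart p (Some y).
  by rewrite -hx /loc /= hp unchartK.
have Gx' : G (chart p (Some x)) = chart p (Some y').
  by rewrite -Gx /loc /= Gp unchartK.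
have shift (j : nat) : (N (j %% R)%N).[y] / (D (j %% R)%N).[y] =
    (N (j.+1 %% R)%N).[y'] / (D (j.+1 %% R)%N).[y'].
  have := wordS j (chart p (Some x)); rewrite hx' Gx' !vE; last first.
  - by have [] := Dy j.
  - by have [] := Dy j.+1.
  by move/(congr1 (unchart p)); rewrite !chartK => -[].
pose c (j : nat) : F := eta ^- j * ((N (j %% R)%N).[y'] / (D (j %% R)%N).[y']).
transitivity (eta * \sum_(j < R) c j.+1).
  rewrite big_distrr /=; apply: eq_bigr => j _.
  have := shift j; rewrite [(j %% R)%N]modn_small // => ->.
  by rewrite /c exprS; field; rewrite eta0 expf_neq0 // andbT; have [_ ->] := Dy j.+1.
congr (_ * _); transitivity (\sum_(j < R) c j).
  have e1 : \sum_(i < R.+1) c i = c 0%N + \sum_(i < R) c i.+1.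
    by rewrite big_ord_recl; congr (_ + _); apply: eq_bigr.
  have e2 : \sum_(i < R.+1) c i = \sum_(i < R) c i + c R by rewrite big_ord_recr.
  have cR : c R = c 0%N by rewrite /c modnn mod0n etaR expr0.
  by apply: (addrI (c 0%N)); rewrite -e1 e2 cR addrC.
by apply: eq_bigr => j _; rewrite /c modn_small.
Qed.

End Resolvent.

(** Near [p] the map [h] is [G] followed by a rotation of order [R], and [b]
    generates the functions invariant under this rotation.  The commutation rules
    of [f], [h] and [G] make [b \o f] invariant, so [b \o f = Phi \o b].  The
    [R]-th power of the resolvent [la] is a function [u] of [b]; comparing local
    degrees gives [R * mult la x = mult u (b p) * mult b x] on the fibre of [b p].
    At [x = p], [R] divides [mult b p] and [mult la p] is 1 modulo [R], so
    [mult u (b p)] is prime to [R] and [R] divides all [mult b x]. *)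
Lemma rotation_order f h G p R k eta : End f -> End h -> End G ->
  f p = p -> h p = p -> G p = p -> (0 < k)%N -> R.-primitive_root eta ->
  h \o G = G \o h -> iter R h = iter R G -> f \o G = G \o f ->
  f \o h \o iter k.-1 G = iter k h \o f ->
  mult h p = mult G p -> eta ^+ mult G p = eta -> lead h p = eta * lead G p ->
  (forall s : seq P1, exists j z, iter j f z = p /\ z \notin s) ->
  (R < 3 * deg f ^ 2)%N.
Proof.
move=> Ef Eh EG fp hp Gp k0 prim hG hR fG fh mhG etaM lhG inf.
rewrite ltnNge; apply/negP => big.
have R0 := prim_order_gt0 prim; have etaR := prim_expr_order prim.
have eta0 : eta != 0.
  by apply: contra_eq_neq etaR => ->; rewrite expr0n gtn_eqF // eq_sym oner_eq0.
have [la [Ela lap lah]] :=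
  resolvent Eh EG hp Gp hG R0 hR etaR mhG etaM lhG.
have lG0 : lead G p != 0 by apply: lead_neq0.
have Epow := End_power R0; have Esc := End_scaling eta0.
have [msc lsc] := mult_lead_scaling eta0.
have mla : (R %| (mult la p).-1)%N.
  have E : la \o h = scaling eta \o (la \o G) by apply/funext => z; apply: lah.
  have := congr1 (fun u => lead u p) E.
  rewrite (lead_comp p Ela Eh) (lead_comp p Esc (End_comp Ela EG)) (lead_comp p Ela EG).
  rewrite /= hp Gp lap msc lsc expr1 lhG exprMn.
  set m := mult la p; have m0 : (0 < m)%N by apply: mult_gt0.
  rewrite mulrCA => /(mulIf _) h1.
  have {}h1 : eta ^+ m = eta by apply: h1; rewrite mulf_neq0 ?expf_neq0 // lead_neq0.
  rewrite (prim_order_dvd prim); apply/eqP/(mulfI eta0).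
  by rewrite mulr1 -exprS prednK.
have powS z : power R (scaling eta z) = power R z.
  by case: z => [x|] //=; rewrite exprMn etaR mul1r.
have eq0 : equalizes h G (power R \o la).
  by apply/funext => z; rewrite /= lah powS.
have [b [Eb eqb univ]] := lueroth Eh EG (End_comp Epow Ela) eq0.
have [u [eu uE]] := univ _ (proj1 (End_comp Epow Ela)) eq0.
have nonconst (k1 k2 : P1 -> P1) : endo k1 -> End (k1 \o k2) -> End k1.
  by move=> ev [_ nc]; split=> //; case=> c cE; apply: nc; exists c => z; apply: cE.
have Eu : End u by apply: (nonconst u b) => //; rewrite -uE; apply: End_comp.
have bG j z : b (iter j h z) = b (iter j G z).
  elim: j z => // j IH z; rewrite iterS.
  have /= -> := congr1 (fun k => k (iter j h z)) eqb.
  have := hG_iter hG j 1 z => /= <-.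
  by rewrite IH -iterSr.
have eqbf : equalizes h G (b \o f).
  apply/funext => w; have [z <-] := End_surj w (End_iter k.-1 EG).
  have /= -> := congr1 (fun k => k z) fh.
  rewrite bG; have fGj j x : f (iter j G x) = iter j G (f x).
    elim: j => //= j IH; have /= -> := congr1 (fun k => k (iter j G x)) fG.
    by rewrite IH.
  by rewrite -fGj -{1}(prednK k0).
have [Phi [ePhi PhiE]] := univ _ (proj1 (End_comp Eb Ef)) eqbf.
have EPhi : End Phi by apply: (nonconst Phi b) => //; rewrite -PhiE; apply: End_comp.
have Phi0 : Phi (b p) = b p.
  by have /= <- := congr1 (fun k => k p) PhiE; rewrite fp.
have mE x : b x = b p -> (R * mult la x = mult u (b p) * mult b x)%N.
  move=> bx; have lx : la x = Some 0.
    have := congr1 (fun k => k x) uE; rewrite /= bx.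
    have /= <- := congr1 (fun k => k p) uE; rewrite lap /= expr0n gtn_eqF //.
    case: (la x) => [y|] //= [] /eqP; rewrite expf_eq0 R0 /= => /eqP->//.
  have := congr1 (fun k => mult k x) uE.
  by rewrite (mult_comp x Epow Ela) (mult_comp x Eu Eb) lx mult_power // bx.
have Rb : (R %| mult b p)%N.
  rewrite (prim_order_dvd prim).
  have := congr1 (fun k => lead k p) eqb.
  rewrite (lead_comp p Eb Eh) (lead_comp p Eb EG) hp Gp lhG exprMn.
  move/(mulfI (lead_neq0 _ Eb)) => h1; apply/eqP; apply: (mulIf (expf_neq0 (mult b p) lG0)).
  by rewrite h1 mul1r.
have cop : coprime R (mult u (b p)).
  have [m' mbE] := dvdnP Rb; have := mE p erefl; rewrite mbE mulnA [X in _ = X]mulnC => /eqP.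
  rewrite eqn_mul2l gtn_eqF //= => /eqP mlaE.
  have c1 : coprime R (mult la p).
    have [q qE] := dvdnP mla; have m0 := mult_gt0 p Ela.
    by rewrite -(prednK m0) qE -addn1 /coprime gcdnMDl gcdn1.
  by move: c1; rewrite mlaE coprimeMr => /andP[].
have hRb x : b x = b p -> (R <= mult b x)%N.
  move=> bx; apply: dvdn_leq; first exact: mult_gt0.
  by rewrite -(Gauss_dvdr _ cop) -mE // dvdn_mulr.
have [L LP] := finite_backward_orbit Eb EPhi Ef PhiE Phi0 hRb big.
have [j [z [zj zL]]] := inf L; move/negP: zL; apply.
by apply: (LP j); rewrite zj.
Qed.

End Rotations.

(** * Superattracting cycles with infinite backward orbit *)

(** A prime [q] of [M] not dividing [k] would, for [T = P], have its power
    [q ^ P > P] dividing [P]. *)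
Lemma prime_dvd_of_powers M k P : (0 < P)%N ->
  (forall T, exists J, M ^ T %| k ^ J * P)%N ->
  forall q, prime q -> (q %| M)%N -> (q %| k)%N.
Proof.
move=> P0 h q pq qM; apply: contraT => qk; have [J dv] := h P.
have : (q ^ P %| P)%N.
  rewrite -(@Gauss_dvdr (q ^ P) (k ^ J) P).
    by apply: dvdn_trans dv; apply: dvdn_exp2r.
  by apply/coprimeXl/coprimeXr; rewrite prime_coprime.
by move/(dvdn_leq P0); rewrite leqNgt ltn_expl ?prime_gt1.
Qed.

(** Used with [M] the local degree of a composition of [f] and [g] on a cycle, and
    [k] that of [f]: roots of unity of order [Q] are then permuted by raising to
    the power [M]. *)
Lemma coprime_of_primes M k Q P : (0 < P)%N -> (0 < Q)%N -> (0 < M)%N ->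
  (forall T, exists J, M ^ T %| k ^ J * P)%N -> coprime k Q -> coprime M Q.
Proof.
move=> P0 Q0 M0 h ck; rewrite /coprime eqn_leq gcdn_gt0 M0 andbT leqNgt.
apply/negP => /pdivP[q pq]; rewrite dvdn_gcd => /andP[qM qQ].
have qk := prime_dvd_of_powers P0 h pq qM.
by have := dvdn_gcd q k Q; rewrite (eqP ck) qk qQ dvdn1 => /eqP q1; rewrite q1 in pq.
Qed.

(** The geometric sum is [(M ^ t - 1) / (M - 1)]; Euler's theorem modulo
    [Q * (M - 1)]. *)
Lemma geometric_exponent M Q : (1 < M)%N -> (0 < Q)%N -> coprime M Q ->
  exists t, [/\ (0 < t)%N, (Q %| (M ^ t).-1)%N & (Q %| \sum_(i < t) M ^ i)%N].
Proof.
move=> M1 Q0 cMQ; have M1' : (0 < M.-1)%N by rewrite -subn1 subn_gt0.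
have M0 : (0 < M)%N by apply: ltnW.
exists (totient (Q * M.-1)); split; first by rewrite totient_gt0 muln_gt0 Q0.
all: have := @cyclic.Euler_exp_totient M (Q * M.-1); rewrite coprimeMr cMQ coprimenP // => /(_ isT).
all: set t := totient _; move/eqP; rewrite eqn_mod_dvd ?expn_gt0 ?M0 // subn1.
  by apply: dvdn_trans; apply: dvdn_mulr.
by rewrite predn_exp mulnC dvdn_pmul2l.
Qed.

Section Superattracting.
Local Open Scope ring_scope.
Variable F : numClosedFieldType.
Local Notation P1 := (P1 F).
Variable f : P1 -> P1.
Hypothesis Ef : End f.
Implicit Types (g u v : P1 -> P1) (a x y z w : P1).

(** The factor by which the local coordinate has to be divided for [f] to have
    leading coefficient 1 at a superattracting fixed point; [nlead] is the
    leading coefficient in these coordinates. *)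
Definition theta a : F := (mult f a).-1.-root (lead f a)^-1.
Definition nlead u a : F := lead u a * theta a ^+ mult u a / theta (u a).

Lemma theta_neq0 a : (1 < mult f a)%N -> theta a != 0.
Proof.
move=> m1; rewrite /theta rootC_eq0; last by case: (mult f a) m1 => [|[]].
by rewrite invr_eq0 lead_neq0.
Qed.

Lemma nlead_f a : f a = a -> (1 < mult f a)%N -> nlead f a = 1.
Proof.
move=> fa m1; have t0 := theta_neq0 m1; rewrite /nlead fa.
have l0 : lead f a != 0 by apply: lead_neq0.
have m0 : (0 < (mult f a).-1)%N by case: (mult f a) m1 => [|[]].
have e : theta a ^+ (mult f a).-1 = (lead f a)^-1 by rewrite /theta rootCK.
by rewrite -(prednK (ltnW m1)) exprSr e mulrA divff // mul1r divff.
Qed.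

Lemma nlead_comp u v a : End u -> End v -> (1 < mult f (v a))%N ->
  nlead (u \o v) a = nlead u (v a) * nlead v a ^+ mult u (v a).
Proof.
move=> Eu Ev m1; have t0 := theta_neq0 m1.
rewrite /nlead lead_comp // mult_comp //=.
move: (mult u (v a)) (mult v a) => m m'; rewrite !exprMn exprVn [(m * m')%N]mulnC exprM.
have : theta (v a) ^+ m != 0 by rewrite expf_neq0.
move: (theta (v a) ^+ m) (lead v a ^+ m) (_ ^+ m) (_ ^-1) (lead u _) => X Y Z W V X0.
by field.
Qed.

Lemma nlead_eq u v a : u a = v a -> mult u a = mult v a -> nlead u a = nlead v a ->
  (1 < mult f a)%N -> (1 < mult f (u a))%N -> lead u a = lead v a.
Proof.
move=> e m l ma mua; move: l; rewrite /nlead -e -m.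
have t0 : theta a ^+ mult u a != 0 by rewrite expf_neq0 // theta_neq0.
have t1 : (theta (u a))^-1 != 0 by rewrite invr_eq0 theta_neq0.
by move/(mulIf t1)/(mulIf t0).
Qed.

Variable A : seq P1.
Hypothesis Afix : forall a, a \in A -> f a = a /\ (1 < mult f a)%N.
Hypothesis Ainv : forall g n a, End g -> (0 < n)%N -> comm g f n -> a \in A -> g a \in A.

Section Commuting.
Variables (n k : nat).
Hypothesis n0 : (0 < n)%N.
Hypothesis k1 : (1 < k)%N.

(** The monoid of maps commuting with [iter n f], and the points of [A] where [f]
    has local degree [k]; the former acts on the latter. *)
Definition commuting u := End u /\ comm u f n.
Definition good a := a \in A /\ mult f a = k.

Lemma good1 a : good a -> (1 < mult f a)%N.
Proof. by case=> _ ->. Qed.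

Lemma commuting_comp u v : commuting u -> commuting v -> commuting (u \o v).
Proof.
move=> [Eu cu] [Ev cv]; split; first exact: End_comp.
by move=> z /=; rewrite cv cu.
Qed.

Lemma commuting_f : commuting f.
Proof. by split=> // z; rewrite -iterSr. Qed.

Lemma commuting_id : commuting id.
Proof. by split=> //; apply: End_id. Qed.

Lemma commuting_iter j u : commuting u -> commuting (iter j u).
Proof. by move=> su; elim: j => [|j IH]; [exact: commuting_id|exact: commuting_comp su IH]. Qed.

Lemma iter_comm u z : comm u f n -> u \o iter n f = iter n f \o u.
Proof. by move=> c; apply/funext => x /=; rewrite c. Qed.

Lemma good_commuting u a : commuting u -> good a -> good (u a).
Proof.
move=> [Eu cu] [aA ma]; have uA := Ainv Eu n0 cu aA; split=> //.
have [fa _] := Afix aA; have [fua _] := Afix uA.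
have En := End_iter n Ef.
have := congr1 (fun k => mult k a) (iter_comm a cu).
rewrite (mult_comp a Eu En) (mult_comp a En Eu) iter_fixed // !mult_iter_fixed // ma mulnC.
move/eqP; rewrite eqn_mul2r gtn_eqF ?mult_gt0 //= eqn_exp2r // => /eqP->//.
Qed.

Lemma nlead_iter_f j a : good a -> nlead (iter j f) a = 1.
Proof.
move=> ga; have [fa _] := Afix (proj1 ga); have m1 := good1 ga.
elim: j => [|j IH].
  by rewrite /nlead /= lead_id mult_id expr1 mul1r divff // theta_neq0.
have E : iter j.+1 f = f \o iter j f by [].
rewrite E nlead_comp //; try exact: End_iter; rewrite iter_fixed //.
by rewrite IH expr1n mulr1 nlead_f.
Qed.

(** Compare the leading coefficients of [u \o iter n f] and [iter n f \o u]. *)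
Lemma nlead_root_of_unity u a : commuting u -> good a -> nlead u a ^+ (k ^ n) = nlead u a.
Proof.
move=> su ga; have [Eu cu] := su; have gu := good_commuting su ga.
have [fa _] := Afix (proj1 ga); have [fua _] := Afix (proj1 gu).
have En := End_iter n Ef.
have := congr1 (fun k => nlead k a) (iter_comm a cu).
rewrite nlead_comp //; last by rewrite iter_fixed //; apply: good1.
rewrite nlead_comp //; last exact: good1.
rewrite !nlead_iter_f // expr1n mulr1 mul1r iter_fixed //.
by rewrite mult_iter_fixed // (proj2 gu) => <-.
Qed.

(** The superattracting [iter n f] makes [rigid_super] applicable. *)
Lemma commuting_rigid u v a : commuting u -> commuting v -> good a -> u a = v a ->
  mult u a = mult v a -> nlead u a = nlead v a -> u = v.
Proof.
move=> su sv ga e m l; have [Eu cu] := su; have [Ev cv] := sv.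
have gu := good_commuting su ga.
have [fa _] := Afix (proj1 ga); have [fua _] := Afix (proj1 gu).
apply: (@rigid_super F (iter n f) u v a (End_iter n Ef) Eu Ev); rewrite ?iter_fixed //.
- by rewrite mult_iter_fixed // (proj2 ga) -(expn0 k) ltn_exp2l.
- by rewrite !mult_iter_fixed // (proj2 ga) (proj2 gu).
- exact: nlead_eq e m l (good1 ga) (good1 gu).
- by rewrite iter_comm.
- by rewrite iter_comm.
Qed.

Lemma nlead_iter u a j : commuting u -> good a -> u a = a ->
  nlead (iter j u) a = nlead u a ^+ (\sum_(i < j) mult u a ^ i)%N.
Proof.
move=> su ga ua; elim: j => [|j IH].
  by rewrite big_ord0 expr0 -(nlead_iter_f 0 ga).
have E : iter j.+1 u = iter j u \o u by apply/funext => z; rewrite iterSr.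
rewrite E nlead_comp ?ua //; [|by case: (commuting_iter j su)|by case: su|exact: good1].
rewrite IH mult_iter_fixed //; last by case: su.
by rewrite -exprD big_ord_recr.
Qed.

End Commuting.

Variable p' : P1.
Hypothesis p'A : p' \in A.
Hypothesis inf : forall s : seq P1, exists j z, iter j f z = p' /\ z \notin s.

Lemma expr_dvd_pred (x : F) (Q M : nat) : x ^+ Q = 1 -> (Q %| M.-1)%N -> (0 < M)%N -> x ^+ M = x.
Proof. by move=> xQ /dvdnP[q qE] M0; rewrite -(prednK M0) qE exprS mulnC exprM xQ expr1n mulr1. Qed.

(** Let [g] carry [p'] to a cycle of length [s] containing [a0] and [a1 = g a0],
    let [c] be the normalized leading coefficient of [g] at [a0] and
    [w = iter s.-1 g], which sends [a1] to [a0].  The maps [U = g \o f \o w] and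
    [V = f \o g \o w] fix [a1] with the same local degree [M], and their leading
    coefficients differ by [eta = c ^+ k.-1].  All leading coefficients are roots
    of unity of order [Q = k ^ n - 1], and [M] is prime to [Q]; so a suitable
    power [G] of [U] has leading coefficient 1 and local degree 1 modulo [Q],
    and [h = V \o iter t.-1 U] has coefficient [eta].  By rigidity all relations
    between [f], [h] and [G] required by [rotation_order] can be checked on
    leading terms, and the order [R] of [eta] is bounded.  The numbers
    [c ^+ (k ^ j)] lie in the [R] classes [c * eta ^+ i], so two of them coincide
    for small exponents, and by rigidity [g] commutes with the corresponding
    iterate. *)
Lemma commute_superattracting g n : End g -> (0 < n)%N -> comm g f n ->
  comm g f (3 * deg f ^ 2)`!.
Proof.
move=> Eg n0 cg.
have [fp' k1] := Afix p'A; have [k kE] : exists k, k = mult f p' by eexists.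
rewrite -kE in k1.
have k0 : (0 < k)%N := ltnW k1.
have gp' : good k p' by [].
have sg : commuting n g by [].
have sf := commuting_f n.
have gd u a : commuting n u -> good k a -> good k (u a) by apply: good_commuting.
have itA j : iter j g p' \in A by have [] := gd _ _ (commuting_iter j sg) gp'.
have [i [i' [/andP[ii' _] iE]]] := @pigeonhole _ (fun j => iter j g p') A itA.
pose s := (i' - i)%N; have s0 : (0 < s)%N by rewrite subn_gt0.
pose a0 := iter i g p'; pose a1 := g a0.
have ga0 : good k a0 := gd _ _ (commuting_iter i sg) gp'.
have ga1 : good k a1 := gd _ _ sg ga0.
have [fa0 _] := Afix (proj1 ga0); have [fa1 _] := Afix (proj1 ga1).
have sa0 : iter s g a0 = a0 by rewrite /a0 -iterD subnK ?iE // ltnW.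
pose w := iter s.-1 g; have sw : commuting n w := commuting_iter _ sg.
have wa1 : w a1 = a0 by rewrite /w /a1 -iterSr prednK.
have [Ew _] := sw.
pose U := g \o f \o w; pose V := f \o g \o w.
have sU : commuting n U by apply: commuting_comp => //; apply: commuting_comp.
have sV : commuting n V by apply: commuting_comp => //; apply: commuting_comp.
have [EU _] := sU; have [EV _] := sV.
have Ua : U a1 = a1 by rewrite /U /= wa1 fa0.
have Va : V a1 = a1 by rewrite /V /= wa1 -/a1 fa1.
pose c := nlead g a0; pose M := mult U a1.
have Egf := End_comp Eg Ef; have Efg := End_comp Ef Eg.
have mU : mult U a1 = (mult g a0 * k * mult w a1)%N.
  rewrite /U (mult_comp a1 Egf Ew) wa1 (mult_comp a0 Eg Ef) fa0.
  by rewrite (proj2 ga0).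
have mV : mult V a1 = mult U a1.
  rewrite mU /V (mult_comp a1 Efg Ew) wa1 (mult_comp a0 Ef Eg) -/a1 (proj2 ga1).
  by rewrite [(k * _)%N]mulnC.
have lU : nlead U a1 = c * nlead w a1 ^+ (mult g a0 * k).
  rewrite /U nlead_comp ?wa1 //; last exact: good1 ga0.
  rewrite (mult_comp a0 Eg Ef) fa0 (proj2 ga0) nlead_comp ?fa0 //; last exact: good1 ga0.
  by rewrite nlead_f ?fa0 ?expr1n ?mulr1 //; apply: good1 ga0.
have lV : nlead V a1 = c ^+ k * nlead w a1 ^+ (mult g a0 * k).
  rewrite /V nlead_comp ?wa1 //; last exact: good1 ga0.
  rewrite (mult_comp a0 Ef Eg) -/a1 (proj2 ga1) nlead_comp //; last exact: good1 ga1.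
  rewrite -/a1 (proj2 ga1) nlead_f //; last exact: good1 ga1.
  by rewrite mul1r [(k * _)%N]mulnC.
pose eta := c ^+ k.-1.
have lVU : nlead V a1 = eta * nlead U a1.
  by rewrite lV lU mulrA /eta -exprSr prednK.
pose Q := (k ^ n).-1.
have kn1 : (1 < k ^ n)%N by rewrite -(expn0 k) ltn_exp2l.
have Q0 : (0 < Q)%N by rewrite /Q; case: (k ^ n)%N kn1 => [|[]].
have QE : (k ^ n = Q.+1)%N by rewrite /Q prednK // ltnW.
have nl0 u a : commuting n u -> good k a -> nlead u a != 0.
  move=> su ga; have [Eu _] := su; rewrite /nlead !mulf_neq0 ?lead_neq0 ?expf_neq0 ?invr_eq0 //.
    by apply: theta_neq0; apply: good1 ga.
  by apply: theta_neq0; apply: good1 (gd _ _ su ga).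
have rootQ u a : commuting n u -> good k a -> nlead u a ^+ Q = 1.
  move=> su ga; have := nlead_root_of_unity n0 k1 su ga; rewrite QE exprS.
  by rewrite -[X in _ = X]mulr1 => /(mulfI (nl0 _ _ su ga)).
have cQ : c ^+ Q = 1 by apply: rootQ.
have etaQ : eta ^+ Q = 1 by rewrite /eta -exprM mulnC exprM cQ expr1n.
have c_neq0 : c != 0 by apply: nl0.
have [Cr [uC CP _]] := critical Ef.
pose P := (\prod_(z <- Cr) mult f z)%N.
have P0 : (0 < P)%N.
  rewrite /P; apply: (big_ind (fun m => 0 < m)%N) => // [a b a_gt0 b_gt0|z _].
    by rewrite muln_gt0 a_gt0.
  exact: mult_gt0.
(* Iterates of [g] are unramified at some deep preimage [z] of [p'], so that their
   local degrees at [p'] divide those of iterates of [f] along the orbit of an image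
   of [z], which lands on a point where [f] has local degree [k]. *)
have Mdvd T : exists J, (M ^ T %| k ^ J * P)%N.
  have Msg : M = mult (iter s g) a1 * k.
    have -> : iter s g = g \o w by apply/funext => z; rewrite /w /= -iterS prednK.
    by rewrite /M mU (mult_comp a1 Eg Ew) wa1 mulnAC.
  have sga1 : iter s g a1 = a1 by rewrite /a1 -iterSr iterS sa0.
  have Es := End_iter s Eg.
  have d1 : (mult (iter s g) a1 ^ T %| mult (iter (s * T + i.+1) g) p')%N.
    rewrite (mult_iterD _ _ _ Eg); apply: dvdn_mulr.
    have -> : iter i.+1 g p' = a1 by [].
    by rewrite iter_mulE (mult_iter_fixed _ Es sga1).
  pose u := iter (s * T + i.+1) g; have su : commuting n u := commuting_iter _ sg; have [Eu cu] := su.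
  have [Cu [_ CuP _]] := critical Eu.
  have [j [z [zj]]] := inf Cu; rewrite CuP -leqNgt => mz.
  have mz1 : mult u z = 1%N by apply/eqP; rewrite eqn_leq mz mult_gt0.
  have jJ : (j <= n * j)%N by apply: leq_pmull.
  have zJ : iter (n * j) f z = p'.
    by rewrite -(subnK jJ) iterD zj iter_fixed.
  have EJ := End_iter (n * j) Ef.
  have h : u \o iter (n * j) f = iter (n * j) f \o u.
    by apply/funext => x /=; rewrite (comm_mul _ cu).
  have := congr1 (fun k => mult k z) h.
  rewrite (mult_comp z Eu EJ) (mult_comp z EJ Eu) mz1 muln1 zJ => e.
  have gu := gd _ _ su gp'; have [fu _] := Afix (proj1 gu).
  have := mult_iter_landing Ef uC CP fu (J := n * j) (y := u z).
  rewrite -(comm_mul _ cu) zJ (proj2 gu) => /(_ erefl) d2.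
  exists (T + n * j)%N; rewrite Msg expnMn expnD -mulnA mulnC dvdn_mul //.
  apply: dvdn_trans d1 _; apply: dvdn_trans d2; rewrite -e; exact: dvdn_mulr.
have ckQ : coprime k Q.
  rewrite coprime_sym; have : coprime Q (k ^ n) by rewrite QE coprimenS.
  by rewrite coprime_pexpr.
have M1 : (1 < M)%N.
  rewrite /M mU -mulnA mulnCA; apply: leq_trans k1 _; rewrite leq_pmulr //.
  by rewrite muln_gt0 !mult_gt0.
have cMQ : coprime M Q := coprime_of_primes P0 Q0 (ltnW M1) Mdvd ckQ.
have [t [t0 QMt QSt]] := geometric_exponent M1 Q0 cMQ.
pose G := iter t U; pose h := V \o iter t.-1 U.
have sG : commuting n G := commuting_iter _ sU.
have sh : commuting n h by apply: commuting_comp => //; apply: commuting_iter.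
have [EG _] := sG; have [Eh _] := sh.
have Ga : G a1 = a1 by apply: iter_fixed.
have ha : h a1 = a1 by rewrite /h /= iter_fixed.
have lG : nlead G a1 = 1.
  rewrite (nlead_iter k1 t sU ga1 Ua) -/M; case/dvdnP: QSt => q ->.
  by rewrite mulnC exprM rootQ // expr1n.
have mG : mult G a1 = (M ^ t)%N by rewrite /G mult_iter_fixed.
have EUt := End_iter t.-1 EU.
have GE : G = U \o iter t.-1 U by apply/funext => z; rewrite /G /= -iterS prednK.
have mh : mult h a1 = mult G a1.
  by rewrite GE /h (mult_comp a1 EV EUt) (mult_comp a1 EU EUt) iter_fixed // mV.
have lh : nlead h a1 = eta.
  have m1 : (1 < mult f (iter t.-1 U a1))%N by rewrite iter_fixed //; apply: good1 ga1.
  have := lG; rewrite GE /h (nlead_comp EU EUt m1) (nlead_comp EV EUt m1) iter_fixed // mV lVU => e.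
  by rewrite -mulrA e mulr1.
have Mt0 : (0 < M ^ t)%N by rewrite expn_gt0 (ltnW M1).
have powMt (x : F) : x ^+ Q = 1 -> x ^+ mult G a1 = x.
  by move=> xQ; rewrite mG; apply: expr_dvd_pred xQ QMt Mt0.
have [R prim RQ] := prim_order_exists Q0 etaQ.
have R0 := prim_order_gt0 prim; have etaR := prim_expr_order prim.
have lhj j : nlead (iter j h) a1 = eta ^+ j /\ mult (iter j h) a1 = mult (iter j G) a1.
  elim: j => [|j [IH1 IH2]]; first by rewrite (nlead_iter_f k1 0 ga1).
  have E : iter j.+1 h = iter j h \o h by apply/funext => z; rewrite iterSr.
  have Ej := End_iter j Eh; have m1 : (1 < mult f (h a1))%N by rewrite ha; apply: good1 ga1.
  rewrite !(mult_iter_fixed _ EG Ga) !(mult_iter_fixed _ Eh ha) mh; split=> //.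
  have mj : mult (iter j h) a1 = (mult G a1 ^ j)%N by rewrite mult_iter_fixed // mh.
  rewrite E nlead_comp // ha IH1 lh mj exprSr; congr (_ * _).
  by elim: (j) => // j' IH; rewrite expnS exprM powMt.
have lGj j : nlead (iter j G) a1 = 1.
  by rewrite (nlead_iter k1 j sG ga1 Ga) lG expr1n.
have g1a1 : (1 < mult f a1)%N := good1 k1 ga1.
have bound : (R < 3 * deg f ^ 2)%N.
  apply: (@rotation_order F f h G a1 R k eta) => //.
  - apply: (commuting_rigid n0 k1 (commuting_comp sh sG) (commuting_comp sG sh) ga1).
    + by rewrite /= Ga ha Ga.
    + by rewrite (mult_comp a1 Eh EG) (mult_comp a1 EG Eh) Ga ha mulnC.
    + rewrite (nlead_comp Eh EG) ?Ga // (nlead_comp EG Eh) ?ha // lG lh.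
      by rewrite expr1n mul1r mulr1 powMt.
  - apply: (commuting_rigid n0 k1 (commuting_iter R sh) (commuting_iter R sG) ga1).
    + by rewrite !iter_fixed.
    + by have [_ ->] := lhj R.
    + by have [-> _] := lhj R; rewrite lGj etaR.
  - apply: (commuting_rigid n0 k1 (commuting_comp sf sG) (commuting_comp sG sf) ga1).
    + by rewrite /= fa1 Ga fa1.
    + by rewrite (mult_comp a1 Ef EG) (mult_comp a1 EG Ef) Ga fa1 mulnC.
    + rewrite (nlead_comp Ef EG) ?Ga // (nlead_comp EG Ef) ?fa1 // lG nlead_f //.
      by rewrite !expr1n.
  - apply: (commuting_rigid n0 k1 (commuting_comp (commuting_comp sf sh) (commuting_iter k.-1 sG))
       (commuting_comp (commuting_iter k sh) sf) ga1).
    + by rewrite /= fa1 !iter_fixed // ha fa1.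
    + have Efh := End_comp Ef Eh; have EGk := End_iter k.-1 EG; have Ehk := End_iter k Eh.
      rewrite (mult_comp a1 Efh EGk) (mult_comp a1 Ehk Ef) fa1 iter_fixed //.
      rewrite (mult_comp a1 Ef Eh) ha !mult_iter_fixed // mh (proj2 ga1).
      by rewrite -/M -mG -mulnA -expnS prednK // mulnC.
    + have Efh := End_comp Ef Eh; have EGk := End_iter k.-1 EG; have Ehk := End_iter k Eh.
      rewrite (nlead_comp Efh EGk) ?iter_fixed // lGj expr1n mulr1.
      rewrite (nlead_comp Ef Eh) ?ha // nlead_f // mul1r lh (proj2 ga1).
      rewrite (nlead_comp Ehk Ef) ?fa1 // nlead_f // expr1n mulr1.
      by have [-> _] := lhj k.
  - exact: powMt.
  - have t1 : theta a1 ^+ mult G a1 != 0 by rewrite expf_neq0 // theta_neq0.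
    have t2 : (theta a1)^-1 != 0 by rewrite invr_eq0 theta_neq0.
    apply: (mulIf t1); apply: (mulIf t2); move: lG lh; rewrite /nlead mh Ga ha.
    by move=> e ->; rewrite -!mulrA [lead G a1 * _]mulrA e mulr1.
  move=> l; have [l' l'P] := preimage_seq l (End_iter i.+1 Eg).
  have [j [z [zj zl]]] := inf l'; exists (n * j)%N, (iter i.+1 g z); split.
    rewrite -(comm_mul j (proj2 (commuting_iter i.+1 sg))).
    have jJ : (j <= n * j)%N by apply: leq_pmull.
    by rewrite -(subnK jJ) iterD zj (iter_fixed _ fp').
  by apply: contra zl => /l'P.
(* [c ^+ (k ^ j)] is [c] times the power of [eta] of exponent [\sum_(i < j) k ^ i] *)
have [j [j' [/andP[jj js] je]]] : exists j j' : nat, (j < j' <= R)%N /\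
    c ^+ (k ^ j) = c ^+ (k ^ j').
  have hin j : c ^+ (k ^ j) \in [seq c * eta ^+ i | i <- iota 0 R].
    have kj0 : (0 < k ^ j)%N by rewrite expn_gt0 k0.
    apply/mapP; exists ((\sum_(i < j) k ^ i) %% R)%N; first by rewrite mem_iota ltn_mod.
    rewrite (prim_expr_mod prim) /eta -exprM -predn_exp -exprS prednK //.
  have [j [j' [jj e]]] := pigeonhole hin.
  by exists j, j'; move: jj; rewrite size_map size_iota.
have ckn m : c ^+ (k ^ (n * m)) = c.
  have cs := nlead_root_of_unity n0 k1 sg ga0; rewrite -/c in cs.
  by elim: m => [|m IH]; rewrite ?muln0 ?expr1 // mulnS expnD exprM cs.
have ct : c ^+ (k ^ (j' - j)) = c.
  have jn : (j <= n * j)%N by apply: leq_pmull.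
  have := congr1 (fun x : F => x ^+ (k ^ (n * j - j))) je; rewrite -!exprM -!expnD subnKC // ckn.
  have -> : (j' + (n * j - j) = n * j + (j' - j))%N.
    by move: jn (ltnW jj); clear; move: (n * j)%N => m; lia.
  by rewrite expnD exprM ckn => <-.
have tpos : (0 < j' - j <= (3 * deg f ^ 2))%N.
  rewrite subn_gt0 jj /=; apply: leq_trans (leq_subr _ _) _.
  by apply: leq_trans js _; apply: ltnW.
apply: (@comm_dvd _ g f (j' - j)); first by rewrite dvdn_fact.
have sft := commuting_iter (j' - j) sf; have [Eft _] := sft.
have E : g \o iter (j' - j) f = iter (j' - j) f \o g.
  apply: (commuting_rigid n0 k1 (commuting_comp sg sft) (commuting_comp sft sg) ga0).
  - by rewrite /= !iter_fixed // -/a1.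
  - rewrite (mult_comp a0 Eg Eft) (mult_comp a0 Eft Eg) !mult_iter_fixed // iter_fixed // -/a1.
    by rewrite (proj2 ga0) (proj2 ga1) mulnC.
  - have m0 : (1 < mult f (iter (j' - j) f a0))%N by rewrite (iter_fixed _ fa0); exact: (good1 k1 ga0).
    rewrite (nlead_comp Eg Eft m0) (nlead_comp Eft Eg (good1 k1 ga1)) (iter_fixed _ fa0).
    rewrite -/a1 !(nlead_iter_f k1) // expr1n mulr1 mul1r mult_iter_fixed //.
    by rewrite (proj2 ga1) -/c ct.
by move=> z; have := congr1 (fun k => k z) E.
Qed.

Lemma stabilizes_superattracting : stabilizes f.
Proof.
exists (3 * deg f ^ 2)`!; split; first exact: fact_gt0.
by move=> g n Eg n0 cg; apply: commute_superattracting cg.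
Qed.

End Superattracting.

(** * Exceptional points and power maps *)

Section Exceptional.
Local Open Scope ring_scope.
Variable F : numClosedFieldType.
Local Notation P1 := (P1 F).
Implicit Types (f g u v : P1 -> P1) (a z w : P1) (p q : {poly F}) (x : F).

Definition power_conjugate f := exists d u v, (0 < d)%N /\
  [/\ endo u, endo v, u \o v = id, v \o u = id &
  f = u \o @power F d \o v \/ f = u \o (@inversion F \o @power F d) \o v].

(** In lowest terms the denominator has no root and the numerator no root but 0. *)
Lemma totally_fixed_scaling f : End f -> f None = None -> f (Some 0) = Some 0 ->
  (forall z, f z = None -> z = None) -> (forall z, f z = Some 0 -> z = Some 0) ->
  exists c, c != 0 /\ f = scaling c \o @power F (deg f).
Proof.
move=> Ef fN f0 tN t0; have [p [q rf]] := degP (proj1 Ef).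
have nq (x : F) : q.[x] != 0.
  apply/eqP => qx; have := represents_fin x rf; rewrite qx /hpt eqxx.
  by move/tN.
have sq : size q = 1%N.
  apply/eqP; apply: contraT => /closed_rootP[x /rootP qx].
  by have := nq x; rewrite qx eqxx.
have [b b0 qE] : exists2 b, b != 0 & q = b%:P by apply/size_poly1P; rewrite sq.
have pr (x : F) : p.[x] = 0 -> x = 0.
  move=> px; have := represents_fin x rf; rewrite px /hpt (negPf (nq x)) mul0r.
  by move/t0 => -[].
have sp : size p = (deg f).+1.
  have := represents_size rf; have := deg_gt0 Ef; rewrite sq.
  by move: (size p) (deg f) => s d d0; rewrite /maxn; case: ltnP => // _ [] d1; rewrite -d1 in d0.
have [rs pE] := closed_field_poly_normal p.
have lp0 : lead_coef p != 0 by rewrite lead_coef_eq0 -size_poly_eq0 sp.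
have rs0 : rs = nseq (deg f) 0.
  have <- : size rs = deg f.
    by move: sp; rewrite pE size_scale // size_prod_XsubC => -[].
  apply/all_pred1P/allP => x xs /=; apply/eqP/pr/rootP.
  by rewrite pE rootZ // root_prod_XsubC.
have {}pE (x : F) : p.[x] = lead_coef p * x ^+ deg f.
  rewrite [in LHS]pE hornerZ rs0; congr (_ * _).
  rewrite horner_prod big_nseq iter_mulr_1.
  by rewrite hornerD hornerN hornerX hornerC subr0.
exists (lead_coef p / b); split; first by rewrite mulf_neq0 // invr_eq0.
apply/funext => -[x|] //=; rewrite (represents_finE rf (nq x)) pE qE hornerC.
by congr Some; field.
Qed.

Lemma End_inversion : End (@inversion F).
Proof.
apply/End_deg; first exact: (@endo_chart F None).
by have := deg_chart (None : P1) => /= ->.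
Qed.

(** Conjugation by [scaling t] multiplies [c] by [t ^+ d.-1], respectively by
    [t ^+ d.+1]. *)
Lemma scaling_power_conj (c : F) d : (1 < d)%N -> c != 0 ->
  power_conjugate (scaling c \o @power F d) /\
  power_conjugate (@inversion F \o (scaling c \o @power F d)).
Proof.
move=> d1 c0; have d0 : (0 < d)%N := ltnW d1.
have sK (t : F) : t != 0 -> scaling t \o scaling t^-1 = id.
  move=> t0; apply/funext => -[x|] //=; congr Some; by rewrite mulrA divff // mul1r.
have sK' (t : F) : t != 0 -> scaling t^-1 \o scaling t = id.
  move=> t0; apply/funext => -[x|] //=; congr Some; by rewrite mulrA mulVf // mul1r.
have es (t : F) : t != 0 -> endo (scaling t) by move=> t0; case: (End_scaling t0).
split.
- have m0 : (0 < d.-1)%N by rewrite -subn1 subn_gt0.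
  pose t : F := d.-1.-root c^-1.
  have t0 : t != 0 by rewrite rootC_eq0 // invr_eq0.
  have te : t ^+ d.-1 = c^-1 by rewrite rootCK.
  have ti : t^-1 != 0 by rewrite invr_eq0.
  exists d, (scaling t), (scaling t^-1); split=> //; split; [exact: es|exact: es|exact: sK|exact: sK'|left].
  apply/funext => -[x|] //=; congr Some.
  rewrite exprMn exprVn -{2}(prednK d0) exprS te; field.
  by rewrite c0 t0.
- pose t : F := d.+1.-root c^-1.
  have t0 : t != 0 by rewrite rootC_eq0 // invr_eq0.
  have te : t ^+ d.+1 = c^-1 by rewrite rootCK.
  have ti : t^-1 != 0 by rewrite invr_eq0.
  exists d, (scaling t), (scaling t^-1); split=> //; split; [exact: es|exact: es|exact: sK|exact: sK'|right].
  apply/funext => -[x|] /=; last by rewrite mulr0.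
  rewrite !mulf_eq0 !expf_eq0 d0 (negPf c0) mulf_eq0 (negPf ti) /=.
  case: eqP => //= /eqP x0; congr Some.
  have td : t ^+ d != 0 by rewrite expf_neq0.
  have xd : x ^+ d != 0 by rewrite expf_neq0.
  rewrite exprMn exprVn !invfM !invrK mulrA -exprS te //.
Qed.

Lemma power_conjugate_conj f u v : endo u -> endo v -> u \o v = id -> v \o u = id ->
  power_conjugate (v \o f \o u) -> power_conjugate f.
Proof.
move=> eu ev uv vu [d [a [b [d0 [ea eb ab ba h]]]]].
have uvE z : u (v z) = z by have := congr1 (fun k => k z) uv.
have vuE z : v (u z) = z by have := congr1 (fun k => k z) vu.
have abE z : a (b z) = z by have := congr1 (fun k => k z) ab.
have baE z : b (a z) = z by have := congr1 (fun k => k z) ba.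
exists d, (u \o a), (b \o v); split=> //; split; [exact: endo_comp|exact: endo_comp| | |].
- by apply/funext => z /=; rewrite abE uvE.
- by apply/funext => z /=; rewrite vuE baE.
have fE : f = u \o (v \o f \o u) \o v by apply/funext => z /=; rewrite !uvE.
by case: h => h; [left|right]; rewrite fE h.
Qed.

(** The map [f] permutes [B], and its points are alone in their fibres, hence
    totally ramified; Riemann-Hurwitz leaves exactly two of them.  Moved to 0 and
    infinity, they are fixed by [f], or exchanged, in which case [f] is followed
    by the inversion. *)
Lemma exceptional_power f (B : seq P1) : End f -> (1 < deg f)%N -> uniq B ->
  (forall z, (f z \in B) = (z \in B)) -> (forall z, (1 < mult f z)%N -> z \in B) ->
  power_conjugate f.
Proof.
move=> Ef d1 uB fB cB.
have uf : uniq (map f B).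
  apply: (leq_size_uniq uB); last by rewrite size_map.
  move=> z zB; have [w wz] := End_surj z Ef.
  by rewrite -wz map_f // -fB wz.
have inj z w : z \in B -> f w = f z -> w = z.
  move=> zB e; have wB : w \in B by rewrite -fB e fB.
  have := nth_uniq (f z) (s := map f B) (i := index w B) (j := index z B).
  rewrite size_map !index_mem => /(_ wB zB uf).
  rewrite !(nth_map z) ?index_mem // !nth_index // e eqxx => /esym/eqP h.
  by rewrite -(nth_index z wB) h nth_index.
have mB z : z \in B -> mult f z = deg f.
  move=> zB; have [s [us sP <-]] := fibre (f z) Ef.
  have ps : perm_eq s [:: z].
    apply: uniq_perm => // w; rewrite inE; apply/idP/eqP => [/sP|->]; last exact/sP.
    exact: inj.
  by rewrite (perm_big _ ps) big_seq1.
have [Cr [uC CP CS]] := critical Ef.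
have pB : perm_eq B Cr.
  apply: uniq_perm => // z; rewrite CP; apply/idP/idP => [zB|]; last exact: cB.
  by rewrite mB.
have sB : size B = 2%N.
  move: CS; rewrite -(perm_big _ pB) big_seq (eq_bigr (fun=> (deg f).-1)); last first.
    by move=> z zB; rewrite mB.
  rewrite -big_seq big_const_seq count_predT iter_addn_0 mulnC => /eqP.
  have -> : (2 * deg f - 2 = 2 * (deg f).-1)%N by rewrite -subn1 mulnBr.
  by rewrite eqn_mul2r -subn1 subn_eq0 leqNgt d1 /= => /eqP.
case: B sB {uf pB} uB fB cB inj mB => [|a [|c [|? ?]]] // _ uB fB cB inj mB.
have ac : a <> c by move: uB; rewrite /= inE andbT => /eqP.
have onlyB (y z : P1) : y \in [:: a; c] -> f z = f y -> z = y by apply: inj.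
have K := from_infK c; have K' := to_infK c.
have [E1 E2] := End_from_inf c.
have tc : to_inf c c = None by rewrite -{2}(from_inf_None c) K.
case ta : (to_inf c a) => [tau|]; last by case: ac; rewrite -(K' a) ta from_inf_None.
pose u := from_inf c \o translation tau; pose v := translation (- tau) \o to_inf c.
have et t : endo (@translation F t) := @endo_chart F (Some t).
have tK t : @translation F (- t) \o translation t = id.
  by apply/funext => z; apply: (@chartK F (Some t)).
have tK' t : @translation F t \o translation (- t) = id.
  by apply/funext => z; apply: (@unchartK F (Some t)).
have uvE z : u (v z) = z.
  rewrite /u /v /=; have /= -> := congr1 (fun k => k (to_inf c z)) (tK' tau).
  exact: K'.
have vuE z : v (u z) = z.
  rewrite /u /v /= K; by have /= -> := congr1 (fun k => k z) (tK tau).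
have eu : endo u by apply: endo_comp => //; case: E1.
have ev : endo v by apply: endo_comp => //; case: E2.
have u0 : u (Some 0) = a by rewrite /u /= add0r -ta K'.
have uN : u None = c by rewrite /u /= from_inf_None.
have uv : u \o v = id by apply/funext => z /=; rewrite uvE.
have vu : v \o u = id by apply/funext => z /=; rewrite vuE.
apply: (power_conjugate_conj eu ev uv vu); set f' := v \o f \o u.
have Euv (k k' : P1 -> P1) : endo k -> k' \o k = id -> End k.
  move=> ek kk; split=> //; case=> w kw; have := congr1 (fun k => k None) kk.
  by have := congr1 (fun k => k (Some 0)) kk; rewrite /= !kw => ->.
have Eu := Euv u v eu vu; have Ev := Euv v u ev uv.
have Ef' : End f' by apply: End_comp => //; apply: End_comp.
have du : deg u = 1%N.
  have := congr1 (@deg _) uv; rewrite deg_comp // deg_id => /eqP.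
  by rewrite muln_eq1 => /andP[/eqP].
have dv : deg v = 1%N.
  have := congr1 (@deg _) uv; rewrite deg_comp // deg_id => /eqP.
  by rewrite muln_eq1 => /andP[_ /eqP].
have df' : deg f' = deg f.
  rewrite /f' (deg_comp (proj1 (End_comp Ev Ef)) eu) (deg_comp ev (proj1 Ef)).
  by rewrite du dv mul1n muln1.
have va : v a = Some 0 by rewrite -u0 vuE.
have vc : v c = None by rewrite -uN vuE.
have aB : a \in [:: a; c] by rewrite inE eqxx.
have cB' : c \in [:: a; c] by rewrite !inE eqxx orbT.
have uinj z w : u z = w -> z = v w by move=> <-; rewrite vuE.
have sw z w : v (f (u z)) = w -> f (u z) = u w by move=> <-; rewrite uvE.
have := fB a; rewrite aB !inE => /orP[] /eqP fa.
  have fc : f c = c.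
    have := fB c; rewrite cB' !inE => /orP[] /eqP fc //.
    by case: ac; apply/esym/(onlyB a c aB); rewrite fa.
  have [||||k [k0 kE]] := @totally_fixed_scaling f' Ef'.
  - by rewrite /f' /= uN fc vc.
  - by rewrite /f' /= u0 fa va.
  - move=> z /sw; rewrite uN -fc => /(onlyB c _ cB')/uinj ->; exact: vc.
  - move=> z /sw; rewrite u0 -{1}fa => /(onlyB a _ aB)/uinj ->; exact: va.
  by rewrite kE df'; case: (scaling_power_conj d1 k0).
have fc : f c = a.
  have := fB c; rewrite cB' !inE => /orP[] /eqP fc //.
  by case: ac; apply/esym/(onlyB a c aB); rewrite fa.
have Einv := End_inversion.
have dinv : deg (@inversion F) = 1%N := deg_chart (None : P1).
have iK : @inversion F \o (@inversion F \o f') = f'.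
  by apply/funext => z /=; rewrite inversionK.
have Eif := End_comp Einv Ef'.
have iN z : inversion z = None -> z = Some 0 :> P1.
  by move=> e; rewrite -(inversionK z) e.
have i0 z : inversion z = Some 0 -> z = None :> P1.
  by move=> e; rewrite -(inversionK z) e /= eqxx.
have [||||k [k0 kE]] := @totally_fixed_scaling _ Eif.
- by rewrite /f' /= uN fc va /= eqxx.
- by rewrite /f' /= u0 fa vc.
- move=> z /iN /sw; rewrite u0 -{1}fc => /(onlyB c _ cB')/uinj ->; exact: vc.
- move=> z /i0 /sw; rewrite uN -{1}fa => /(onlyB a _ aB)/uinj ->; exact: va.
have dE : deg (@inversion F \o f') = deg f.
  by rewrite (deg_comp (proj1 Einv) (proj1 Ef')) dinv mul1n df'.
by rewrite -iK kE dE; case: (scaling_power_conj d1 k0).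
Qed.

(** * Combining the cases *)

Lemma stabilizes_iter f m : (0 < m)%N -> stabilizes (iter m f) -> stabilizes f.
Proof.
move=> m0 [N [N0 h]]; exists (m * N)%N; split; first by rewrite muln_gt0 m0.
move=> g n Eg n0 cg z; rewrite iter_mulE; apply: (h g n Eg n0) => w.
by rewrite -iter_mulE (comm_dvd _ cg) // dvdn_mull.
Qed.

(** Either some point of the finite set [A] of superattracting periodic points on
    which critical orbits land has an infinite backward orbit, or the union of the
    backward orbits of the points of [A] is exceptional.  The set [A] is preserved
    by commuting maps, since local degrees of [iter J f] at [a] and [g a] agree
    when [iter J f] fixes [a] and commutes with [g]. *)
Lemma stabilizes_superattracting_landing f (Cr : seq P1) : End f -> (1 < deg f)%N ->
  (forall z, (z \in Cr) = (1 < mult f z)%N) ->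
  (forall z, z \in Cr -> preperiodic f z) ->
  (forall c, c \in Cr -> exists i, periodic f (iter i f c) /\
     exists j, (1 < mult (iter j f) (iter i f c))%N) ->
  power_conjugate f \/ stabilizes f.
Proof.
move=> Ef d1 CrP pre land.
have [L LP] := orbits_seq pre.
pose P y := periodic f y /\ exists j, (1 < mult (iter j f) y)%N.
pose A : seq P1 := [seq y <- L | `[< P y >]].
have AP y : y \in A <-> P y.
  rewrite mem_filter; split; first by case/andP => /asboolP.
  move=> Py; rewrite (asboolT Py) /=; have [[m [m0 my]] [j mj]] := Py.
  have [k [kj mk]] := mult_iter_crit Ef mj.
  have km : (k <= m * k)%N by apply: leq_pmull.
  have <- : iter (m * k - k) f (iter k f y) = y.
    by rewrite -iterD subnK //; have := iter_cycle 0 k my; rewrite add0n.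
  by apply: LP; rewrite CrP.
have Ainv g n a : End g -> (0 < n)%N -> comm g f n -> a \in A -> g a \in A.
  move=> Eg n0 cg /AP[pa [j mj]]; apply/AP; split; first exact: periodic_comm cg n0 pa.
  have [m [m0 ma]] := pa; pose J := (n * (m * j))%N.
  have jJ : (j <= J)%N.
    by rewrite /J mulnA leq_pmull // muln_gt0 n0.
  have aJ : iter J f a = a.
    rewrite /J mulnCA; by have := iter_cycle 0 (n * j) ma; rewrite add0n.
  exists J; have EJ := End_iter J Ef.
  have h : iter J f \o g = g \o iter J f by apply/funext => z /=; rewrite (comm_mul _ cg).
  have := congr1 (fun k => mult k a) h.
  rewrite (mult_comp a EJ Eg) (mult_comp a Eg EJ) aJ mulnC => /eqP.
  rewrite eqn_mul2l gtn_eqF ?mult_gt0 //= => /eqP ->.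
  by apply: leq_trans mj _; apply: mult_iter_le.
have fA a : a \in A -> f a \in A by apply: (Ainv f 1%N).
have fAi a i : a \in A -> iter i f a \in A by move=> aA; elim: i => //= i; apply: fA.
(* an iterate fixes [A] pointwise and is ramified at each of its points *)
have [m [m0 mA]] : exists m, (0 < m)%N /\
    forall a, a \in A -> a \in A /\ (iter m f a = a /\ (1 < mult (iter m f) a)%N).
  apply: (@common_multiple _ A
     (fun a m => a \in A /\ (iter m f a = a /\ (1 < mult (iter m f) a)%N))).
    move=> a aA; have [[n [n0 na]] [j mj]] := proj1 (AP a) aA.
    have j0 : (0 < j)%N by case: j mj => //; rewrite mult_id.
    exists (n * j)%N; split; first by rewrite muln_gt0 n0.
    split=> //; split; first by have := iter_cycle 0 j na; rewrite add0n.
    by apply: leq_trans mj _; apply: mult_iter_le => //; apply: leq_pmull.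
  move=> a n k n0 k0 [aA [na mn]]; split=> //; split.
    by have := iter_cycle 0 k na; rewrite add0n.
  by apply: leq_trans mn _; apply: mult_iter_le => //; apply: leq_pmulr.
have Em := End_iter m Ef.
have [[p [pA inf]]|fin] := pselect (exists p : P1, p \in A /\
   forall s : seq P1, exists j z, iter j (iter m f) z = p /\ z \notin s).
  right; apply: (stabilizes_iter m0).
  apply: (@stabilizes_superattracting F (iter m f) Em A _ _ p pA inf).
    by move=> a /mA[_].
  move=> g n a Eg n0 cg; apply: (Ainv g (m * n)%N) => //; first by rewrite muln_gt0 m0.
  by move=> z; rewrite iter_mulE.
left; have [S SP] : exists S : seq P1, forall a j z, a \in A -> iter j (iter m f) z = a -> z \in S.
  have : forall a, a \in A -> exists s : seq P1, forall j z, iter j (iter m f) z = a -> z \in s.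
    move=> a aA; apply: contrapT => h; apply: fin; exists a; split=> // s.
    apply: contrapT => h'; apply: h; exists s => j z zj; apply: contrapT => /negP zs.
    by apply: h'; exists j, z.
  elim: (A) => [|a l IH] h; first by exists [::].
  have [|S SP] := IH; first by move=> b bl; apply: h; rewrite inE bl orbT.
  have [s sP] := h a (mem_head _ _); exists (s ++ S) => b j z.
  rewrite inE mem_cat => /orP[/eqP->|bl e]; first by move/sP->.
  by rewrite (SP b j z bl e) orbT.
(* the union of the backward orbits *)
pose inB z := exists j, iter j (iter m f) z \in A.
pose B : seq P1 := undup [seq z <- S | `[< inB z >]].
have BP z : z \in B <-> inB z.
  rewrite mem_undup mem_filter; split; first by case/andP => /asboolP.
  move=> zB; rewrite (asboolT zB) /=; case: zB => j jA.
  exact: (SP _ j z jA erefl).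
have toB z i : iter i f z \in A -> inB z.
  move=> iA; exists i; rewrite -iter_mulE.
  by rewrite -(subnK (leq_pmull i m0)) iterD fAi.
apply: (@exceptional_power f B Ef d1 (undup_uniq _)).
  move=> z; apply/idP/idP => /BP[j jA]; apply/BP.
    by apply: (toB _ (m * j).+1); rewrite iterSr iter_mulE.
  by apply: (toB _ (m * j)%N); rewrite -iterSr iterS iter_mulE fA.
move=> z; rewrite -CrP => zC; apply/BP; have [i li] := land z zC.
by apply: (toB z i); apply/AP.
Qed.

Theorem stabilizes_or_power f : End f -> power_conjugate f \/ stabilizes f.
Proof.
move=> Ef; have d0 := deg_gt0 Ef.
have [d1|d1] := leqP (deg f) 1.
  by right; apply: stabilizes_automorphism => //; apply/eqP; rewrite eqn_leq d1.
have [Cr [uC CP CS]] := critical Ef.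
have [[c [cC cw]]|pre] := pselect (exists c, c \in Cr /\ ~ preperiodic f c).
  by right; apply: (stabilizes_infinite_critical_orbit Ef uC CP cC cw).
have {}pre z : z \in Cr -> preperiodic f z.
  by move=> zC; apply: contrapT => h; apply: pre; exists z.
have [[c [i [cC [per ns]]]]|land] := pselect (exists c i, c \in Cr /\
    periodic f (iter i f c) /\ forall j, mult (iter j f) (iter i f c) = 1%N).
  by right; apply: stabilizes_repelling_landing CP pre cC per ns.
apply: (stabilizes_superattracting_landing Ef d1 CP pre) => c cC.
have [i [j [ij e]]] := pre c cC; exists i; split.
  exists (j - i)%N; rewrite subn_gt0 ij; split=> //.
  by rewrite -iterD subnK // ltnW.
apply: contrapT => h; apply: land; exists c, i; split=> //; split.
  exists (j - i)%N; rewrite subn_gt0 ij; split=> //.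
  by rewrite -iterD subnK // ltnW.
move=> k; apply/eqP; rewrite eqn_leq mult_gt0 ?andbT; last exact: End_iter.
by rewrite leqNgt; apply/negP => hk; apply: h; exists k.
Qed.

End Exceptional.

Local Open Scope complex_scope.

Theorem corollary1p4 (R : realType) (f : P1 R[i] -> P1 R[i]) :
  End_plus f ->
  ~ (exists g : P1 R[i] -> P1 R[i], power_map g /\ conjugate f g) ->
  exists N : nat, (1 <= N)%N /\ centralizer_infty f = centralizer (iter N f).
Proof.
move=> Ef npow.
have [pc|[N [N0 NP]]] := @stabilizes_or_power R[i] f Ef.
  exfalso; apply: npow; have [d [u [v [d0 [eu ev uv vu h]]]]] := pc.
  have hp (x y : R[i]) : power d (hpt x y) = hpt (x ^+ d)%R (y ^+ d)%R.
    rewrite /hpt /power expf_eq0 d0 /=; case: eqP => // _.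
    by rewrite expr_div_n.
  have hi (x y : R[i]) : (x, y) != (0, 0)%R -> inversion (hpt x y) = hpt y x.
    have [_ _ _ iE] := represents_inversion R[i].
    move=> xy; rewrite iE // !form1 !coefX !coef1 /=.
    by rewrite !mul0r !mul1r addr0 add0r.
  case: h => h; [exists (power d)|exists (@inversion _ \o power d)].
    split; last by exists u, v.
    by exists d; split=> //; left=> x y _; apply: hp.
  split; last by exists u, v.
  exists d; split=> //; right=> x y xy; rewrite /= hp hi //.
  by rewrite !xpair_eqE !expf_eq0 d0 -xpair_eqE.
exists N; split=> //; apply/seteqP; split=> g.
  move=> [n n1 [Eg gc]]; split=> //; apply/funext => z /=.
  apply: (NP g n Eg n1) => w.
  by have := congr1 (fun k => k w) gc.
by move=> gN; exists N.
Qed.
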